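(* Assume that $q^+<\varphi^-_{\min}$. Then there exist two positive constants $\lambda_*>0$ and $\lambda^*>0$ such that every $\lambda\in(0,\lambda_* )\cup[\lambda^*,\infty)$ is an eigenvalue of Problem $(P_a)$; that is, for every such $\lambda$ there exists $u\in W\setminus\{0\}$ such that $$\int_{Q}\sum_{i=1}^{N}a_i(|D^{s}u|)\,D^{s}u\,D^{s}v\,d\mu=\lambda\int_{\Omega}|u|^{q(x)-2}uv\,dx\qquad\text{for all } v\in W.$$
   Context: Let $N\ge 1$, $0<s<1$, and let $\Omega\subset\mathbb{R}^N$ be a bounded open set with Lipschitz ($C^{0,1}$) boundary. Let $q\in C(\overline{\Omega})$ with $q(x)>1$ for all $x\in\overline\Omega$; $q^-=\inf_{\overline\Omega}q$, $q^+=\sup_{\overline\Omega}q$. For $i=1,\dots,N$ let $a_i:\mathbb{R}\to\mathbb{R}$ be such that $\varphi_i(t)=a_i(|t|)t$ for $t\ne0$, $\varphi_i(0)=0$, is an increasing homeomorphism of $\mathbb{R}$ onto itself, and let $\Phi_i(t)=\int_0^t\varphi_i(\tau)\,d\tau$. Standing assumptions, for every $i$: (a) $1<\varphi_i^-:=\inf_{t>0}\frac{t\varphi_i(t)}{\Phi_i(t)}\le\varphi_i^+:=\sup_{t>0}\frac{t\varphi_i(t)}{\Phi_i(t)}<+\infty$; (b) $t\mapsto\Phi_i(\sqrt t)$ is convex on $[0,\infty)$. Moreover there is $j\in\{1,\dots,N\}$ such that (c) $\int_0^1\frac{\Phi_j^{-1}(\tau)}{\tau^{(N+s)/N}}d\tau<\infty$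 and $\int_1^\infty\frac{\Phi_j^{-1}(\tau)}{\tau^{(N+s)/N}}d\tau=\infty$; (d) with $(\Phi_j)_*$ defined through its inverse $(\Phi_j)_*^{-1}(t)=\int_0^t\frac{\Phi_j^{-1}(\tau)}{\tau^{(N+s)/N}}d\tau$, one has $\lim_{t\to\infty}\frac{t^{q^+}}{(\Phi_j)_*(kt)}=0$ for all $k>0$. Put $\varphi^-_{\min}=\min_i\varphi_i^-$. Let $Q=\mathbb{R}^{2N}\setminus\big((\mathbb{R}^N\setminus\Omega)\times(\mathbb{R}^N\setminus\Omega)\big)$, $D^su=D^su(x,y)=\frac{u(x)-u(y)}{|x-y|^s}$, $d\mu=\frac{dx\,dy}{|x-y|^N}$. For $u:\mathbb{R}^N\to\mathbb{R}$ measurable, $[u]_i=\inf\{\lambda>0:\int_Q\Phi_i(|D^su|/\lambda)\,d\mu\le1\}$. The fractional anisotropic Orlicz–Sobolev space $W=W_0^sL_{\overrightarrow{\Phi}}(Q)$ is the closure of $C_0^\infty(\Omega)$ (functions extended by $0$ to $\mathbb{R}^N$) with respect to the norm $\|u\|_{\overrightarrow{\Phi}}=\sum_{i=1}^N[u]_i$. The expression $a_i(|t|)t$ is read as $\varphi_i(t)$, so it is $0$ at $t=0$. Problem $(P_a)$ is: $\sum_{i=1}^N(-\Delta)^s_{a_i(\cdot)}u=\lambda|u|^{q(x)-2}u$ in $\Omega$, $u=0$ in $\mathbb{R}^N\setminus\Omega$, where $(-\Delta)^s_{a_i(\cdot)}u(x)=2\lim_{\varepsilon\searrow0}\int_{\mathbb{R}^N\setminus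 B_\varepsilon(x)}a_i\big(\tfrac{|u(x)-u(y)|}{|x-y|^s}\big)\tfrac{u(x)-u(y)}{|x-y|^s}\tfrac{dy}{|x-y|^{N+s}}$; eigenvalues are understood in the weak sense written in the claim. *)

(* Defs.v *)
From HB Require Import structures.
From mathcomp Require Import all_boot all_order all_algebra.
From mathcomp Require Import all_classical all_reals all_analysis.

Set Implicit Arguments.
Unset Strict Implicit.
Unset Printing Implicit Defensive.

Import Order.TTheory GRing.Theory Num.Theory.
Import numFieldNormedType.Exports.

Local Open Scope classical_set_scope.
Local Open Scope ring_scope.

(* R^n is 'rV[R]_n.  The library gives this type its topology (its norm is the
   sup norm, hence [enorm] below), but neither a sigma-algebra nor a Lebesgue
   measure.  The sigma-algebra is the one generated by the coordinates, i.e.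
   the Borel one; the library does the same for tuples. *)
Definition measure_rV_display : measure_display.
Proof. exact: default_measure_display. Qed.

Section measurable_rV.
Context {R : realType} (n : nat).

Let coord (i : 'I_n) (x : 'rV[R]_n) : R := x 0 i.

Let rV_set0 : g_sigma_preimage coord set0.
Proof. exact: sigma_algebra0. Qed.

Let rV_setC A : g_sigma_preimage coord A -> g_sigma_preimage coord (~` A).
Proof. exact: sigma_algebraC. Qed.

Let rV_bigcup (F : (set _)^nat) : (forall i, g_sigma_preimage coord (F i)) ->
  g_sigma_preimage coord (\bigcup_i (F i)).
Proof. exact: sigma_algebra_bigcup. Qed.

HB.instance Definition _ := @isMeasurable.Build measure_rV_display
  'rV[R]_n (g_sigma_preimage coord) rV_set0 rV_setC rV_bigcup.

Lemma measurable_coord (i : 'I_n) :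
  measurable_fun [set: 'rV[R]_n] (fun x : 'rV[R]_n => x 0 i).
Proof.
move=> _ Y mY; rewrite setTI; apply: sub_sigma_algebra => /=.
rewrite -bigcup_seq/=; exists i => /=; first by rewrite mem_index_enum.
by exists Y => //; rewrite setTI.
Qed.

Lemma measurable_fun_rV d (T : measurableType d) (f : T -> 'rV[R]_n) :
  (forall i, measurable_fun [set: T] (fun t => f t 0 i)) ->
  measurable_fun [set: T] f.
Proof.
move=> mf _ A; rewrite setTI => mA.
suff : g_sigma_preimage coord `<=` [set B | measurable (f @^-1` B)] by exact.
apply: smallest_sub.
  split => /=; first by rewrite preimage_set0.
    by move=> B; rewrite setTD -preimage_setC => mB; exact: measurableC.
  by move=> F mF; rewrite preimage_bigcup; exact: bigcupT_measurable.
rewrite -bigcup_seq; apply: bigcup_sub => i _ B [Y mY <-] /=.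
by rewrite setTI -[X in measurable X]setTI; exact: mf.
Qed.

End measurable_rV.

Section lebesgue_rV.
Context {R : realType}.

Definition rV_cons n (p : R * 'rV[R]_n) : 'rV[R]_n.+1 :=
  \row_i (if unlift ord0 i is Some j then p.2 0 j else p.1).

Definition rV_uncons n (x : 'rV[R]_n.+1) : R * 'rV[R]_n :=
  (x 0 ord0, \row_i x 0 (lift ord0 i)).

Lemma measurable_rV_cons n :
  measurable_fun [set: R * 'rV[R]_n] (@rV_cons n).
Proof.
apply: measurable_fun_rV => i; rewrite /rV_cons.
under eq_fun do rewrite mxE.
case: (unlift ord0 i) => [j|]; last exact: measurable_fst.
apply: (@measurableT_comp _ _ _ _ _ _ (fun x : 'rV[R]_n => x 0 j)) => //.
exact: measurable_coord.
Qed.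

Lemma measurable_rV_uncons n :
  measurable_fun [set: 'rV[R]_n.+1] (@rV_uncons n).
Proof.
apply: measurable_fun_pair; first exact: measurable_coord.
apply: measurable_fun_rV => i; under eq_fun do rewrite mxE.
exact: measurable_coord.
Qed.

Lemma rV_consK n : cancel (@rV_cons n) (@rV_uncons n).
Proof.
move=> [t x]; congr pair; first by rewrite mxE unlift_none.
by apply/rowP => i; rewrite !mxE liftK.
Qed.

Section step.
Local Open Scope ereal_scope.
Context n (m : {sigma_finite_measure set 'rV[R]_n -> \bar R}).

Definition lebesgue_step : set 'rV[R]_n.+1 -> \bar R :=
  pushforward (@lebesgue_measure R \x m) (@rV_cons n).

HB.instance Definition _ := Measure.copy lebesgue_step
  (measure_function_pushforward__canonical__measure_function_Measure
    (@lebesgue_measure R \x m) (@measurable_rV_cons n)).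

Let lebesgue_step_sigma_finite : sigma_finite setT lebesgue_step.
Proof.
have /sigma_finiteP[F [TF ndF Foo]] := sigma_finiteT (@lebesgue_measure R).
have /sigma_finiteP[G [TG ndG Goo]] := sigma_finiteT m.
have mFG (k : nat) : measurable (F k `*` G k).
  by apply: measurableX; [have [] := Foo k|have [] := Goo k].
exists (fun k => @rV_uncons n @^-1` (F k `*` G k)).
  rewrite -preimage_bigcup (_ : \bigcup_k _ = setT) ?preimage_setT//.
  apply/seteqP; split => // -[x y] _.
  have [k _ Fkx] : (\bigcup_k F k) x by rewrite -TF.
  have [l _ Gly] : (\bigcup_k G k) y by rewrite -TG.
  exists (maxn k l) => //; split => /=.
  - by move: x Fkx; exact/subsetPset/ndF/leq_maxl.
  - by move: y Gly; exact/subsetPset/ndG/leq_maxr.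
move=> k; split.
  by rewrite -[X in measurable X]setTI; exact: (measurable_rV_uncons measurableT (mFG k)).
rewrite /lebesgue_step /pushforward -comp_preimage.
rewrite (_ : @rV_uncons n \o @rV_cons n = id); last first.
  by apply/funext => p /=; rewrite rV_consK.
have [mF Fk] := Foo k; have [mG Gk] := Goo k.
by rewrite preimage_id product_measure1E// lte_mul_pinfty// ge0_fin_numE.
Qed.

HB.instance Definition _ := Measure_isSigmaFinite.Build _ _ _
  lebesgue_step lebesgue_step_sigma_finite.

End step.

Fixpoint lebesgue_rV n : {sigma_finite_measure set 'rV[R]_n -> \bar R} :=
  match n with
  | 0 => dirac (0 : 'rV[R]_0)
  | n'.+1 => lebesgue_step (lebesgue_rV n')
  end.

Lemma lebesgue_rV_box n (A : 'I_n -> set R) :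
  (forall i, measurable (A i)) ->
  lebesgue_rV n [set x | forall i, A i (x 0 i)] =
  (\prod_(i < n) lebesgue_measure (A i))%E.
Proof.
elim: n A => [|n IH] A mA; first by rewrite big_ord0 /= diracE mem_set// => -[].
have mB : measurable [set x : 'rV[R]_n | forall i, A (lift ord0 i) (x 0 i)].
  rewrite (_ : mkset _ = \bigcap_(i in [set: 'I_n])
      ((fun x : 'rV[R]_n => x 0 i) @^-1` A (lift ord0 i))).
    apply: fin_bigcap_measurable => // i _.
    by rewrite -[X in measurable X]setTI; exact: measurable_coord.
  by apply/seteqP; split=> [x Ax i _|x Ax i]; [exact: Ax|exact: (Ax i I)].
rewrite big_ord_recl -IH => [|i]; last exact: mA.
transitivity ((lebesgue_measure \x lebesgue_rV n)%E
    (A ord0 `*` [set x : 'rV[R]_n | forall i, A (lift ord0 i) (x 0 i)])).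
  apply: (congr1 (lebesgue_measure \x lebesgue_rV n)%E); apply/seteqP.
  split => [[t x] /= Ax|[t x] /= [At Ax] i].
    split; first by have := Ax ord0; rewrite mxE unlift_none.
    by move=> i; have := Ax (lift ord0 i); rewrite mxE liftK.
  by rewrite mxE; case: unliftP => [k ->|->].
by apply: product_measure1E => //; exact: mA.
Qed.

End lebesgue_rV.

Section domains.
Context {R : realType}.

Definition enorm n (x : 'rV[R]_n) : R := Num.sqrt (\sum_i x 0 i ^+ 2).

(* Near each boundary point, in suitable orthonormal coordinates x *m U, the
   set is the strict epigraph, in the direction of the j-th coordinate, of a
   Lipschitz function of the remaining coordinates. *)
Definition lipschitz_boundary n (Omega : set 'rV[R]_n) :=
  forall x0, closure Omega x0 -> ~ interior Omega x0 ->
  exists (r : R) (U : 'M[R]_n) (j : 'I_n) (g : 'rV[R]_n.-1 -> R),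
  [/\ 0 < r,
      U *m U^T = 1%:M,
      exists L : R, forall y z, `|g y - g z| <= L * enorm (y - z) &
      forall x, enorm (x - x0) < r ->
        Omega x <-> g (col' j (x *m U)) < (x *m U) 0 j].

Fixpoint Ck n k (f : 'rV[R]_n -> R) : Prop :=
  continuous f /\
  (if k is k'.+1 then
    forall i : 'I_n, (forall x, derivable f x (delta_mx 0 i)) /\
                     Ck k' (fun x => 'D_(delta_mx 0 i) f x)
   else True).

Definition test_function n (Omega : set 'rV[R]_n) (f : 'rV[R]_n -> R) :=
  [/\ forall k, Ck k f,
      compact (closure [set x | f x != 0]) &
      closure [set x | f x != 0] `<=` Omega].

End domains.

Section young_functions.
Context {R : realType}.
Local Notation mu := (@lebesgue_measure R).

(* At t = 0 this is 0, whatever a 0 is. *)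
Definition phi (a : R -> R) (t : R) : R := a `|t| * t.

Definition increasing_homeomorphism (f : R -> R) :=
  {mono f : x y / x < y} /\
  exists g : R -> R, [/\ cancel f g, cancel g f, continuous f & continuous g].

Definition Phi (a : R -> R) (t : R) : R :=
  if 0 <= t then \int[mu]_(x in `[0, t]) phi a x
  else - \int[mu]_(x in `[t, 0]) phi a x.

Definition phi_minus (a : R -> R) : \bar R :=
  ereal_inf [set (t * phi a t / Phi a t)%:E | t in `]0, +oo[].

Definition phi_plus (a : R -> R) : \bar R :=
  ereal_sup [set (t * phi a t / Phi a t)%:E | t in `]0, +oo[].

Definition phi_minus_min n (a : 'I_n -> R -> R) : \bar R :=
  \big[Order.min/+oo%E]_(i < n) phi_minus (a i).

Definition Phi_inv (a : R -> R) : R -> R := 'pinv_(fun=> 0) (`[0, +oo[ : set R) (Phi a).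

Definition sobolev_integrand n (s : R) (a : R -> R) (tau : R) : R :=
  Phi_inv a tau / tau `^ ((n%:R + s) / n%:R).

Definition Phi_star_inv n (s : R) (a : R -> R) (t : R) : R :=
  \int[mu]_(tau in `]0, t]) sobolev_integrand n s a tau.

Definition Phi_star n (s : R) (a : R -> R) : R -> R :=
  'pinv_(fun=> 0) (`[0, +oo[ : set R) (Phi_star_inv n s a).

End young_functions.

Section orlicz_sobolev.
Context {R : realType} (n : nat).
Implicit Types (u v : 'rV[R]_n -> R) (Omega : set 'rV[R]_n).

Definition Qset Omega : set ('rV[R]_n * 'rV[R]_n) :=
  ~` ((~` Omega) `*` (~` Omega)).

Definition Ds (s : R) u (p : 'rV[R]_n * 'rV[R]_n) : R :=
  (u p.1 - u p.2) / enorm (p.1 - p.2) `^ s.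

(* Integrals against d mu = dx dy / |x - y|^n are written with this density
   and the Lebesgue measure on R^n x R^n. *)
Definition mu_density (p : 'rV[R]_n * 'rV[R]_n) : R :=
  (enorm (p.1 - p.2) ^+ n)^-1.

Definition lebesgue2 : set ('rV[R]_n * 'rV[R]_n) -> \bar R :=
  (lebesgue_rV n \x lebesgue_rV n)%E.

HB.instance Definition _ := Measure.on lebesgue2.

Definition seminorm (s : R) Omega (a : R -> R) u : \bar R :=
  ereal_inf [set l%:E | l in [set l : R | 0 < l /\
    (\int[lebesgue2]_(p in Qset Omega)
       (Phi a (`|Ds s u p| / l) * mu_density p)%:E <= 1)%E]].

Definition anorm (s : R) Omega (a : 'I_n -> R -> R) u : \bar R :=
  (\sum_(i < n) seminorm s Omega (a i) u)%E.

(* Functions are identified when they agree almost everywhere.  [anorm] does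
   not see constants, so the closure is taken among functions vanishing
   outside Omega, where it is a norm. *)
Definition Wspace (s : R) Omega (a : 'I_n -> R -> R) : set ('rV[R]_n -> R) :=
  [set u : 'rV[R]_n -> R | [/\ measurable_fun setT u,
     {ae lebesgue_rV n, forall x, ~ Omega x -> u x = 0} &
     forall e : R, 0 < e -> exists2 v, test_function Omega v &
       (anorm s Omega a (u \- v)%R < e%:E)%E]].

Definition lhs_integrand (s : R) (a : 'I_n -> R -> R) u v
    (p : 'rV[R]_n * 'rV[R]_n) : R :=
  (\sum_(i < n) phi (a i) (Ds s u p) * Ds s v p) * mu_density p.

(* [0 `^ r * 0 = 0] for every r, so the integrand is 0 where u vanishes, also
   when q x < 2. *)
Definition rhs_integrand (q : 'rV[R]_n -> R) u v (x : 'rV[R]_n) : R :=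
  `|u x| `^ (q x - 2) * u x * v x.

(* The library integral is total: integrability is what makes the identity
   meaningful. *)
Definition weak_identity (s : R) Omega (a : 'I_n -> R -> R)
    (q : 'rV[R]_n -> R) (lambda : R) u v :=
  [/\ lebesgue2.-integrable (Qset Omega) (EFin \o lhs_integrand s a u v),
      (lebesgue_rV n).-integrable Omega (EFin \o rhs_integrand q u v) &
      (\int[lebesgue2]_(p in Qset Omega) (lhs_integrand s a u v p)%:E =
       lambda%:E * \int[lebesgue_rV n]_(x in Omega) (rhs_integrand q u v x)%:E)%E].

Definition weak_eigenvalue (s : R) Omega (a : 'I_n -> R -> R)
    (q : 'rV[R]_n -> R) (lambda : R) :=
  exists u, [/\ Wspace s Omega a u,
    ~ {ae lebesgue_rV n, forall x, u x = 0} &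
    forall v, Wspace s Omega a v -> weak_identity s Omega a q lambda u v].

End orlicz_sobolev.

(* Main.v *)
Require Import Defs.
From mathcomp Require Import all_boot all_order all_algebra.
From mathcomp Require Import all_classical all_reals all_analysis measurable_realfun.
From mathcomp Require Import ring lra.
Set Implicit Arguments.
Unset Strict Implicit.
Unset Printing Implicit Defensive.
Import Order.TTheory GRing.Theory Num.Theory.
Import numFieldNormedType.Exports.
Local Open Scope classical_set_scope.
Local Open Scope ring_scope.

(** Every positive lambda is an eigenvalue, so that both thresholds may be
    taken equal to 1. The eigenfunction minimises J = E - lambda G over the
    closure of the test functions, where E u is the integral of
    Psi(D^s u) dmu with Psi the sum of the functions t |-> Phi_i(|t|), and G u
    is the integral over Omega of |u|^q / q.

    Growth. Psi lies between powers of exponents p and r, where p is the least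
    lower index, which exceeds Q = q^+ (young_exponents). With the inequality
    of Poincare type in poincare, G is therefore bounded by a constant plus an
    arbitrarily small multiple of E (G_le), and J is bounded below. Along t w,
    with w a bump, E is of order t^p at most and G of order t^Q at least, so
    the infimum of J is negative (min_action_lt0) and a minimiser is not zero.

    Existence. Convexity of Phi_i(sqrt t) gives the parallelogram inequality
      E((u + v)/2) + E((u - v)/2) <= (E u + E v)/2.
    For two almost minimal functions u and v, the midpoint has almost minimal
    action as well, so E((u - v)/2) is small as soon as G((u + v)/2) is close
    to the mean of G u and G v (minimizing_close). For that it suffices that
    u and v are close in L1 (G_diff). Bounded energy makes this possible: up to
    a small multiple of 1 + E, the L1 norm is controlled by the integrals over
    finitely many cubes (L1_compactness), and along an ultrafilter these
    integrals are Cauchy. Hence some minimising sequence is Cauchy for the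
    energy (minimizing_cauchy); it converges almost everywhere, and the lemma
    of Fatou identifies the limit (finite_energy_limit).

    Equation. The tangent of Psi at D^s (u + t v) and the tangent of |.|^q / q
    at u bound the increment of J from u to u + t v from above
    (action_increment). As u is a minimiser, dividing by t and letting t tend
    to 0 gives one inequality of the weak identity, and - v gives the other
    (euler_lagrange).

    The space. By convexity and doubling, small Luxemburg seminorms and small
    modulars are the same thing, so the closure for the energy is the space W
    up to null sets (energy_closure_Wspace, cutoff_energy_closure). Test
    functions have finite energy because they are bounded and Lipschitz
    (energy_lipschitz). *)

(** * Young functions between two powers *)

Section young.
Context {R : realType}.

(** Only what the minimisation uses of an Orlicz function, for an abstract pair
    so that it covers each Phi_i, which defines a seminorm, as well as
    their sum, which is minimised. The scaling bounds are the integrated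
    form of p Psi(t) <= t psi(t) <= r Psi(t). *)
Record young (p r : R) (Psi psi : R -> R) : Prop := Young {
  young0 : Psi 0 = 0;
  youngN : forall t, Psi (- t) = Psi t;
  young1_gt0 : 0 < Psi 1;
  young_tangent : forall x y, Psi x + psi x * (y - x) <= Psi y;
  young_cont : continuous psi;
  young_scale_ge : forall c t, 1 <= c -> c `^ p * Psi t <= Psi (c * t);
  young_scale_le : forall c t, 1 <= c -> Psi (c * t) <= c `^ r * Psi t;
  young_parallelogram : forall x y,
    Psi ((x + y) / 2) + Psi ((x - y) / 2) <= (Psi x + Psi y) / 2 }.

Section young_theory.
Context (p r : R) (Psi psi : R -> R) (Y : young p r Psi psi).

Lemma young_ge0 t : 0 <= Psi t.
Proof.
have := young_tangent Y 0 t; have := young_tangent Y 0 (- t).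
rewrite (young0 Y) (youngN Y); lra.
Qed.

(** Average the tangent inequalities at the intermediate point. *)
Lemma young_convex e x y : 0 <= e <= 1 ->
  Psi ((1 - e) * x + e * y) <= (1 - e) * Psi x + e * Psi y.
Proof.
move=> e01; set c := _ * _ + _ * _.
have hx := young_tangent Y c x; have hy := young_tangent Y c y.
have : (1 - e) * (Psi c + psi c * (x - c)) <= (1 - e) * Psi x.
  by apply: ler_wpM2l => //; case/andP: e01; lra.
have : e * (Psi c + psi c * (y - c)) <= e * Psi y.
  by apply: ler_wpM2l => //; case/andP: e01.
have -> : e * (Psi c + psi c * (y - c)) = Psi c -
   (1 - e) * (Psi c + psi c * (x - c)) by rewrite /c; ring.
lra.
Qed.

Lemma young_norm t : Psi `|t| = Psi t.
Proof. by case: (ger0P t) => // _; exact: (youngN Y). Qed.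

Lemma young_contract e t : 0 <= e <= 1 -> Psi (e * t) <= e * Psi t.
Proof.
move=> e01; have := young_convex 0 t e01; rewrite (young0 Y).
by rewrite !mulr0 !add0r.
Qed.

Lemma young_le x y : `|x| <= `|y| -> Psi x <= Psi y.
Proof.
rewrite -(young_norm x) -(young_norm y) => xy.
have [y0|y0] := eqVneq `|y| 0.
  by move: xy; rewrite y0 normr_le0 => /eqP ->; rewrite normr0.
have y_gt0 : 0 < `|y| by rewrite lt_neqAle eq_sym y0/=.
have e01 : 0 <= `|x| / `|y| <= 1.
  by rewrite divr_ge0//= ler_pdivrMr// mul1r.
have := young_contract `|y| e01; rewrite divfK// => /le_trans; apply.
by rewrite ler_piMl ?young_ge0//; case/andP: e01.
Qed.

Lemma young_continuous : continuous Psi.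
Proof.
move=> x; apply/cvgrPdist_le => e e0.
have h y : `|Psi x - Psi y| <= (`|psi x| + `|psi y|) * `|x - y|.
  have h1 := young_tangent Y x y; have h2 := young_tangent Y y x.
  have a1 := ler_norm (- (psi y * (x - y))).
  have a2 := ler_norm (- (psi x * (y - x))).
  move: a1 a2; rewrite !normrN !normrM (distrC y x) => a1 a2.
  have a3 : 0 <= `|psi x| * `|x - y| by [].
  have a4 : 0 <= `|psi y| * `|x - y| by [].
  by rewrite ler_norml; apply/andP; split; lra.
have : (`|psi x| + `|psi y|) * `|x - y| @[y --> x] --> (`|psi x| + `|psi x|) * `|x - x|.
  apply: cvgM.
    by apply: cvgD; [exact: cvg_cst|apply: cvg_norm; exact: (young_cont Y)].
  by apply: cvg_norm; apply: cvgB; [exact: cvg_cst|exact: cvg_id].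
rewrite subrr normr0 mulr0 => /cvgrPdist_le /(_ e e0); apply: filterS => y.
rewrite sub0r normrN ger0_norm ?mulr_ge0 ?addr_ge0//.
exact/le_trans.
Qed.

Lemma young_double x y : Psi (x + y) <= 2 `^ r * (Psi x + Psi y).
Proof.
have h : Psi (2 * ((1 - 2^-1) * x + 2^-1 * y)) <= _ := young_scale_le Y _ (ler1n R 2).
rewrite (_ : 2 * _ = x + y) in h; last by field.
apply: (le_trans h); rewrite ler_pM2l ?powR_gt0//.
have := @young_convex 2^-1 x y ltac:(lra).
have := young_ge0 x; have := young_ge0 y; lra.
Qed.

(** Write x as a convex combination of y and y + (x - y) / d with weight d on
    the second point: for small d the coefficient of Psi(y) is close to 1,
    and doubling pays for the rest. *)
Lemma young_perturb e : 0 < e -> exists2 C, 0 <= C & forall x y,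
  Psi x <= (1 + e) * Psi y + C * Psi (x - y).
Proof.
move=> e0; pose d := Num.min 1 (e / 2 `^ r).
have K0 : 0 < 2 `^ r :> R by rewrite powR_gt0.
have d0 : 0 < d by rewrite lt_min ltr01 divr_gt0.
have d1 : d <= 1 by rewrite ge_min lexx.
have dK : d * 2 `^ r <= e by rewrite -ler_pdivlMr// /d ge_min lexx orbT.
exists (2 `^ r * (d^-1 `^ r)) => [|x y]; first by rewrite mulr_ge0// powR_ge0.
have -> : x = (1 - d) * y + d * (y + d^-1 * (x - y)).
  by rewrite mulrDr mulrA divff ?gt_eqF//; ring.
have d01 : 0 <= d <= 1 by lra.
apply: le_trans (young_convex _ _ d01) _.
have h1 := young_double y (d^-1 * (x - y)).
have h2 : Psi (d^-1 * (x - y)) <= d^-1 `^ r * Psi (x - y).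
  by apply: (young_scale_le Y); rewrite invf_ge1.
have -> : (1 - d) * y + d * (y + d^-1 * (x - y)) - y = x - y.
  by rewrite mulrDr mulrA divff ?gt_eqF//; ring.
have hA : d * Psi (y + d^-1 * (x - y)) <= d * (2 `^ r * (Psi y + d^-1 `^ r * Psi (x - y))).
  rewrite ler_pM2l//; apply: (le_trans h1); rewrite ler_pM2l// lerD2l//.
have y0 := young_ge0 y.
have hB : d * (2 `^ r * (d^-1 `^ r * Psi (x - y))) <= 2 `^ r * d^-1 `^ r * Psi (x - y).
  rewrite -!mulrA ler_piMl// mulr_ge0 ?powR_ge0// mulr_ge0 ?powR_ge0//.
  exact: young_ge0.
have hC : d * 2 `^ r * Psi y <= e * Psi y by rewrite ler_wpM2r.
have hD : 0 <= d * Psi y by rewrite mulr_ge0// ltW.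
move: hA; rewrite !mulrDr; lra.
Qed.

(** The tangent at x, evaluated at x + y and at x - y. This yields an
    integrable majorant for the first variation of the energy. *)
Lemma young_psi_bound x y : `|psi x * y| <= Psi (x + y) + Psi (x - y).
Proof.
have h1 := young_tangent Y x (x + y); have h2 := young_tangent Y x (x - y).
rewrite (_ : x + y - x = y) in h1; last by ring.
rewrite (_ : x - y - x = - y) in h2; last by ring.
have := young_ge0 (x + y); have := young_ge0 (x - y); have := young_ge0 x.
rewrite mulrN in h2.
by move=> ? ? ?; rewrite ler_norml; apply/andP; split; lra.
Qed.

Lemma young_gt0 t : t != 0 -> 0 < Psi t.
Proof.
move=> t0.
have c1 : 1 <= Num.max 1 `|t|^-1 by rewrite le_max lexx.
have h1 : Psi 1 <= Psi (Num.max 1 `|t|^-1 * t).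
  apply: young_le; rewrite normr1 normrM.
  rewrite [X in X * _]ger0_norm ?le_max ?ler01//.
  by rewrite -ler_pdivrMr ?normr_gt0// mul1r le_max lexx orbT.
have h2 := le_trans h1 (young_scale_le Y t c1).
have := lt_le_trans (young1_gt0 Y) h2.
by rewrite pmulr_rgt0// powR_gt0// (lt_le_trans ltr01).
Qed.

(** By convexity the slope of Psi beyond e is at least Psi(e) / e. *)
Lemma young_dominates_id e : 0 < e ->
  exists2 C, 0 <= C & forall t, `|t| <= e + C * Psi t.
Proof.
move=> e0; have Pe0 : 0 < Psi e by rewrite young_gt0 ?gt_eqF.
exists (e / Psi e) => [|t]; first by rewrite divr_ge0 ?ltW.
have [te|te] := lerP `|t| e.
  rewrite (le_trans te)// lerDl mulr_ge0 ?young_ge0// divr_ge0 ?ltW//.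
have t0 : 0 < `|t| by apply: lt_trans te.
have e01 : 0 <= e / `|t| <= 1.
  by apply/andP; split; [exact/divr_ge0/ltW/t0/ltW|rewrite ler_pdivrMr// mul1r ltW].
have := young_contract `|t| e01; rewrite divfK ?gt_eqF// young_norm.
rewrite mulrAC ler_pdivlMr// => h; rewrite (@le_trans _ _ (e / Psi e * Psi t))//.
  by rewrite mulrAC ler_pdivlMr// mulrC.
by rewrite lerDr ltW.
Qed.

Lemma young_growth t : 1 <= `|t| -> Psi 1 * `|t| `^ p <= Psi t.
Proof.
by move=> t1; rewrite mulrC -[Psi t]young_norm -{2}[`|t|]mulr1; exact: (young_scale_ge Y).
Qed.

End young_theory.
End young.

(** * The primitives Phi *)

Section Phi_young.
Context {R : realType} (a : R -> R).
Context (ha : increasing_homeomorphism (phi a)).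

Lemma phi_continuous : continuous (phi a).
Proof. by case: ha => _ [g []]. Qed.

Lemma phi0 : phi a 0 = 0. Proof. by rewrite /phi mulr0. Qed.

Lemma phiN t : phi a (- t) = - phi a t.
Proof. by rewrite /phi normrN mulrN. Qed.

Lemma phi_mono x y : (phi a x <= phi a y) = (x <= y).
Proof. by rewrite !leNgt (proj1 ha). Qed.

Lemma phi_gt0 t : 0 < t -> 0 < phi a t.
Proof. by move=> t0; rewrite -phi0 (proj1 ha). Qed.

Lemma phi_ge0 t : 0 <= t -> 0 <= phi a t.
Proof. by move=> t0; rewrite -phi0 phi_mono. Qed.

Let phi_integrable (b : R) :
  (@lebesgue_measure R).-integrable `[0, b] (EFin \o phi a).
Proof.
apply: continuous_compact_integrable; first exact: segment_compact.
exact/continuous_subspaceT/phi_continuous.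
Qed.

Let PhiE t : 0 <= t ->
  Phi a t = parameterized_integral (@lebesgue_measure R) 0 t (phi a).
Proof. by move=> t0; rewrite /Phi t0. Qed.

Lemma Phi0 : Phi a 0 = 0.
Proof. by rewrite /Phi lexx set_itv1 Rintegral_set1. Qed.

Lemma is_derive_Phi (t : R) : 0 < t -> is_derive t 1 (Phi a) (phi a t).
Proof.
move=> t0; have [] := @continuous_FTC1_closed _ (phi a) 0 t (t + 1).
- by rewrite ltrDl.
- exact: phi_integrable.
- exact: t0.
- exact: phi_continuous.
move=> dF F'.
have e : \near t, (\int[lebesgue_measure]_(u in `[0, t]) phi a u)%R = Phi a t.
  near=> y; rewrite /Phi ifT//; apply: ltW; near: y; exact: lt_nbhsr.
split; first exact: near_eq_derivable e dF.
by rewrite -(near_eq_derive _ e) -derive1E.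
Unshelve. all: by end_near. Qed.

Lemma Phi_within_continuous x y : 0 <= x -> {within `[x, y], continuous (Phi a)}.
Proof.
move=> x0; apply: (@continuous_subspaceW _ _ _ `[0, y]).
  by move=> z /=; rewrite !in_itv/= => /andP[xz ->]; rewrite (le_trans x0).
have [y0|y0] := lerP 0 y; last by rewrite set_itv_ge ?bnd_simp -?ltNge//; exact: continuous_subspace0.
apply: (@subspace_eq_continuous _ _ _ (fun t => parameterized_integral (@lebesgue_measure R) 0 t (phi a))).
  by move=> z; rewrite inE/= in_itv/= => /andP[z0 _] /=; rewrite -PhiE.
exact: parameterized_integral_continuous.
Qed.

(** The mean value theorem, with phi increasing. *)
Lemma Phi_tangent_ge0 x y : 0 <= x -> 0 <= y ->
  Phi a x + phi a x * (y - x) <= Phi a y.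
Proof.
move=> x0 y0; have [xy|yx] := leP x y.
  have [|c] := @MVT_segment _ (Phi a) (phi a) x y xy _ (Phi_within_continuous x0).
    by move=> z; rewrite in_itv/= => /andP[xz _]; apply: is_derive_Phi; exact: le_lt_trans xz.
  rewrite in_itv/= => /andP[xc _] e.
  have : phi a x * (y - x) <= phi a c * (y - x).
    by rewrite ler_wpM2r ?subr_ge0// phi_mono.
  lra.
have [|c] := @MVT_segment _ (Phi a) (phi a) y x (ltW yx) _ (Phi_within_continuous y0).
  by move=> z; rewrite in_itv/= => /andP[xz _]; apply: is_derive_Phi; exact: le_lt_trans xz.
rewrite in_itv/= => /andP[_ cx] e.
have : phi a c * (x - y) <= phi a x * (x - y).
  by rewrite ler_wpM2r ?subr_ge0// ?phi_mono// ltW.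
lra.
Qed.

Lemma Phi_gt0 t : 0 < t -> 0 < Phi a t.
Proof.
move=> t0; have t20 : 0 < t / 2 by lra.
have := @Phi_tangent_ge0 (t / 2) t (ltW t20) (ltW t0).
have := @Phi_tangent_ge0 0 (t / 2) (lexx _) (ltW t20).
rewrite phi0 mul0r addr0 Phi0.
have := phi_gt0 t20.
have -> : t - t / 2 = t / 2 by field.
move=> h; have : 0 < phi a (t / 2) * (t / 2) by rewrite mulr_gt0.
lra.
Qed.

Lemma Phi_norm_tangent x y : Phi a `|x| + phi a x * (y - x) <= Phi a `|y|.
Proof.
have aux u v : 0 <= u -> Phi a u + phi a u * (v - u) <= Phi a `|v|.
  move=> u0; apply: le_trans (@Phi_tangent_ge0 u `|v| u0 (normr_ge0 _)).
  by rewrite lerD2l ler_wpM2l ?phi_ge0// lerD2r ler_norm.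
have [x0|x0] := ger0P x; first exact: aux.
have := @aux (- x) (- y) ltac:(by rewrite oppr_ge0 ltW).
by rewrite normrN (_ : phi a (- x) * _ = phi a x * (y - x))// phiN; ring.
Qed.

Let is_derive_ratio (p t : R) : 0 < t ->
  is_derive t 1 (fun x => Phi a x * x `^ (- p))
    (t `^ (- p - 1) * (t * phi a t - p * Phi a t)).
Proof.
move=> t0; have d1 := is_derive_Phi t0; have d2 := is_derive1_powR (- p) t0.
have d12 := is_deriveM d1 d2; apply: (is_derive_eq d12).
rewrite /GRing.scale/=.
have -> : t `^ (- p) = t `^ (- p - 1) * t.
  by rewrite -[X in _ * X]powRr1 ?ltW// -powRD ?subrK// (gt_eqF t0) implybT.
ring.
Qed.

Let ratio_within (p x y : R) : 0 < x ->
  {within `[x, y], continuous (fun x => Phi a x * x `^ (- p))}.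
Proof.
move=> x0; apply: derivable_within_continuous => z.
rewrite in_itv/= => /andP[xz _].
by have [] := is_derive_ratio p (lt_le_trans x0 xz).
Qed.

Let ratioK (p t c : R) : 0 < c -> 0 < t ->
  (Phi a t * t `^ (- p)) * (c * t) `^ p = c `^ p * Phi a t.
Proof.
move=> c0 t0; rewrite powRM ?ltW// powRN.
by rewrite [c `^ p * _]mulrC mulrA divfK 1?mulrC// gt_eqF// powR_gt0.
Qed.

(** Phi(t) t^(-p) is nondecreasing, as its derivative is t^(-p - 1) (t phi(t) -
    p Phi(t)). *)
Lemma Phi_scale_ge p : (forall t, 0 < t -> p * Phi a t <= t * phi a t) ->
  forall c t, 1 <= c -> 0 <= t -> c `^ p * Phi a t <= Phi a (c * t).
Proof.
move=> hp c t c1; rewrite le_eqVlt => /predU1P[<-|t0].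
  by rewrite mulr0 Phi0 mulr0.
have c0 : 0 < c by exact: lt_le_trans c1.
have ct0 : 0 < c * t by rewrite mulr_gt0.
have e := @ratioK p (c * t) 1 ltr01 ct0; rewrite powR1 !mul1r in e.
rewrite -ratioK// -[leRHS]e ler_pM2r ?powR_gt0//.
apply: (@ger0_derive1_ndecr _ (fun x => Phi a x * x `^ (- p)) t (c * t)) => //.
- move=> x; rewrite in_itv/= => /andP[tx _].
  by have [] := is_derive_ratio p (lt_trans t0 tx).
- move=> x; rewrite in_itv/= => /andP[tx _].
  have x0 := lt_trans t0 tx.
  rewrite derive1E; have [_ ->] := is_derive_ratio p x0.
  by rewrite mulr_ge0 ?powR_ge0// subr_ge0 hp.
- exact: ratio_within.
- by rewrite ler_peMl// ltW.
Qed.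

Lemma Phi_scale_le p : (forall t, 0 < t -> t * phi a t <= p * Phi a t) ->
  forall c t, 1 <= c -> 0 <= t -> Phi a (c * t) <= c `^ p * Phi a t.
Proof.
move=> hp c t c1; rewrite le_eqVlt => /predU1P[<-|t0].
  by rewrite mulr0 Phi0 mulr0.
have c0 : 0 < c by exact: lt_le_trans c1.
have ct0 : 0 < c * t by rewrite mulr_gt0.
have e := @ratioK p (c * t) 1 ltr01 ct0; rewrite powR1 !mul1r in e.
rewrite -ratioK// -[leLHS]e ler_pM2r ?powR_gt0//.
apply: (@ler0_derive1_nincr _ (fun x => Phi a x * x `^ (- p)) t (c * t)) => //.
- move=> x; rewrite in_itv/= => /andP[tx _].
  by have [] := is_derive_ratio p (lt_trans t0 tx).
- move=> x; rewrite in_itv/= => /andP[tx _].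
  have x0 := lt_trans t0 tx.
  rewrite derive1E; have [_ ->] := is_derive_ratio p x0.
  by rewrite mulr_ge0_le0 ?powR_ge0// subr_le0 hp.
- exact: ratio_within.
- by rewrite ler_peMl// ltW.
Qed.

Context (hc : convex_function (`[0, +oo[ : set R^o)
  (fun t => Phi a (Num.sqrt t))).

Let H (t : R) := Phi a (Num.sqrt t).

Let H_convex (e x y : R) : 0 <= e <= 1 -> 0 <= x -> 0 <= y ->
  H (e * x + (1 - e) * y) <= e * H x + (1 - e) * H y.
Proof.
move=> /andP[e0 e1] x0 y0.
have := @hc (Itv01 e0 e1) x y.
by rewrite !inE/= !in_itv/= !andbT => /(_ x0 y0).
Qed.

Let H_superadditive (x y : R) : 0 <= x -> 0 <= y -> H x + H y <= H (x + y).
Proof.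
move=> x0 y0; have H0 : H 0 = 0 by rewrite /H sqrtr0 Phi0.
have [xy|xy] := eqVneq (x + y) 0.
  have -> : x = 0 by lra.
  have -> : y = 0 by lra.
  by rewrite addr0 H0 addr0.
have aux u v : 0 <= u -> 0 <= v -> u + v != 0 -> H u <= u / (u + v) * H (u + v).
  move=> u0 v0 uv.
  have uv0 : 0 < u + v by rewrite lt_neqAle eq_sym uv addr_ge0.
  have := @H_convex (u / (u + v)) (u + v) 0.
  rewrite H0 !mulr0 !addr0 divfK//; apply => //; last exact: ltW.
  by rewrite divr_ge0 ?addr_ge0//= ler_pdivrMr// mul1r lerDl.
have h1 := aux _ _ x0 y0 xy; have := aux _ _ y0 x0; rewrite [y + x]addrC => /(_ xy) h2.
apply: (le_trans (lerD h1 h2)).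
by rewrite -!mulrDl divff// mul1r.
Qed.

(** H(t) = Phi(sqrt t) is convex and vanishes at 0, hence superadditive. Apply
    this to the squares of (x + y) / 2 and (x - y) / 2, whose sum is the
    mean of x^2 and y^2. This inequality takes the place of uniform
    convexity. *)
Lemma Phi_norm_parallelogram x y :
  Phi a `|(x + y) / 2| + Phi a `|(x - y) / 2| <= (Phi a `|x| + Phi a `|y|) / 2.
Proof.
have E t : Phi a `|t| = H (t ^+ 2) by rewrite /H sqrtr_sqr.
rewrite !E; apply: (le_trans (H_superadditive (sqr_ge0 _) (sqr_ge0 _))).
have -> : ((x + y) / 2) ^+ 2 + ((x - y) / 2) ^+ 2 =
  2^-1 * x ^+ 2 + (1 - 2^-1) * y ^+ 2 by field.
apply: (le_trans (H_convex _ (sqr_ge0 _) (sqr_ge0 _))); lra.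
Qed.

End Phi_young.

Section Phi_is_young.
Context {R : realType}.

Lemma Phi_is_young (a : R -> R) (p r : R) :
  increasing_homeomorphism (phi a) ->
  (forall t, 0 < t -> p * Phi a t <= t * phi a t) ->
  (forall t, 0 < t -> t * phi a t <= r * Phi a t) ->
  convex_function (`[0, +oo[ : set R^o) (fun t => Phi a (Num.sqrt t)) ->
  young p r (fun t => Phi a `|t|) (phi a).
Proof.
move=> ha hp hr hc; split.
- by rewrite normr0 Phi0.
- by move=> t; rewrite normrN.
- by rewrite normr1 Phi_gt0.
- exact: Phi_norm_tangent.
- exact: phi_continuous.
- move=> c t c1; rewrite normrM (ger0_norm (le_trans ler01 c1)).
  exact: Phi_scale_ge.
- move=> c t c1; rewrite normrM (ger0_norm (le_trans ler01 c1)).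
  exact: Phi_scale_le.
- exact: Phi_norm_parallelogram.
Qed.

Lemma young_sum n (i0 : 'I_n) (p r : R) (Psi psi : 'I_n -> R -> R) :
  (forall i, young p r (Psi i) (psi i)) ->
  young p r (fun t => \sum_(i < n) Psi i t) (fun t => \sum_(i < n) psi i t).
Proof.
move=> Y; split.
- by rewrite big1// => i _; exact: young0 (Y i).
- by move=> t; apply: eq_bigr => i _; exact: (youngN (Y i)).
- rewrite (bigD1 i0)//= ltr_pwDl ?(young1_gt0 (Y i0))//.
  by apply: sumr_ge0 => i _; exact: (young_ge0 (Y i)).
- move=> x y; rewrite mulr_suml -big_split/=; apply: ler_sum => i _.
  exact: (young_tangent (Y i)).
- apply: continuous_big => [|i _]; [exact: add_continuous|exact: (young_cont (Y i))].
- move=> c t c1; rewrite mulr_sumr; apply: ler_sum => i _.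
  exact: (young_scale_ge (Y i)).
- move=> c t c1; rewrite mulr_sumr; apply: ler_sum => i _.
  exact: (young_scale_le (Y i)).
- move=> x y; rewrite -!big_split/= mulr_suml; apply: ler_sum => i _.
  exact: (young_parallelogram (Y i)).
Qed.

(** The least lower index is a common p for all i, and any common bound of the
    upper indices is a common r. *)
Lemma young_exponents n (i0 : 'I_n) (Q : R) (a : 'I_n -> R -> R) :
  (forall i, increasing_homeomorphism (phi (a i))) ->
  (forall i, [/\ (1 < phi_minus (a i))%E,
       (phi_minus (a i) <= phi_plus (a i))%E & (phi_plus (a i) < +oo)%E]) ->
  (forall i, convex_function (`[0, +oo[ : set R^o)
       (fun t => Phi (a i) (Num.sqrt t))) ->
  (Q%:E < phi_minus_min a)%E ->
  exists p r, [/\ Q < p, 0 < r &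
    forall i, young p r (fun t => Phi (a i) `|t|) (phi (a i))].
Proof.
move=> ha hi hc hQ.
have le_min i : (phi_minus_min a <= phi_minus (a i))%E.
  by rewrite /phi_minus_min (bigD1 i)//= ge_min lexx.
have min_fin : phi_minus_min a \is a fin_num.
  rewrite fin_numE; apply/andP; split.
    by rewrite -ltNye (le_lt_trans _ hQ)// leNye.
  rewrite -ltey (le_lt_trans (le_min i0))//.
  by have [_ /le_lt_trans h /h] := hi i0.
exists (fine (phi_minus_min a)), (\sum_i `|fine (phi_plus (a i))| + 1); split.
- by rewrite -lte_fin fineK.
- by rewrite ltr_wpDl// sumr_ge0.
move=> i; apply: Phi_is_young => // t t0.
  rewrite -ler_pdivlMr ?Phi_gt0// -lee_fin fineK// (le_trans (le_min i))//.
  by apply: ereal_inf_lbound; exists t => //=; rewrite in_itv/= t0.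
rewrite -ler_pdivrMr ?Phi_gt0//.
have plus_fin : phi_plus (a i) \is a fin_num.
  have [h1 h2 h3] := hi i; rewrite fin_numE -ltNye -ltey h3 andbT.
  by rewrite (lt_le_trans _ h2)// (lt_trans _ h1)// ltNye.
rewrite (@le_trans _ _ (fine (phi_plus (a i))))//.
  rewrite -lee_fin fineK//.
  by apply: ereal_sup_ubound; exists t => //=; rewrite in_itv/= t0.
rewrite (le_trans (ler_norm _))// (bigD1 i)//= -addrA lerDl addr_ge0// sumr_ge0//.
Qed.

End Phi_is_young.

(** * Measurability on R^n *)

Section measurability_rV.
Context {R : realType} (n : nat).
Local Notation V := 'rV[R]_n.

(** An open set is the union of the countably many boxes with rational centre
    and width that it contains, and boxes are measurable for the sigma-
    algebra of the coordinates. *)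
Lemma open_measurable_rV (U : set V) : open U -> measurable U.
Proof.
move=> oU.
pose box (c : 'rV[rat]_n * rat) : set V :=
  [set x | forall i, `|x 0 i - ratr (c.1 0 i)| < ratr c.2].
have mbox c : measurable (box c).
  rewrite (_ : box c = \bigcap_(i in [set: 'I_n])
      ((fun x : V => x 0 i) @^-1` [set t | `|t - ratr (c.1 0 i)| < ratr c.2])).
    apply: fin_bigcap_measurable => // i _.
    rewrite -[X in measurable X]setTI; apply: measurable_coord => //.
    rewrite (_ : mkset _ = `]ratr (c.1 0 i) - ratr c.2, ratr (c.1 0 i) + ratr c.2[%classic).
      exact: measurable_itv.
    by apply/seteqP; split=> t /=; rewrite in_itv/= ltr_distl.
  by apply/seteqP; split=> [x Ax i _|x Ax i]; [exact: Ax|exact: (Ax i I)].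
have -> : U = \bigcup_k (if unpickle k is Some c then
    if `[< box c `<=` U >] then box c else set0 else set0).
  apply/seteqP; split => [x Ux|x [k _]]; last first.
    by case: unpickle => // c; case: asboolP => // cU /cU.
  have /nbhs_ballP[e /= e0 xeU] := oU _ Ux.
  have e20 : 0 < e / 2 by rewrite divr_gt0.
  have [r] := rat_in_itvoo e20.
  rewrite in_itv/= => /andP[r0 re].
  have /choice[c hc] : forall i, exists c : rat, `|x 0 i - ratr c| < ratr r.
    move=> i; have xr : x 0 i - ratr r < x 0 i + ratr r by rewrite ltrD2l gtrN.
    have [c] := rat_in_itvoo xr.
    rewrite in_itv/= => hc; exists c.
    by rewrite distrC ltr_distl.
  exists (pickle (\row_i c i, r)) => //; rewrite pickleK; case: asboolP.
    by move=> _ i /=; rewrite mxE.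
  case=> y hy; apply: xeU; split=> // i j; rewrite ord1.
  have := hy j; rewrite /= mxE => hyj.
  have := ltrD (hc j) hyj; rewrite [X in _ + X]distrC => h.
  rewrite /ball/= (@le_lt_trans _ _ (ratr r + ratr r))//; last by lra.
  by rewrite (le_trans _ (ltW h))// -[X in `|X|](subrKA (ratr (c j))) ler_normD.
apply: bigcupT_measurable => k; case: unpickle => [c|]//.
by case: ifP.
Qed.

Lemma measurable_fun_continuous_open (A : set V) (f : V -> R) : open A ->
  {within A, continuous f} -> measurable_fun A f.
Proof.
move=> oA; rewrite continuous_open_subspace// => cf.
apply: (measurability (@RGenOInfty.G R)); first exact: RGenOInfty.measurableE.
move=> _ [_ [x ->] <-]; apply: open_measurable_rV.
rewrite openE => y [Ay fy]; apply: filterI.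
  by move: oA; rewrite openE; exact.
apply: (cf y (mem_set Ay)); apply: (@open_nbhs_nbhs R); split => //.
Qed.

Lemma continuous_measurable_rV (f : V -> R) : continuous f ->
  measurable_fun setT f.
Proof.
move=> cf; apply: measurable_fun_continuous_open; first exact: openT.
exact: continuous_subspaceT.
Qed.

Lemma enorm_ge0 (x : V) : 0 <= enorm x. Proof. exact: sqrtr_ge0. Qed.

Lemma coord_le_enorm (x : V) i : `|x 0 i| <= enorm x.
Proof.
rewrite -sqrtr_sqr ler_wsqrtr// (bigD1 i)//= lerDl.
by apply: sumr_ge0 => j _; exact: sqr_ge0.
Qed.

Lemma enormN (x : V) : enorm (- x) = enorm x.
Proof. by rewrite /enorm; congr Num.sqrt; apply: eq_bigr => i _; rewrite mxE sqrrN. Qed.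

Lemma enormB (x y : V) : enorm (x - y) = enorm (y - x).
Proof. by rewrite -enormN opprB. Qed.

Lemma enorm_eq0 (x : V) : enorm x = 0 -> x = 0.
Proof.
move=> x0; apply/rowP => i; have := coord_le_enorm x i.
by rewrite x0 normr_le0 mxE => /eqP.
Qed.

Lemma enorm_le (x : V) (d : R) : 0 <= d -> (forall i, `|x 0 i| <= d) ->
  enorm x <= n%:R * d.
Proof.
move=> d0 xd; rewrite -[leRHS]ger0_norm ?mulr_ge0// -sqrtr_sqr ler_wsqrtr//.
apply: (@le_trans _ _ (\sum_(i < n) d ^+ 2)).
  by apply: ler_sum => i _; rewrite -real_normK ?num_real// lerXn2r ?nnegrE ?normr_ge0.
rewrite sumr_const card_ord exprMn -[d ^+ 2 *+ n]mulr_natl ler_wpM2r ?sqr_ge0//.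
by rewrite -natrX ler_nat; case: (n) => // m; rewrite -{1}[m.+1]expn1 leq_pexp2l.
Qed.

Lemma measurable_enorm : measurable_fun setT (@enorm R n).
Proof.
apply: (@measurableT_comp _ _ _ _ _ _ (@Num.sqrt R) setT (fun x : V => \sum_i x 0 i ^+ 2)).
  by apply: continuous_measurable_fun; exact: sqrt_continuous.
apply: measurable_sum => i; apply: measurable_funX; exact: measurable_coord.
Qed.

Lemma measurable_enormB : measurable_fun setT
  (fun p : V * V => enorm (p.1 - p.2)).
Proof.
apply: (measurableT_comp measurable_enorm).
apply: measurable_fun_rV => i; under eq_fun do rewrite !mxE.
apply: measurable_funB.
  by apply: (measurableT_comp (measurable_coord i)); exact: measurable_fst.
by apply: (measurableT_comp (measurable_coord i)); exact: measurable_snd.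
Qed.

Lemma measurable_Ds s (u : V -> R) : measurable_fun setT u ->
  measurable_fun setT (Ds s u).
Proof.
move=> mu; rewrite /Ds; under eq_fun do rewrite -powRN.
apply: measurable_funM.
  apply: measurable_funB.
    by apply: (measurableT_comp mu); exact: measurable_fst.
  by apply: (measurableT_comp mu); exact: measurable_snd.
by apply: (measurableT_comp (@measurable_powR _ (- s))); exact: measurable_enormB.
Qed.

Lemma measurable_mu_density : measurable_fun setT (@mu_density R n).
Proof.
rewrite /mu_density; under eq_fun do rewrite -powR_invn ?enorm_ge0//.
by apply: (measurableT_comp (@measurable_powR _ (- n%:R))); exact: measurable_enormB.
Qed.

Lemma mu_density_ge0 (p : V * V) : 0 <= mu_density p.
Proof. by rewrite invr_ge0 exprn_ge0 ?enorm_ge0. Qed.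

Lemma DsD s (u v : V -> R) p : Ds s (u \+ v) p = Ds s u p + Ds s v p.
Proof. by rewrite /Ds -mulrDl /=; congr (_ * _); ring. Qed.

Lemma DsB s (u v : V -> R) p : Ds s (u \- v) p = Ds s u p - Ds s v p.
Proof. by rewrite /Ds -mulrBl /=; congr (_ * _); ring. Qed.

Lemma DsZ s c (u : V -> R) p : Ds s (fun x => c * u x) p = c * Ds s u p.
Proof. by rewrite /Ds -mulrBr mulrA. Qed.

End measurability_rV.

(** * The nonlocal energy *)

Section ae_product.
Context {R : realType} (n : nat).
Local Notation V := 'rV[R]_n.
Local Notation Leb := (@lebesgue_rV R n).

Lemma lebesgue2X (A B : set V) : measurable A -> measurable B ->
  (@lebesgue2 R n (A `*` B) = Leb A * Leb B)%E.
Proof. by move=> mA mB; exact: product_measure1E. Qed.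

Lemma ae_lebesgue2 (P : set V) : {ae Leb, forall x, P x} ->
  {ae (@lebesgue2 R n), forall z, P z.1 /\ P z.2}.
Proof.
move=> [N [mN N0 PN]]; exists ((N `*` setT) `|` (setT `*` N)); split.
- by apply: measurableU; apply: measurableX.
- apply/eqP; rewrite -measure_le0 (le_trans (measureU2 _ _ _))//; try exact: measurableX.
  rewrite (_ : (_ + _ = 0)%E)//.
  by rewrite -[RHS]adde0; congr (_ + _)%E; rewrite [LHS]lebesgue2X// N0 ?mul0e ?mule0.
- move=> z /= /not_andP[/PN|/PN]; [by left|by right].
Qed.

End ae_product.

Section energy.
Context {R : realType} (n : nat) (s : R).
Context (p r : R) (Psi psi : R -> R) (Y : young p r Psi psi).
Local Notation V := 'rV[R]_n.
Local Notation Leb := (@lebesgue_rV R n).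
Implicit Types u v w : V -> R.

(** The integral runs over all pairs. For functions vanishing outside Omega the
    integrand is zero off Q, so nothing is lost and the domain disappears
    from the calculus. *)
Definition energy u : \bar R :=
  (\int[@lebesgue2 R n]_z (Psi (Ds s u z) * mu_density z)%:E)%E.

Lemma measurable_young : measurable_fun setT Psi.
Proof. exact: continuous_measurable_fun (young_continuous Y). Qed.

Lemma measurable_energy u : measurable_fun setT u ->
  measurable_fun setT (fun z => (Psi (Ds s u z) * mu_density z)%:E).
Proof.
move=> mu; apply/measurable_EFinP; apply: measurable_funM.
  by apply: (measurableT_comp measurable_young); exact: measurable_Ds.
exact: measurable_mu_density.
Qed.

Lemma energy_integrand_ge0 u z : (0 <= (Psi (Ds s u z) * mu_density z)%:E)%E.
Proof. by rewrite lee_fin mulr_ge0 ?(young_ge0 Y)// mu_density_ge0. Qed.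
Hint Resolve energy_integrand_ge0 : core.

Lemma energy_ge0 u : (0 <= energy u)%E.
Proof. exact: integral_ge0. Qed.

(** Integrates a pointwise inequality between values of Psi. Doubling, scaling,
    perturbation and the parallelogram inequality for the energy are all
    instances. *)
Lemma energy_comb u1 u2 v1 v2 (A B : R) :
  measurable_fun setT u1 -> measurable_fun setT u2 ->
  measurable_fun setT v1 -> measurable_fun setT v2 -> 0 <= A -> 0 <= B ->
  (forall z, Psi (Ds s u1 z) + Psi (Ds s u2 z) <=
             A * Psi (Ds s v1 z) + B * Psi (Ds s v2 z)) ->
  (energy u1 + energy u2 <= A%:E * energy v1 + B%:E * energy v2)%E.
Proof.
move=> m1 m2 m3 m4 A0 B0 h; rewrite /energy.
rewrite -ge0_integralD//; try exact: measurable_energy.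
rewrite -!ge0_integralZl_EFin//; try exact: measurable_energy.
rewrite -ge0_integralD//; first last.
- by apply: measurable_funeM; exact: measurable_energy.
- by move=> z _; rewrite mule_ge0.
- by apply: measurable_funeM; exact: measurable_energy.
- by move=> z _; rewrite mule_ge0.
apply: ge0_le_integral => //.
- by move=> z _; rewrite adde_ge0.
- by apply: emeasurable_funD; exact: measurable_energy.
- by apply: emeasurable_funD; apply: measurable_funeM; exact: measurable_energy.
move=> z _; rewrite -!EFinM -!EFinD lee_fin -mulrDl !mulrA -mulrDl.
by rewrite ler_wpM2r ?mu_density_ge0.
Qed.

Lemma energy_ae_eq u v : measurable_fun setT u -> measurable_fun setT v ->
  {ae Leb, forall x, u x = v x} -> energy u = energy v.
Proof.
move=> mu mv uv; apply: ge0_ae_eq_integral => //; try exact: measurable_energy.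
have := ae_lebesgue2 uv; apply: filterS => z [uv1 uv2] _.
by rewrite /Ds uv1 uv2.
Qed.

Lemma Ds_cst0 (z : V * V) : Ds s (fun=> 0 : R) z = 0.
Proof. by rewrite /Ds subrr mul0r. Qed.

Lemma energy0 : energy (fun=> 0) = 0%E.
Proof. by rewrite /energy integral0_eq// => z _; rewrite Ds_cst0 (young0 Y) mul0r. Qed.

Lemma energy_comb1 u v1 v2 (A B : R) :
  measurable_fun setT u ->
  measurable_fun setT v1 -> measurable_fun setT v2 -> 0 <= A -> 0 <= B ->
  (forall z, Psi (Ds s u z) <= A * Psi (Ds s v1 z) + B * Psi (Ds s v2 z)) ->
  (energy u <= A%:E * energy v1 + B%:E * energy v2)%E.
Proof.
move=> m1 m2 m3 A0 B0 h; rewrite -[leLHS]adde0 -energy0.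
by apply: energy_comb => // z; rewrite Ds_cst0 (young0 Y) addr0.
Qed.

Lemma energy_double u v : measurable_fun setT u -> measurable_fun setT v ->
  (energy (u \+ v)%R <= (2 `^ r)%R%:E * energy u + (2 `^ r)%R%:E * energy v)%E.
Proof.
move=> mu mv; apply: energy_comb1 => //; rewrite ?powR_ge0//.
  exact: measurable_funD.
by move=> z; rewrite DsD -mulrDr; exact: (young_double Y).
Qed.

Lemma energy_scale c u : measurable_fun setT u ->
  (energy (fun x => c * u x)%R <= ((Num.max 1 `|c|) `^ r)%R%:E * energy u)%E.
Proof.
move=> mu; rewrite -[leRHS]adde0 -[X in (_ + X)%E](mul0e (energy u)).
apply: energy_comb1 => //; rewrite ?powR_ge0//; first exact: measurable_funM.
move=> z; rewrite mul0r addr0 DsZ.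
apply: le_trans (young_scale_le Y (Ds s u z) (_ : 1 <= Num.max 1 `|c|)); last first.
  by rewrite le_max lexx.
apply: (young_le Y); rewrite !normrM ler_wpM2r// [leRHS]ger0_norm ?le_max ?lexx ?orbT ?ler01//.
Qed.

Lemma energyN u : energy (fun x => - u x) = energy u.
Proof.
apply: eq_integral => z _; congr (_ * _)%:E; rewrite -[RHS](youngN Y).
by congr Psi; rewrite /Ds; lra.
Qed.

Lemma energyB u v : energy (u \- v) = energy (v \- u).
Proof.
rewrite -energyN; congr energy; apply/funext => x /=; exact: opprB.
Qed.

Lemma energy_perturb e : 0 < e -> exists2 C : R, 0 <= C &
  forall u v, measurable_fun setT u -> measurable_fun setT v ->
  (energy u <= (1 + e)%:E * energy v + C%:E * energy (u \- v)%R)%E.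
Proof.
move=> e0; have [C C0 hC] := young_perturb Y e0; exists C => // u v mu mv.
apply: energy_comb1 => //; first exact: measurable_funB.
  by rewrite addr_ge0// ltW.
by move=> z; rewrite DsB.
Qed.

Lemma energy_parallelogram u v :
  measurable_fun setT u -> measurable_fun setT v ->
  (energy (fun x => (u x + v x) / 2)%R + energy (fun x => (u x - v x) / 2)%R <=
   (2^-1)%:E * energy u + (2^-1)%:E * energy v)%E.
Proof.
move=> mu mv; apply: energy_comb => //; try lra.
- by apply: measurable_funM => //; exact: measurable_funD.
- by apply: measurable_funM => //; exact: measurable_funB.
move=> z; have := young_parallelogram Y (Ds s u z) (Ds s v z).
rewrite (_ : Ds s (fun x => (u x + v x) / 2) z = (Ds s u z + Ds s v z) / 2); last first.
  by rewrite /Ds; ring.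
rewrite (_ : Ds s (fun x => (u x - v x) / 2) z = (Ds s u z - Ds s v z) / 2); last first.
  by rewrite /Ds; ring.
lra.
Qed.

End energy.

(** * Boxes and grids *)

Section boxes.
Context {R : realType} (n : nat).
Local Notation V := 'rV[R]_n.
Local Notation Leb := (@lebesgue_rV R n).

(** Half-open, so that the cells of a grid are disjoint. *)
Definition box (c : V) (h : R) : set V :=
  [set x | forall i, c 0 i <= x 0 i < c 0 i + h].

Lemma measurable_box c h : measurable (box c h).
Proof.
rewrite (_ : box c h = \bigcap_(i in [set: 'I_n])
    ((fun x : V => x 0 i) @^-1` `[c 0 i, c 0 i + h[%classic)).
  apply: fin_bigcap_measurable => // i _.
  rewrite -[X in measurable X]setTI; apply: measurable_coord => //.
by apply/seteqP; split=> x Ax i => [_|]; have := Ax i; rewrite /= in_itv/= => H; exact: H.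
Qed.

Lemma lebesgue_box c h : 0 <= h -> Leb (box c h) = (h ^+ n)%:E.
Proof.
move=> h0; have -> : box c h = [set x | forall i, (`[c 0 i, c 0 i + h[%classic : set R) (x 0 i)].
  by apply/seteqP; split=> x Ax i; have := Ax i; rewrite /= in_itv.
rewrite (@lebesgue_rV_box R n (fun i => `[c 0 i, c 0 i + h[%classic)); last by move=> i; exact: measurable_itv.
rewrite (eq_bigr (fun=> h%:E)); last first.
  move=> i _; rewrite lebesgue_measure_itv/= lte_fin.
  case: ltP => [_|]; first by rewrite -EFinD addrAC subrr add0r.
  rewrite gerDl => h0'; by rewrite (@le_anti _ _ h 0)// h0 h0'.
by rewrite prodEFin prodr_const card_ord.
Qed.

Lemma integral_rect (f : V * V -> \bar R) (A B : set V) :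
  measurable A -> measurable B -> measurable_fun setT f ->
  (forall z, 0 <= f z)%E ->
  (\int[@lebesgue2 R n]_(z in A `*` B) f z =
   \int[Leb]_(x in A) \int[Leb]_(y in B) f (x, y))%E.
Proof.
move=> mA mB mf f0; have mAB : measurable (A `*` B) by exact: measurableX.
rewrite integral_mkcond.
have e := @fubini_tonelli1 _ _ _ _ _ Leb Leb (f \_ (A `*` B)).
rewrite [LHS]e; last 2 first.
- by apply/(measurable_restrictT _ _).1 => //; exact: measurable_funTS.
- by move=> z; apply: erestrict_ge0.
rewrite [RHS]integral_mkcond; apply: eq_integral => x _.
rewrite /fubini_F patchE; case: ifPn => [/set_mem xA|xA].
  rewrite [RHS]integral_mkcond; apply: eq_integral => y _.
  rewrite !patchE; congr (if _ then _ else _); apply/idP/idP.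
    by move=> /set_mem[_ /mem_set].
  by move=> /set_mem yB; exact/mem_set.
apply: integral0_eq => y _; rewrite patchE ifF//.
by apply/negbTE; apply: contra xA => /set_mem[/mem_set].
Qed.

Lemma integral_rect_swap (f : V * V -> \bar R) (A B : set V) :
  measurable A -> measurable B -> measurable_fun setT f ->
  (forall z, 0 <= f z)%E ->
  (\int[@lebesgue2 R n]_(z in A `*` B) f z =
   \int[Leb]_(y in B) \int[Leb]_(x in A) f (x, y))%E.
Proof.
move=> mA mB mf f0; have mAB : measurable (A `*` B) by exact: measurableX.
have mg : measurable_fun setT (f \_ (A `*` B)).
  by apply/(measurable_restrictT _ _).1 => //; exact: measurable_funTS.
have g0 z : (0 <= (f \_ (A `*` B)) z)%E by exact: erestrict_ge0.
rewrite integral_mkcond.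
have e := @fubini_tonelli1 _ _ _ _ _ Leb Leb (f \_ (A `*` B)) mg g0.
have e2 := @fubini_tonelli _ _ _ _ _ Leb Leb (f \_ (A `*` B)) mg g0.
rewrite [LHS]e [LHS]e2.
rewrite [RHS]integral_mkcond; apply: eq_integral => y _.
rewrite patchE; case: ifPn => [/set_mem yB|yB].
  rewrite [RHS]integral_mkcond; apply: eq_integral => x _.
  rewrite !patchE; congr (if _ then _ else _); apply/idP/idP.
    by move=> /set_mem[/mem_set].
  by move=> /set_mem xA; exact/mem_set.
apply: integral0_eq => x _; rewrite patchE ifF//.
by apply/negbTE; apply: contra yB => /set_mem[_ /mem_set].
Qed.

Lemma coord_norm (x : V) i : `|x 0 i| <= `|x|.
Proof.
rewrite [leRHS]/Num.norm /= mx_normrE; apply/bigmax_geP; right => /=.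
by exists (ord0, i).
Qed.

Lemma bounded_coord (A : set V) : bounded_set A ->
  exists2 M : R, 0 < M & forall x i, A x -> `|x 0 i| < M.
Proof.
move=> [M [_ hM]]; exists (`|M| + 2).
  by rewrite ltr_wpDl.
move=> x i Ax; apply: (le_lt_trans (coord_norm x i)).
apply: (@le_lt_trans _ _ (`|M| + 1)); last by rewrite ltrD2l ltr1n.
by apply: hM => //; rewrite (le_lt_trans (ler_norm M))// ltrDl.
Qed.

End boxes.

Section cells.
Context {R : realType} (n K : nat) (M : R) (M0 : (0 : R) < M) (K0 : (0 < K)%N).
Local Notation V := 'rV[R]_n.
Let h := 2 * M / K%:R.

Definition cell (c : {ffun 'I_n -> 'I_K}) : set V :=
  box (\row_i (- M + (c i)%:R * h)) h.

Lemma cell_width_gt0 : 0 < h. Proof. by rewrite !mulr_gt0// invr_gt0 ltr0n. Qed.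

Lemma trivIset_cell : trivIset setT cell.
Proof.
move=> c d _ _ [x [cx dx]]; apply/ffunP => i; apply/val_inj.
have := cx i; have := dx i; rewrite !mxE => /andP[d1 d2] /andP[c1 c2].
have h0 := cell_width_gt0.
have aux (a b : nat) : - M + a%:R * h <= x 0 i -> x 0 i < - M + b%:R * h + h ->
    (a <= b)%N.
  move=> ha hb; rewrite -ltnS -(ltr_nat R) -natr1 -(ltr_pM2r h0) mulrDl mul1r.
  by have := le_lt_trans ha hb; rewrite -addrA ltrD2l.
by apply/eqP; rewrite eqn_leq !aux.
Qed.

Lemma cell_cover (x : V) : (forall i, `|x 0 i| < M) -> exists c, cell c x.
Proof.
move=> xM; have h0 := cell_width_gt0.
have /choice[c hc] : forall i, exists k : 'I_K,
    - M + k%:R * h <= x 0 i < - M + k%:R * h + h.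
  move=> i; have := xM i; rewrite ltr_norml => /andP[x1 x2].
  have y0 : 0 <= (x 0 i + M) / h by rewrite divr_ge0 ?ltW//; lra.
  have := truncn_itv y0; set k := Num.truncn _ => /andP[k1 k2].
  have kK : (k < K)%N.
    rewrite -(ltr_nat R) (le_lt_trans k1)// ltr_pdivrMr// /h.
    rewrite mulrC divfK ?pnatr_eq0 ?gtn_eqF//; lra.
  exists (Ordinal kK) => /=; move: k1 k2.
  rewrite ler_pdivlMr// ltr_pdivrMr// -natr1 mulrDl mul1r => k1 k2.
  by apply/andP; split; lra.
exists [ffun i => c i] => i; rewrite !mxE ffunE; exact: hc.
Qed.

End cells.

(** * An inequality of Poincare type *)

Section poincare.
Context {R : realType} (n : nat) (s : R) (n0 : (0 < n)%N) (s0 : (0 : R) < s).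
Context (p r : R) (Psi psi : R -> R) (Y : young p r Psi psi).
Local Notation V := 'rV[R]_n.
Local Notation Leb := (@lebesgue_rV R n).
Context (Omega : set V) (mOmega : measurable Omega).
Context (M : R) (M0 : (0 : R) < M) (OM : forall x i, Omega x -> `|x 0 i| < M).
Implicit Types u v w : V -> R.

Lemma measurable_Psi_comp u : measurable_fun setT u ->
  measurable_fun setT (fun x => (Psi (u x))%:E).
Proof.
by move=> mu; apply/measurable_EFinP/(measurableT_comp (measurable_young Y)).
Qed.

Lemma young_scale_max c t : Psi (c * t) <= (Num.max 1 `|c|) `^ r * Psi t.
Proof.
apply: le_trans (young_scale_le Y t (_ : 1 <= Num.max 1 `|c|)); last first.
  by rewrite le_max lexx.
apply: (young_le Y).
by rewrite !normrM ler_wpM2r// [leRHS]ger0_norm ?le_max ?lexx ?orbT ?ler01.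
Qed.

(** As u vanishes at the second point, u at the first one is D^s u times a
    power of the distance, and the distance is at most D. *)
Lemma Psi_le_energy_integrand (D : R) u (z : V * V) : 0 < r ->
  u z.2 = 0 -> 0 < enorm (z.1 - z.2) <= D ->
  Psi (u z.1) <= ((Num.max 1 (D `^ s)) `^ r * D ^+ n) *
    (Psi (Ds s u z) * mu_density z).
Proof.
move=> r0 uz /andP[e0 eD]; set e := enorm _ in e0 eD.
have D0 : 0 < D by exact: lt_le_trans eD.
have {1}-> : u z.1 = e `^ s * Ds s u z.
  by rewrite /Ds -/e uz subr0 mulrC divfK// gt_eqF// powR_gt0.
apply: (le_trans (young_scale_max _ _)).
have K1 : (Num.max 1 `|e `^ s|) `^ r <= (Num.max 1 (D `^ s)) `^ r.
  have eDs : e `^ s <= D `^ s.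
    by rewrite (ge0_ler_powR (ltW s0)) ?nnegrE ?(ltW e0) ?(ltW D0).
  have mm : Num.max 1 `|e `^ s| <= Num.max 1 (D `^ s).
    by rewrite ger0_norm ?powR_ge0// ge_max !le_max lexx eDs orbT.
  by apply: (ge0_ler_powR (ltW r0)) => //; rewrite nnegrE le_max ler01.
rewrite -!mulrA; apply: ler_pM => //; rewrite ?powR_ge0 ?(young_ge0 Y)//.
rewrite mulrCA ler_peMr ?(young_ge0 Y)//.
by rewrite /mu_density -/e ler_pdivlMr ?exprn_gt0// mul1r lerXn2r ?nnegrE ?(ltW e0) ?(ltW D0).
Qed.

(** Compare every point x of Omega with all points y of a cube B on which u
    vanishes: Psi(u(x)) is at most a constant times the energy integrand at
    (x, y). Integrate over Omega x B and divide by the measure of B. *)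
Lemma poincare : 0 < r -> exists2 C : R, 0 <= C & forall u,
  measurable_fun setT u -> (forall x, ~ Omega x -> u x = 0) ->
  (\int[Leb]_(x in Omega) (Psi (u x))%:E <= C%:E * energy s Psi u)%E.
Proof.
(* the coordinates on B are at least 2 M, those on Omega less than M, which
   keeps the distance away from 0 *)
move=> r0; pose B : set V := box (const_mx (2 * M)) M.
have mB : measurable B by exact: measurable_box.
have b0 : 0 < M ^+ n by rewrite exprn_gt0.
pose D : R := n%:R * (4 * M).
pose K := ((Num.max 1 (D `^ s)) `^ r * D ^+ n).
have K0 : 0 <= K.
  by rewrite mulr_ge0 ?powR_ge0 ?exprn_ge0// mulr_ge0// mulr_ge0// ltW.
exists ((M ^+ n)^-1 * K); first by rewrite mulr_ge0// invr_ge0 ltW.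
move=> u mu uO.
have OB (z : V * V) : (Omega `*` B) z -> u z.2 = 0 /\ 0 < enorm (z.1 - z.2) <= D.
  case: z => x y [/= Ox By].
  have i : 'I_n by exact: Ordinal n0.
  have xy j : M < `|(x - y) 0 j| <= 4 * M.
    have := OM j Ox; have := By j; rewrite !mxE.
    rewrite ltr_norml => /andP[y1 y2] /andP[x1 x2].
    have M0R : (0 : R) < M by exact: M0.
    move: (x 0 j) (y 0 j) x1 x2 y1 y2 => a b x1 x2 y1 y2.
    have t1 : a - b < 0 by lra.
    have t2 : M < b - a by lra.
    have t3 : b - a <= 4 * M by lra.
    by rewrite ltr0_norm// opprB t2 t3.
  split.
    apply: uO => /OM => /(_ i); have := By i; rewrite mxE => /andP[y1 _].
    rewrite ltr_norml => /andP[_ y2]; have := le_lt_trans y1 y2.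
    by rewrite gtr_pMl// ltNge ler1n.
  apply/andP; split.
    have /andP[h1 _] := xy i.
    by apply: (lt_le_trans (lt_trans M0 h1)); exact: coord_le_enorm.
  apply: enorm_le; first by rewrite mulr_ge0// ltW.
  by move=> j; have /andP[] := xy j.
have mf := measurable_Psi_comp mu.
have mOB : measurable (Omega `*` B) by exact: measurableX.
have mg : measurable_fun setT (fun z : V * V => (Psi (u z.1))%:E).
  exact: (measurableT_comp mf).
have h : (\int[@lebesgue2 R n]_(z in Omega `*` B) (Psi (u z.1))%:E <=
    K%:E * energy s Psi u)%E.
  rewrite -ge0_integralZl_EFin//; last 2 first.
  - by move=> z _; exact: (energy_integrand_ge0 s Y).
  - exact: (measurable_energy s Y).
  apply: (@le_trans _ _ (\int[@lebesgue2 R n]_(z in Omega `*` B)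
      (K%:E * (Psi (Ds s u z) * mu_density z)%:E))%E).
    apply: ge0_le_integral => //.
    + by move=> z _; rewrite lee_fin (young_ge0 Y).
    + exact: measurable_funTS.
    + by apply: measurable_funTS; apply: measurable_funeM; exact: (measurable_energy s Y).
    + move=> z /OB[uz zD]; rewrite -EFinM lee_fin.
      exact: Psi_le_energy_integrand.
  apply: ge0_subset_integral => //.
  + by apply: measurable_funeM; exact: (measurable_energy s Y).
  + by move=> z _; rewrite mule_ge0// (energy_integrand_ge0 s Y).
rewrite integral_rect// in h; last by move=> z; rewrite lee_fin (young_ge0 Y).
rewrite /= in h.
have e : (\int[Leb]_(x in Omega) \int[Leb]_(y in B) (Psi (u x))%:E =
  (M ^+ n)%:E * \int[Leb]_(x in Omega) (Psi (u x))%:E)%E.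
  rewrite -ge0_integralZl_EFin//; last 3 first.
  - by move=> x _; rewrite lee_fin (young_ge0 Y).
  - exact: measurable_funTS.
  - exact: ltW.
  have LB : Leb B = (M ^+ n)%:E by exact/lebesgue_box/ltW.
  by apply: eq_integral => x _; rewrite integral_cst// [RHS]muleC; congr (_ * _)%E.
rewrite e in h.
rewrite EFinM -muleA; apply: le_trans (lee_wpmul2l _ h); last first.
  by rewrite lee_fin invr_ge0 ltW.
by rewrite muleA -EFinM mulVf ?mul1e// gt_eqF.
Qed.

End poincare.

(** * Oscillation on a cube *)

Section compactness.
Context {R : realType} (n : nat) (s : R) (n0 : (0 < n)%N) (s0 : (0 : R) < s).
Context (p r : R) (Psi psi : R -> R) (Y : young p r Psi psi) (r0 : (0 : R) < r).
Local Notation V := 'rV[R]_n.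
Local Notation Leb := (@lebesgue_rV R n).
Context (Omega : set V) (mOmega : measurable Omega).
Context (M : R) (M0 : (0 : R) < M) (OM : forall x i, Omega x -> `|x 0 i| < M).
Implicit Types u v w : V -> R.

Lemma lebesgue_Omega_lty : (Leb Omega < +oo)%E.
Proof.
apply: (@le_lt_trans _ _ (Leb (box (const_mx (- M)) (2 * M)))).
  apply: le_measure; rewrite ?inE//; first exact: measurable_box.
  move=> x Ox i; rewrite mxE; have := OM i Ox.
  have M0R : (0 : R) < M by exact: M0.
  rewrite ltr_norml => /andP[/ltW -> h] /=; apply: (lt_le_trans h); lra.
by rewrite lebesgue_box ?ltry// mulr_ge0// ltW.
Qed.

Lemma measurable_absE u : measurable_fun setT u ->
  measurable_fun setT (fun x => (`|u x|)%:E).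
Proof. by move=> mu; apply/measurable_EFinP; exact: (measurableT_comp _ mu). Qed.

Lemma L1_le_modular e : 0 < e -> exists2 C : R, 0 <= C & forall u,
  measurable_fun setT u ->
  (\int[Leb]_(x in Omega) (`|u x|)%:E <=
   e%:E * Leb Omega + C%:E * \int[Leb]_(x in Omega) (Psi (u x))%:E)%E.
Proof.
move=> e0; have [C C0 hC] := young_dominates_id Y e0; exists C => // u mu.
have mP := measurable_Psi_comp Y mu.
rewrite -ge0_integralZl_EFin//; last 2 first.
- by move=> x _; rewrite lee_fin (young_ge0 Y).
- exact: measurable_funTS.
rewrite -integral_cst// -ge0_integralD//; last 3 first.
- by move=> x _; rewrite lee_fin ltW.
- by move=> x _; rewrite -EFinM lee_fin mulr_ge0 ?(young_ge0 Y).
- by apply: measurable_funeM; exact: measurable_funTS.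
apply: ge0_le_integral => //.
- by apply: measurable_funTS; exact: measurable_absE.
- by apply: emeasurable_funD => //; apply: measurable_funeM; exact: measurable_funTS.
- by move=> x _; rewrite -EFinM -EFinD lee_fin.
Qed.

(** For fixed x, the measure a of A times w(x) is the integral over y of w(x) -
    w(y) plus the integral of w; then integrate in x. *)
Lemma cell_mean (A : set V) (a : R) w : measurable A -> Leb A = a%:E ->
  measurable_fun setT w -> (\int[Leb]_(x in A) (`|w x|)%:E < +oo)%E ->
  (a%:E * \int[Leb]_(x in A) (`|w x|)%:E <=
   \int[@lebesgue2 R n]_(z in A `*` A) (`|w z.1 - w z.2|)%:E +
   a%:E * `|\int[Leb]_(x in A) w x|%:E)%E.
Proof.
move=> mA Aa mw wA.
have a0 : 0 <= a by rewrite -lee_fin -Aa.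
have iw : Leb.-integrable A (EFin \o w).
  by apply/integrableP; split; [exact/measurable_EFinP/measurable_funTS|].
have mww : measurable_fun setT (fun z : V * V => (`|w z.1 - w z.2|)%:E).
  apply/measurable_EFinP; apply: (measurableT_comp (@normr_measurable R setT)).
  apply: measurable_funB; apply: (measurableT_comp mw).
    exact: measurable_fst.
  exact: measurable_snd.
have Alt : (Leb A < +oo)%E by rewrite Aa ltry.
have pt x : ((a * `|w x|)%:E <=
    \int[Leb]_(y in A) (`|w x - w y|)%:E + `|\int[Leb]_(y in A) w y|%:E)%E.
  have ic : Leb.-integrable A (EFin \o (fun=> w x)).
    apply: measurable_bounded_integrable => //.
    by exists `|w x|; split => // y xy z _ /=; rewrite ltW.
  have ib : Leb.-integrable A (EFin \o (fun y => w x - w y)).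
    rewrite (_ : _ \o _ = (EFin \o (fun=> w x)) \- (EFin \o w))%E//.
    exact: integrableB.
  have e : a * w x = \int[Leb]_(y in A) (w x - w y) + \int[Leb]_(y in A) w y.
    rewrite -RintegralD//; under eq_Rintegral do rewrite subrK.
    by rewrite Rintegral_cst// mulrC; congr (_ * _); exact: (congr1 fine (esym Aa)).
  rewrite -{1}(ger0_norm a0) -normrM e.
  apply: (@le_trans _ _ (`|\int[Leb]_(y in A) (w x - w y)| + `|\int[Leb]_(y in A) w y|)%:E).
    by rewrite lee_fin ler_normD.
  rewrite EFinD leeD2r// EFin_normr_Rintegral//.
  by apply: le_abse_integral => //; have /integrableP[] := ib.
rewrite integral_rect//= -ge0_integralZl_EFin//; last first.
  by apply: measurable_funTS; exact: measurable_absE.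
have mF : measurable_fun A (fun x => \int[Leb]_(y in A) (`|w x - w y|)%:E)%E.
  have := @measurable_fun_fubini_tonelli_F _ _ _ _ _ Leb
    ((fun z : V * V => (`|w z.1 - w z.2|)%:E) \_ (setT `*` A)).
  move=> h; rewrite (_ : (fun x => _) = (fun x => \int[Leb]_y ((fun z : V * V => (`|w z.1 - w z.2|)%:E) \_ (setT `*` A)) (x, y))%E).
    apply: measurable_funTS; apply: h.
      by apply/(measurable_restrictT _ _).1; [exact: measurableX|exact: measurable_funTS].
    by move=> z; apply: erestrict_ge0.
  apply/funext => x; rewrite integral_mkcond; apply: eq_integral => y _.
  rewrite !patchE; congr (if _ then _ else _); apply/idP/idP.
    by move=> /set_mem ?; apply/mem_set.
  by move=> /set_mem[_ ?]; apply/mem_set.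
apply: (@le_trans _ _ (\int[Leb]_(x in A) (\int[Leb]_(y in A) (`|w x - w y|)%:E
    + `|\int[Leb]_(y in A) w y|%:E))%E).
  apply: ge0_le_integral => //.
  - by move=> x _; rewrite -EFinM lee_fin mulr_ge0.
  - by apply: measurable_funeM; by apply: measurable_funTS; exact: measurable_absE.
  - exact: emeasurable_funD.
  - by move=> x _; rewrite -EFinM.
rewrite ge0_integralD//; last by move=> x _; exact: integral_ge0.
rewrite leeD2l// integral_cst// muleC le_eqVlt; apply/orP; left; apply/eqP.
by congr (_ * _)%E.
Qed.

(** On a cube of side h the distance is at most n h, so that |w(x) - w(y)| is
    at most (n h)^s |D^s w| and the density is at least (n h)^(-n). As Psi
    grows at least linearly, the right-hand side is the energy of the cube
    up to constants, and the factor (n h)^s is small for a fine grid. *)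
Lemma cell_ineq (C : R) (c : V) (h : R) w : 0 <= C ->
  (forall t, `|t| <= 1 + C * Psi t) -> 0 < h -> measurable_fun setT w ->
  (\int[Leb]_(x in box c h) (`|w x|)%:E < +oo)%E ->
  (\int[Leb]_(x in box c h) (`|w x|)%:E <=
   ((n%:R * h) `^ s)%R%:E * ((h ^+ n)%:E + (C * n%:R ^+ n)%:E *
      \int[@lebesgue2 R n]_(z in box c h `*` box c h)
         (Psi (Ds s w z) * mu_density z)%:E) +
   `|\int[Leb]_(x in box c h) w x|%:E)%E.
Proof.
move=> C0 hC h0 mw wA; set A := box c h in wA *; set a := h ^+ n.
have mA : measurable A by exact: measurable_box.
have a0 : 0 < a by rewrite exprn_gt0.
have Aa : Leb A = a%:E by apply: lebesgue_box; exact: ltW.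
have mAA : measurable (A `*` A) by exact: measurableX.
set E := (\int[@lebesgue2 R n]_(z in A `*` A) _)%E.
have E0 : (0 <= E)%E by apply: integral_ge0 => z _; exact: (energy_integrand_ge0 s Y).
set k := (n%:R * h) `^ s.
have nh0 : 0 < n%:R * h by rewrite mulr_gt0// ltr0n.
have k0 : 0 <= k by exact: powR_ge0.
have diffle : (\int[@lebesgue2 R n]_(z in A `*` A) (`|w z.1 - w z.2|)%:E <=
    k%:E * ((a * a)%:E + (C * (n%:R * h) ^+ n)%:E * E))%E.
  have AAa : ((a * a)%:E = \int[@lebesgue2 R n]_(z in A `*` A) (1%:E))%E.
    rewrite integral_cst// mul1e EFinM -Aa; exact/esym/lebesgue2X.
  have nng : 0 <= C * (n%:R * h) ^+ n by rewrite mulr_ge0// exprn_ge0// ltW.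
  have mE := measurable_energy s Y mw.
  rewrite AAa /E -ge0_integralZl_EFin//; last 2 first.
  - by move=> z _; exact: (energy_integrand_ge0 s Y).
  - exact: measurable_funTS.
  rewrite -ge0_integralD//; last 2 first.
  - by move=> z _; rewrite mule_ge0//; exact: (energy_integrand_ge0 s Y).
  - by apply: measurable_funeM; exact: measurable_funTS.
  rewrite -ge0_integralZl_EFin//; last 2 first.
  - move=> z _; rewrite adde_ge0// mule_ge0//; exact: (energy_integrand_ge0 s Y).
  - by apply: emeasurable_funD => //; apply: measurable_funeM; exact: measurable_funTS.
  apply: ge0_le_integral => //.
  - apply: measurable_funTS; apply/measurable_EFinP; apply: (measurableT_comp (@normr_measurable R setT)).
    apply: measurable_funB; apply: (measurableT_comp mw).
      exact: measurable_fst.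
    exact: measurable_snd.
  - by apply: measurable_funeM; apply: emeasurable_funD => //; apply: measurable_funeM; exact: measurable_funTS.
  move=> -[x y] [/= xA yA]; rewrite -!EFinM lee_fin.
  set e := enorm (x - y).
  have ele : e <= n%:R * h.
    apply: enorm_le; first exact: ltW.
    move=> i; have := xA i; have := yA i; rewrite !mxE.
    move: (x 0 i) (y 0 i) (c 0 i) => x' y' c' /andP[? ?] /andP[? ?].
    by rewrite ler_norml; apply/andP; split; lra.
  (* on the diagonal the left-hand side is 0 *)
  have [e0|e0] := eqVneq e 0.
    have /eqP := enorm_eq0 e0; rewrite subr_eq0 => /eqP ->.
    rewrite subrr normr0 mulr_ge0// addr_ge0// mulr_ge0//.
    by have := energy_integrand_ge0 s Y w (y, y); rewrite lee_fin.
  have ep : 0 < e by rewrite lt_neqAle eq_sym e0 enorm_ge0.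
  have -> : w x - w y = e `^ s * Ds s w (x, y).
    by rewrite /Ds /= -/e mulrC divfK// gt_eqF// powR_gt0.
  rewrite normrM ger0_norm ?powR_ge0//.
  apply: ler_pM; rewrite ?powR_ge0//.
    by rewrite (ge0_ler_powR (ltW s0)) ?nnegrE ?(ltW ep) ?(ltW nh0).
  apply: (le_trans (hC _)); rewrite lerD2l -mulrA ler_wpM2l//.
  rewrite mulrCA ler_peMr ?(young_ge0 Y)// /mu_density /= -/e.
  by rewrite ler_pdivlMr ?exprn_gt0// mul1r lerXn2r ?nnegrE ?(ltW ep) ?(ltW nh0).
have h1 := cell_mean mA Aa mw wA.
have h2 := le_trans h1 (leeD2r _ diffle).
have an0 : (0 <= (a^-1)%:E)%E by rewrite lee_fin invr_ge0 ltW.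
have := lee_wpmul2l an0 h2.
rewrite muleA -EFinM mulVf ?gt_eqF// mul1e => /le_trans; apply.
rewrite ge0_muleDr//; last 2 first.
- by rewrite mule_ge0// adde_ge0 ?lee_fin ?mulr_ge0// ?(ltW a0)// mule_ge0// lee_fin mulr_ge0// exprn_ge0// ltW.
- by rewrite mule_ge0// lee_fin ltW.
rewrite [X in (_ + X)%E]muleA -[X in (_ + X * _)%E]EFinM mulVf ?gt_eqF// mul1e leeD2r//.
rewrite muleCA lee_wpmul2l//.
rewrite ge0_muleDr ?lee_fin ?mulr_ge0 ?(ltW a0)//; last first.
  by rewrite mule_ge0// lee_fin mulr_ge0// exprn_ge0// ltW.
rewrite -EFinM mulrA mulVf ?gt_eqF// mul1r leeD2l// muleA -EFinM.
by rewrite exprMn mulrCA [a^-1 * _]mulrCA -/a mulVf ?mulr1// gt_eqF.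
Qed.

End compactness.

(** * Total boundedness in L1 *)

Section total_boundedness.
Context {R : realType} (n : nat) (s : R) (n0 : (0 < n)%N) (s0 : (0 : R) < s).
Context (p r : R) (Psi psi : R -> R) (Y : young p r Psi psi) (r0 : (0 : R) < r).
Local Notation V := 'rV[R]_n.
Local Notation Leb := (@lebesgue_rV R n).
Context (Omega : set V) (mOmega : measurable Omega).
Context (M : R) (M0 : (0 : R) < M) (OM : forall x i, Omega x -> `|x 0 i| < M).
Implicit Types u v w : V -> R.

Lemma integral_abs_support (A : set V) w : measurable A ->
  measurable_fun setT w -> (forall x, ~ Omega x -> w x = 0) ->
  (\int[Leb]_(x in A) (`|w x|)%:E <= \int[Leb]_(x in Omega) (`|w x|)%:E)%E.
Proof.
move=> mA mw w0; have mabs := measurable_absE mw.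
rewrite [leRHS]integral_mkcond.
rewrite (_ : _ \_ Omega = (fun x => (`|w x|)%:E)); last first.
  apply/funext => x; rewrite patchE; case: ifPn => // xO.
  by rewrite w0 ?normr0// => /mem_set; apply/negP.
exact: ge0_subset_integral.
Qed.

Lemma L1_bounded w : measurable_fun setT w -> (forall x, ~ Omega x -> w x = 0) ->
  (energy s Psi w < +oo)%E -> (\int[Leb]_(x in Omega) (`|w x|)%:E < +oo)%E.
Proof.
move=> mw w0 Ew.
have [C C0 /(_ w mw w0) hP] := poincare n0 s0 Y mOmega M0 OM r0.
have [C' C'0 /(_ w mw) h] := L1_le_modular Y mOmega ltr01.
have LO := lebesgue_Omega_lty mOmega M0 OM.
apply: (le_lt_trans h); rewrite lte_add_pinfty//.
  by rewrite mul1e.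
rewrite lte_mul_pinfty//; apply: (le_lt_trans hP).
by rewrite lte_mul_pinfty//; exact: energy_ge0 Y _.
Qed.

(** The compactness of the embedding into L1, in quantitative form: up to a
    small multiple of 1 + energy, finitely many integrals control the L1
    norm. They are the integrals over the cells of a sufficiently fine
    grid; summing cell_ineq over the disjoint cells recovers at most the
    whole energy. *)
Lemma L1_compactness (e : R) : 0 < e ->
  exists (I : finType) (A : I -> set V),
    (forall i, measurable (A i)) /\
    forall w, measurable_fun setT w -> (forall x, ~ Omega x -> w x = 0) ->
      (energy s Psi w < +oo)%E ->
      (\int[Leb]_(x in Omega) (`|w x|)%:E <=
        e%:E * (1 + energy s Psi w) + \sum_i `|\int[Leb]_(x in A i) w x|%:E)%E.
Proof.
move=> e0; have [C C0 hC] := young_dominates_id Y ltr01.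
pose B : R := (2 * M) ^+ n + C * n%:R ^+ n.
have M20 : 0 < 2 * M by rewrite mulr_gt0.
have B0 : 0 < B by rewrite ltr_pwDl ?exprn_gt0// mulr_ge0// exprn_ge0.
pose d := (e / B) `^ s^-1.
have d0 : 0 < d by rewrite powR_gt0// divr_gt0.
have nR0 : (0 : R) < n%:R by rewrite ltr0n.
pose K := (Num.truncn (n%:R * (2 * M) / d)).+1.
have K0 : (0 < K)%N by [].
have K0R : (0 : R) < K%:R by rewrite ltr0n.
pose h := 2 * M / K%:R.
have h0 : 0 < h by rewrite divr_gt0.
have nhd : n%:R * h <= d.
  rewrite /h mulrA ler_pdivrMr// [leRHS]mulrC -ler_pdivrMr// ltW//.
  have y0 : 0 <= n%:R * (2 * M) / d.
    by apply: divr_ge0; [apply: mulr_ge0|]; exact: ltW.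
  by have /andP[] := truncn_itv y0.
have kB : (n%:R * h) `^ s * B <= e.
  rewrite -ler_pdivlMr//.
  have -> : e / B = d `^ s.
    by rewrite /d -powRrM mulVf ?gt_eqF// powRr1// divr_ge0 ?ltW.
  rewrite (ge0_ler_powR (ltW s0)) ?nnegrE ?(ltW d0)//.
  by rewrite mulr_ge0 ?ltW.
exists {ffun 'I_n -> 'I_K}, (cell M); split.
  by move=> c; exact: measurable_box.
move=> w mw w0 Ew.
have L1 := L1_bounded mw w0 Ew.
have mabs := measurable_absE mw.
have tI := trivIset_cell (n := n) M0 K0.
have mcell (c : {ffun 'I_n -> 'I_K}) : measurable (cell M c) by exact: measurable_box.
pose U := \big[setU/set0]_(c <- index_enum {ffun 'I_n -> 'I_K}) cell M c.
have mU : measurable U by exact: bigsetU_measurable.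
have OU : Omega `<=` U.
  move=> x Ox; have [c cx] := cell_cover M0 K0 (fun i => OM i Ox).
  by rewrite /U -bigcup_seq; exists c => //=; rewrite mem_index_enum.
apply: (@le_trans _ _ (\int[Leb]_(x in U) (`|w x|)%:E)%E).
  by apply: ge0_subset_integral => //; exact: measurable_funTS.
rewrite ge0_integral_bigsetU//; last 3 first.
- exact: index_enum_uniq.
- exact: sub_trivIset tI.
- exact: measurable_funTS.
pose k := (n%:R * h) `^ s.
have k0 : 0 <= k by exact: powR_ge0.
pose E (c : {ffun 'I_n -> 'I_K}) := (\int[@lebesgue2 R n]_(z in cell M c `*` cell M c)
         (Psi (Ds s w z) * mu_density z)%:E)%E.
have E0 c : (0 <= E c)%E.
  by apply: integral_ge0 => z _; exact: (energy_integrand_ge0 s Y).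
have nng : 0 <= C * n%:R ^+ n by rewrite mulr_ge0// exprn_ge0.
apply: (@le_trans _ _ (\sum_c (k%:E * ((h ^+ n)%:E + (C * n%:R ^+ n)%:E * E c) +
   `|\int[Leb]_(x in cell M c) w x|%:E))%E).
  apply: lee_sum => c _; apply: (cell_ineq n0 s0 Y) => //.
  exact: le_lt_trans (integral_abs_support (mcell c) mw w0) L1.
rewrite big_split/= leeD2r//.
rewrite -ge0_sume_distrr; last first.
  move=> c _; apply: adde_ge0; first by rewrite lee_fin exprn_ge0// ltW.
  by apply: mule_ge0 => //; rewrite lee_fin.
rewrite big_split/= -ge0_sume_distrr//.
have -> : (\sum_(c : {ffun 'I_n -> 'I_K}) (h ^+ n)%:E = ((2 * M) ^+ n)%:E)%E.
  rewrite sumEFin sumr_const card_ffun !card_ord -[(h ^+ n) *+ _]mulr_natr natrX -exprMn.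
  by rewrite /h divfK// gt_eqF.
have sumE : (\sum_c E c <= energy s Psi w)%E.
  have mAA (c : {ffun 'I_n -> 'I_K}) : measurable (cell M c `*` cell M c).
    exact: measurableX.
  rewrite /E -ge0_integral_bigsetU//; first last.
  - by move=> z _; exact: (energy_integrand_ge0 s Y).
  - by apply: measurable_funTS; exact: measurable_energy Y _ _.
  - by move=> c c' _ _ [z [[h1 _] [h2 _]]]; apply: tI => //; exists z.1.
  - exact: index_enum_uniq.
  apply: ge0_subset_integral => //.
  - exact: bigsetU_measurable.
  - exact: measurable_energy Y _ _.
  - by move=> z _; exact: (energy_integrand_ge0 s Y).
have Ew0 : (0 <= energy s Psi w)%E by exact: energy_ge0 Y _.
have kBE : (k%:E * B%:E <= e%:E)%E by rewrite -EFinM lee_fin.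
apply: (@le_trans _ _ (k%:E * (B%:E * (1 + energy s Psi w)))%E); last first.
  by rewrite muleA lee_wpmul2r// adde_ge0.
rewrite lee_wpmul2l//.
rewrite ge0_muleDr// mule1 leeD//.
  by rewrite lee_fin lerDl.
apply: (@le_trans _ _ ((C * n%:R ^+ n)%:E * energy s Psi w)%E).
  by rewrite lee_wpmul2l.
by rewrite lee_wpmul2r// lee_fin lerDr exprn_ge0// ltW.
Qed.

End total_boundedness.

(** * Powers below the growth of a Young function *)

Section power_inequalities.
Context {R : realType}.

Lemma powR_sub2 (q t : R) : 1 < q -> `|t| `^ (q - 2) * t * t = `|t| `^ q.
Proof.
move=> q1; rewrite -mulrA -expr2 -real_normK ?num_real//.
have [->|t0] := eqVneq t 0.
  by rewrite normr0 expr0n mulr0 powR0// gt_eqF// (lt_trans ltr01).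
rewrite -powR_mulrn// -powRD ?subrK//.
by rewrite normr_eq0 t0 implybT.
Qed.

Lemma powR_sub1 (q t : R) : 1 < q -> `| `|t| `^ (q - 2) * t | = `|t| `^ (q - 1).
Proof.
move=> q1; rewrite normrM [X in X * _]ger0_norm ?powR_ge0//.
have [->|t0] := eqVneq t 0.
  by rewrite normr0 mulr0 powR0// subr_eq0 gt_eqF.
rewrite -[X in _ * X]powRr1// -powRD; last by rewrite normr_eq0 t0 implybT.
by congr (_ `^ _); ring.
Qed.

(** The inequality of Young with the exponents q / (q - 1) and q. *)
Lemma young_powR (q x y : R) : 1 < q -> 0 <= x -> 0 <= y ->
  x `^ (q - 1) * y <= x `^ q - x `^ q / q + y `^ q / q.
Proof.
move=> q1 x0 y0; have q0 : 0 < q by exact: lt_trans q1.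
have q10 : 0 < q - 1 by rewrite subr_gt0.
have qq : (q / (q - 1))^-1 + q^-1 = 1 :> R.
  by field; rewrite !gt_eqF.
have qq0 : 0 < q / (q - 1) by rewrite divr_gt0.
apply: (le_trans (conjugate_powR (powR_ge0 x (q - 1)) y0 qq0 q0 qq)).
have qE : (q - 1) * (q / (q - 1)) = q by field; rewrite gt_eqF.
rewrite -powRrM qE lerD2r.
rewrite le_eqVlt; apply/orP; left; apply/eqP.
by field; rewrite !gt_eqF.
Qed.

Lemma powR_tangent (q x y : R) : 1 < q ->
  `|x| `^ q / q + `|x| `^ (q - 2) * x * (y - x) <= `|y| `^ q / q.
Proof.
move=> q1; rewrite mulrBr powR_sub2//.
have h := young_powR q1 (normr_ge0 x) (normr_ge0 y).
have : `|x| `^ (q - 2) * x * y <= `|x| `^ (q - 1) * `|y|.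
  by rewrite -powR_sub1// -normrM ler_norm.
move: h; lra.
Qed.

Lemma powR_lipschitz (q T x y : R) : 1 < q -> 1 <= T -> `|x| <= T ->
  `|x| `^ q - `|y| `^ q <= q * T `^ q * `|x - y|.
Proof.
move=> q1 T1 xT; have q0 : 0 < q by exact: lt_trans q1.
have := @powR_tangent q `|x| `|y| q1; rewrite !normr_id.
set c := `|x| `^ (q - 2) * `|x|.
have c0 : 0 <= c by rewrite mulr_ge0 ?powR_ge0.
have cE : c = `|x| `^ (q - 1).
  by rewrite -powR_sub1// -[LHS]ger0_norm// /c !normrM normr_id.
have cT : c <= T `^ q.
  rewrite cE (@le_trans _ _ (T `^ (q - 1)))//.
    rewrite (ge0_ler_powR _) ?nnegrE ?subr_ge0 ?(ltW q1)//.
    exact: le_trans T1.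
  by rewrite (ler_powR T1)// gerBl.
move=> h.
have h1 : `|x| `^ q / q - `|y| `^ q / q <= T `^ q * `|x - y|.
  apply: (@le_trans _ _ (c * (`|x| - `|y|))); first lra.
  apply: (@le_trans _ _ (c * `|x - y|)); first by rewrite ler_wpM2l// lerB_dist.
  by rewrite ler_wpM2r.
by rewrite -mulrA -ler_pdivrMl// mulrC mulrBl.
Qed.

Context (p r : R) (Psi psi : R -> R) (Y : young p r Psi psi).
Context (Q : R) (Qp : Q < p).

(** For |t| >= 1 one has |t|^q <= |t|^Q and Psi(t) >= Psi(1) |t|^p; the surplus
    |t|^(p - Q) exceeds any constant for large |t|. *)
Lemma powR_dominated e : 0 < e -> exists2 T : R, 1 <= T &
  forall q t, 1 < q <= Q -> T <= `|t| -> `|t| `^ q <= e * Psi t.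
Proof.
move=> e0; have P1 := young1_gt0 Y.
have pQ : 0 < p - Q by rewrite subr_gt0.
pose T := Num.max 1 ((e * Psi 1)^-1 `^ (p - Q)^-1).
have T1 : 1 <= T by rewrite le_max lexx.
have T0 : 0 < T by exact: lt_le_trans T1.
exists T => // q t /andP[q1 qQ] Tt.
have t1 : 1 <= `|t| by exact: le_trans Tt.
apply: (@le_trans _ _ (`|t| `^ Q)); first by rewrite ler_powR.
have h := young_growth Y t1.
have TpQ : (e * Psi 1)^-1 <= `|t| `^ (p - Q).
  have -> : (e * Psi 1)^-1 = ((e * Psi 1)^-1 `^ (p - Q)^-1) `^ (p - Q).
    by rewrite -powRrM mulVf ?gt_eqF// powRr1// invr_ge0 mulr_ge0 ?ltW.
  rewrite (ge0_ler_powR (ltW pQ)) ?nnegrE ?powR_ge0//.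
  by rewrite (le_trans _ Tt)// le_max lexx orbT.
have eP : 0 < e * Psi 1 by rewrite mulr_gt0.
apply: (@le_trans _ _ (e * (Psi 1 * `|t| `^ p))); last by rewrite ler_pM2l.
have -> : `|t| `^ p = `|t| `^ Q * `|t| `^ (p - Q).
  rewrite -powRD; first by rewrite addrC subrK.
  by rewrite (gt_eqF (lt_le_trans ltr01 t1)) implybT.
rewrite (_ : e * _ = `|t| `^ Q * (e * Psi 1 * `|t| `^ (p - Q))); last by ring.
rewrite ler_peMr ?powR_ge0//.
by rewrite -ler_pdivrMl// mulr1.
Qed.

Lemma powR_le_young e : 0 < e -> exists2 C : R, 0 <= C &
  forall q t, 1 < q <= Q -> `|t| `^ q / q <= C + e * Psi t.
Proof.
move=> e0; have [T T1 h] := powR_dominated e0.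
exists (T `^ Q); first exact: powR_ge0.
move=> q t q1Q; have /andP[q1 qQ] := q1Q.
have q0 : 0 < q by exact: lt_trans q1.
apply: (@le_trans _ _ (`|t| `^ q)).
  by rewrite ler_pdivrMr// ler_peMr ?powR_ge0// ltW.
have [Tt|tT] := leP T `|t|.
  by rewrite (le_trans (h _ _ q1Q Tt))// lerDr powR_ge0.
apply: (@le_trans _ _ (T `^ Q)); last by rewrite lerDl mulr_ge0 ?(young_ge0 Y)// ltW.
apply: (@le_trans _ _ (T `^ q)); last by rewrite ler_powR.
by rewrite (ge0_ler_powR (ltW q0)) ?nnegrE ?(ltW tT)// (le_trans ler01).
Qed.

(** Where |x| is large its power is absorbed by Psi, elsewhere the power is
    Lipschitz; both bounds are uniform in q in (1, Q]. *)
Lemma powR_young_diff e : 0 < e -> exists2 C : R, 0 <= C &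
  forall q x y, 1 < q <= Q ->
    `|x| `^ q / q <= `|y| `^ q / q + e * Psi x + C * `|x - y|.
Proof.
move=> e0; have [T T1 h] := powR_dominated e0.
exists (T `^ Q); first exact: powR_ge0.
move=> q x y q1Q; have /andP[q1 qQ] := q1Q.
have q0 : 0 < q by exact: lt_trans q1.
have y0 : 0 <= `|y| `^ q / q by rewrite divr_ge0 ?powR_ge0// ltW.
have c0 : 0 <= T `^ Q * `|x - y| by rewrite mulr_ge0 ?powR_ge0.
have P0 : 0 <= e * Psi x by rewrite mulr_ge0 ?(young_ge0 Y)// ltW.
have [Tx|xT] := leP T `|x|.
  have h1 := h _ _ q1Q Tx.
  have : `|x| `^ q / q <= `|x| `^ q.
    by rewrite ler_pdivrMr// ler_peMr ?powR_ge0// ltW.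
  move: c0 y0 h1; lra.
have h2 := powR_lipschitz y q1 T1 (ltW xT).
have h3 : `|x| `^ q / q - `|y| `^ q / q <= T `^ q * `|x - y|.
  by rewrite -mulrBl ler_pdivrMr// [leRHS]mulrC mulrA.
have h4 : T `^ q * `|x - y| <= T `^ Q * `|x - y| by rewrite ler_wpM2r// ler_powR.
move: P0 h3 h4; lra.
Qed.

End power_inequalities.

(** * The functionals on functions of finite energy *)

Section real_functionals.
Context {R : realType} (n : nat) (s : R) (n0 : (0 < n)%N) (s0 : (0 : R) < s).
Context (p r : R) (Psi psi : R -> R) (Y : young p r Psi psi)
  (r0 : (0 : R) < r).
Local Notation V := 'rV[R]_n.
Local Notation Leb := (@lebesgue_rV R n).
Context (Omega : set V) (mOmega : measurable Omega).
Context (M : R) (M0 : (0 : R) < M) (OM : forall x i, Omega x -> `|x 0 i| < M).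
Context (q : V -> R) (mq : measurable_fun Omega q) (Q : R) (Qp : Q < p).
Context (hq : forall x, Omega x -> 1 < q x <= Q).
Implicit Types u v w : V -> R.

(** The functions vanish outside Omega everywhere, not just almost everywhere,
    so that the energy integrand vanishes off Q. *)
Definition finite_energy u := [/\ measurable_fun setT u,
  forall x, ~ Omega x -> u x = 0 & (energy s Psi u < +oo)%E].

Lemma energy_fin u : finite_energy u -> (energy s Psi u = (fine (energy s Psi u))%:E)%E.
Proof.
by move=> [_ _ Eu]; rewrite fineK// ge0_fin_numE//; exact: energy_ge0 Y _.
Qed.

Local Notation E := (fun u => fine (energy s Psi u)).

Lemma E_ge0 u : 0 <= E u.
Proof. by rewrite fine_ge0//; exact: energy_ge0 Y _. Qed.

Lemma finite_energy_comb u v (a b : R) : finite_energy u -> finite_energy v ->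
  finite_energy (fun x => a * u x + b * v x).
Proof.
move=> [mu u0 Eu] [mv v0 Ev].
have mau : measurable_fun setT (fun x => a * u x) by exact: measurable_funM.
have mbv : measurable_fun setT (fun x => b * v x) by exact: measurable_funM.
split; first exact: measurable_funD.
  by move=> x Ox; rewrite u0// v0// !mulr0 addr0.
have sc (c : R) w : measurable_fun setT w -> (energy s Psi w < +oo)%E ->
    (energy s Psi (fun x => c * w x)%R < +oo)%E.
  move=> mw Ew; apply: (le_lt_trans (energy_scale s Y c mw)).
  by rewrite lte_mul_pinfty// ?lee_fin ?powR_ge0//.
apply: (le_lt_trans (energy_double s Y mau mbv)).
by rewrite lte_add_pinfty// lte_mul_pinfty// ?lee_fin ?powR_ge0// sc.
Qed.

Lemma finite_energyB u v : finite_energy u -> finite_energy v ->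
  finite_energy (fun x => u x - v x).
Proof.
move=> fu fv; have := finite_energy_comb 1 (- 1) fu fv.
by congr finite_energy; apply/funext => x; ring.
Qed.

Lemma E_comb1 u v1 v2 (A B : R) : finite_energy u -> finite_energy v1 ->
  finite_energy v2 ->
  (energy s Psi u <= A%:E * energy s Psi v1 + B%:E * energy s Psi v2)%E ->
  E u <= A * E v1 + B * E v2.
Proof.
by move=> /energy_fin -> /energy_fin -> /energy_fin ->; rewrite -!EFinM -EFinD lee_fin.
Qed.

Lemma E_perturb e : 0 < e -> exists2 C : R, 0 <= C & forall u v,
  finite_energy u -> finite_energy v ->
  E u <= (1 + e) * E v + C * E (fun x => u x - v x).
Proof.
move=> e0; have [C C0 hC] := energy_perturb n s Y e0; exists C => // u v fu fv.
apply: E_comb1 => //; first exact: finite_energyB.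
by case: fu => mu _ _; case: fv => mv _ _; exact: hC.
Qed.

Lemma E_double u v : finite_energy u -> finite_energy v ->
  E (fun x => u x + v x) <= 2 `^ r * E u + 2 `^ r * E v.
Proof.
move=> fu fv; apply: E_comb1 => //.
  have := finite_energy_comb 1 1 fu fv.
  by congr finite_energy; apply/funext => x; ring.
by case: fu => mu _ _; case: fv => mv _ _; exact: energy_double Y _ _ _ _.
Qed.

Lemma E_scale c u : finite_energy u ->
  E (fun x => c * u x) <= Num.max 1 `|c| `^ r * E u.
Proof.
move=> fu; rewrite -[leRHS]addr0 -[X in _ + X](mul0r (E u)).
apply: E_comb1 => //.
  have := finite_energy_comb c 0 fu fu.
  by congr finite_energy; apply/funext => x; ring.
by rewrite mul0e adde0; case: fu => mu _ _; exact: (energy_scale s Y c mu).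
Qed.

Lemma E_sym u v : E (fun x => u x - v x) = E (fun x => v x - u x).
Proof. by congr fine; exact: (energyB s Y). Qed.

Lemma E_parallelogram u v : finite_energy u -> finite_energy v ->
  E (fun x => 2^-1 * u x + 2^-1 * v x) + E (fun x => 2^-1 * u x + (- 2^-1) * v x) <=
  (E u + E v) / 2.
Proof.
move=> fu fv.
have h1 := finite_energy_comb 2^-1 2^-1 fu fv.
have h2 := finite_energy_comb 2^-1 (- 2^-1) fu fv.
have [mu _ _] := fu; have [mv _ _] := fv.
have := energy_parallelogram s Y mu mv.
rewrite (_ : (fun x => (u x + v x) / 2) = (fun x => 2^-1 * u x + 2^-1 * v x)); last first.
  by apply/funext => x; ring.
rewrite (_ : (fun x => (u x - v x) / 2) = (fun x => 2^-1 * u x + (- 2^-1) * v x)); last first.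
  by apply/funext => x; ring.
rewrite (energy_fin h1) (energy_fin h2) (energy_fin fu) (energy_fin fv).
rewrite -!EFinM -!EFinD lee_fin; lra.
Qed.

Definition L1 w : R := fine (\int[Leb]_(x in Omega) (`|w x|)%:E)%E.

Lemma L1_fin w : finite_energy w ->
  (\int[Leb]_(x in Omega) (`|w x|)%:E = (L1 w)%:E)%E.
Proof.
move=> [mw w0 Ew]; rewrite fineK// ge0_fin_numE ?integral_ge0//.
exact: (L1_bounded n0 s0 Y r0 mOmega M0 OM).
Qed.

Lemma L1_ge0 w : 0 <= L1 w. Proof. by rewrite fine_ge0// integral_ge0. Qed.

Lemma finite_integrable (A : set V) w : measurable A -> finite_energy w ->
  Leb.-integrable A (EFin \o w).
Proof.
move=> mA fw; have [mw w0 Ew] := fw; apply/integrableP; split.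
  exact/measurable_EFinP/measurable_funTS.
by rewrite (le_lt_trans (integral_abs_support mA mw w0))// L1_fin// ltry.
Qed.

Lemma L1_compact e : 0 < e -> exists (I : finType) (A : I -> set V),
  (forall i, measurable (A i)) /\ forall w, finite_energy w ->
  L1 w <= e * (1 + E w) + \sum_i `|\int[Leb]_(x in A i) w x|.
Proof.
move=> e0; have [I [A [mA hA]]] := L1_compactness n0 s0 Y r0 mOmega M0 OM e0.
exists I, A; split => // w fw; have [mw w0 Ew] := fw.
have := hA w mw w0 Ew; rewrite (energy_fin fw) L1_fin//.
by rewrite sumEFin -EFinD lee_fin.
Qed.

Definition modular u : R := fine (\int[Leb]_(x in Omega) (Psi (u x))%:E)%E.

Lemma modular_poincare : exists2 C : R, 0 <= C & forall u, finite_energy u ->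
  (\int[Leb]_(x in Omega) (Psi (u x))%:E = (modular u)%:E)%E /\ modular u <= C * E u.
Proof.
have [C C0 hC] := poincare n0 s0 Y mOmega M0 OM r0; exists C => // u fu.
have [mu u0 Eu] := fu; have h := hC u mu u0.
have e : (\int[Leb]_(x in Omega) (Psi (u x))%:E = (modular u)%:E)%E.
  rewrite fineK// ge0_fin_numE.
    by apply: (le_lt_trans h); rewrite (energy_fin fu) -EFinM ltry.
  by apply: integral_ge0 => x _; rewrite lee_fin (young_ge0 Y).
by split => //; move: h; rewrite e (energy_fin fu) -EFinM lee_fin.
Qed.

Let LebO : (Leb Omega = (fine (Leb Omega))%:E)%E.
Proof.
have LO := lebesgue_Omega_lty mOmega M0 OM; by rewrite fineK// ge0_fin_numE//.
Qed.

(** Here the additive constant is small, rather than the factor of the energy: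
    so the L1 norm is continuous at 0 for the energy. *)
Lemma L1_le_E e : 0 < e -> exists2 C : R, 0 <= C & forall w, finite_energy w ->
  L1 w <= e + C * E w.
Proof.
move=> e0; pose m := fine (Leb Omega) + 1.
have m0 : 0 < m by rewrite ltr_wpDl ?fine_ge0.
have [C C0 hC] := L1_le_modular Y mOmega (divr_gt0 e0 m0).
have [C' C'0 hC'] := modular_poincare.
exists (C * C'); first exact: mulr_ge0.
move=> w fw; have [mw _ _] := fw; have [e1 h2] := hC' w fw.
have := hC w mw; rewrite e1 L1_fin// LebO -!EFinM -EFinD lee_fin => h.
apply: (le_trans h); rewrite lerD//.
  by rewrite -mulrA ler_piMr// ?(ltW e0)// mulrC ler_pdivrMr// mul1r lerDl.
by rewrite -mulrA ler_wpM2l.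
Qed.

(** With a variable exponent, measurability is read off from the exponential of
    a product; the factor t makes both sides agree at 0. *)
Lemma pow_expR (t c : R) : `|t| `^ c * t = expR (c * ln `|t|) * t.
Proof.
have [->|t0] := eqVneq t 0; first by rewrite !mulr0.
by rewrite /powR normr_eq0 (negbTE t0).
Qed.

Lemma measurable_rhs u v : measurable_fun setT u -> measurable_fun setT v ->
  measurable_fun Omega (rhs_integrand q u v).
Proof.
move=> mu mv; rewrite /rhs_integrand; under eq_fun do rewrite pow_expR.
have mu' : measurable_fun Omega u by exact: measurable_funTS.
have mv' : measurable_fun Omega v by exact: measurable_funTS.
apply: measurable_funM => //; apply: measurable_funM => //.
apply: (measurableT_comp (@measurable_expR R)); apply: measurable_funM.
  exact: measurable_funB.
apply: (measurableT_comp (@measurable_ln R)).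
exact: (measurableT_comp (@normr_measurable R setT)).
Qed.

Definition Gint u (x : V) : R := `|u x| `^ q x / q x.

Lemma Gint_ge0 u x : Omega x -> 0 <= Gint u x.
Proof.
move=> /hq /andP[q1 _]; rewrite divr_ge0 ?powR_ge0// ltW//.
exact: lt_trans q1.
Qed.

Lemma measurable_Gint u : measurable_fun setT u -> measurable_fun Omega (Gint u).
Proof.
move=> mu; apply: (@eq_measurable_fun _ _ _ _ _ (fun x => rhs_integrand q u u x * q x `^ (- 1))).
  move=> x /set_mem /hq /andP[q1 _].
  rewrite /rhs_integrand /Gint powR_sub2// powR_inv1// ltW//.
  exact: lt_trans q1.
apply: measurable_funM; first exact: measurable_rhs.
exact: (measurableT_comp (@measurable_powR R (- 1)) mq).
Qed.

Definition G u : R := fine (\int[Leb]_(x in Omega) (Gint u x)%:E)%E.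

Lemma G_ge0 u : 0 <= G u.
Proof.
by rewrite fine_ge0// integral_ge0// => x Ox; rewrite lee_fin Gint_ge0.
Qed.

Let G_bound e : 0 < e -> exists2 C : R, 0 <= C & forall u, finite_energy u ->
  (\int[Leb]_(x in Omega) (Gint u x)%:E <= (C + e * E u)%:E)%E.
Proof.
move=> e0; have [C' C'0 hC'] := modular_poincare.
have d0 : 0 < e / (C' + 1) by rewrite divr_gt0// ltr_wpDl.
have [C C0 hC] := powR_le_young Y Qp d0.
exists (C * fine (Leb Omega)); first by rewrite mulr_ge0// fine_ge0.
move=> u fu; have [mu u0 Eu] := fu; have [e1 h1] := hC' u fu.
have mP : measurable_fun Omega (fun x => (Psi (u x))%:E).
  by apply: measurable_funTS; exact: (measurable_Psi_comp Y).
apply: (@le_trans _ _ (\int[Leb]_(x in Omega) (C%:E + (e / (C' + 1))%:E * (Psi (u x))%:E))%E).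
  apply: ge0_le_integral => //.
  - by move=> x Ox; rewrite lee_fin Gint_ge0.
  - by apply/measurable_EFinP; exact: measurable_Gint.
  - by apply: emeasurable_funD => //; exact: measurable_funeM.
  - by move=> x Ox; rewrite -EFinM -EFinD lee_fin hC ?hq.
rewrite ge0_integralD//; last 2 first.
- by move=> x _; rewrite -EFinM lee_fin mulr_ge0 ?(young_ge0 Y)// ltW.
- exact: measurable_funeM.
rewrite integral_cst// ge0_integralZl_EFin//; last 2 first.
- by move=> x _; rewrite lee_fin (young_ge0 Y).
- exact: ltW.
rewrite e1 [X in (_ * X + _)%E](LebO) -!EFinM -EFinD lee_fin lerD2l.
rewrite mulrAC ler_pdivrMr ?ltr_wpDl// -mulrA ler_pM2l//.
rewrite (le_trans h1)// mulrC ler_wpM2l ?E_ge0// lerDl//.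
Qed.

Lemma G_fin u : finite_energy u ->
  (\int[Leb]_(x in Omega) (Gint u x)%:E = (G u)%:E)%E.
Proof.
move=> fu; rewrite fineK// ge0_fin_numE.
  by have [C _ /(_ u fu) h] := G_bound ltr01; rewrite (le_lt_trans h)// ltry.
by rewrite integral_ge0// => x Ox; rewrite lee_fin Gint_ge0.
Qed.

(** With a small factor of the energy this makes the functional coercive: the
    growth exponents of G stay below p. *)
Lemma G_le e : 0 < e -> exists2 C : R, 0 <= C & forall u, finite_energy u ->
  G u <= C + e * E u.
Proof.
move=> /G_bound[C C0 hC]; exists C => // u fu.
by have := hC u fu; rewrite G_fin// lee_fin.
Qed.

(** G is continuous for the L1 distance, up to a small multiple of the energy.
    Compactness in L1 enters the minimisation through this bound. *)
Lemma G_diff e : 0 < e -> exists2 C : R, 0 <= C & forall u v,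
  finite_energy u -> finite_energy v ->
  G u <= G v + e * E u + C * L1 (fun x => u x - v x).
Proof.
move=> e0; have [C' C'0 hC'] := modular_poincare.
have d0 : 0 < e / (C' + 1) by rewrite divr_gt0// ltr_wpDl.
have [C C0 hC] := powR_young_diff Y Qp d0.
exists C => // u v fu fv; have [mu u0 Eu] := fu; have [e1 h1] := hC' u fu.
have [mv v0 Ev] := fv; have fuv := finite_energyB fu fv.
have mP : measurable_fun Omega (fun x => (Psi (u x))%:E).
  by apply: measurable_funTS; exact: (measurable_Psi_comp Y).
have muv : measurable_fun Omega (fun x => (`|u x - v x|)%:E).
  by apply: measurable_funTS; apply: measurable_absE; exact: measurable_funB.
have mG := measurable_Gint.
have : (\int[Leb]_(x in Omega) (Gint u x)%:E <= \int[Leb]_(x in Omega)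
    ((Gint v x)%:E + (e / (C' + 1))%:E * (Psi (u x))%:E + C%:E * (`|u x - v x|)%:E))%E.
  apply: ge0_le_integral => //.
  - by move=> x Ox; rewrite lee_fin Gint_ge0.
  - by apply/measurable_EFinP; exact: mG.
  - apply: emeasurable_funD; last exact: measurable_funeM.
    apply: emeasurable_funD; last exact: measurable_funeM.
    by apply/measurable_EFinP; exact: mG.
  - by move=> x Ox; rewrite -!EFinM -!EFinD lee_fin hC ?hq.
have P0 x : (0 <= (e / (C' + 1))%:E * (Psi (u x))%:E)%E.
  by rewrite -EFinM lee_fin mulr_ge0 ?(young_ge0 Y)// ltW.
rewrite ge0_integralD//; last 4 first.
- by move=> x Ox; rewrite adde_ge0// lee_fin Gint_ge0.
- apply: emeasurable_funD; last exact: measurable_funeM.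
  by apply/measurable_EFinP; exact: mG.
- by move=> x _; rewrite -EFinM lee_fin mulr_ge0.
- exact: measurable_funeM.
rewrite ge0_integralD//; last 3 first.
- by move=> x Ox; rewrite lee_fin Gint_ge0.
- by apply/measurable_EFinP; exact: mG.
- exact: measurable_funeM.
rewrite !ge0_integralZl_EFin//; last 2 first.
- by move=> x _; rewrite lee_fin (young_ge0 Y).
- exact: ltW.
rewrite e1 !G_fin// L1_fin// -!EFinM -!EFinD lee_fin => h.
apply: (le_trans h); rewrite lerD2r lerD2l.
rewrite mulrAC ler_pdivrMr ?ltr_wpDl// -mulrA ler_pM2l//.
by rewrite (le_trans h1)// mulrC ler_wpM2l ?E_ge0// lerDl.
Qed.

End real_functionals.

(** * An integrable kernel *)

Section frac_kernel.
Context {R : realType} (n : nat) (b : R) (b0 : (0 : R) < b).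
Local Notation V := 'rV[R]_n.
Local Notation Leb := (@lebesgue_rV R n).

(** Integrable in y near x and at infinity alike, with a bound independent of
    x. It dominates the energy integrand of bounded Lipschitz functions. *)
Definition frac_kernel (z : V * V) : R :=
  mu_density z * Num.min (enorm (z.1 - z.2) `^ b) (enorm (z.1 - z.2) `^ (- b)).

Lemma frac_kernel_ge0 z : 0 <= frac_kernel z.
Proof. by rewrite mulr_ge0 ?mu_density_ge0// le_min !powR_ge0. Qed.

Lemma frac_kernelC x y : frac_kernel (x, y) = frac_kernel (y, x).
Proof. by rewrite /frac_kernel /mu_density /= enormB. Qed.

Lemma measurable_frac_kernel : measurable_fun setT frac_kernel.
Proof.
apply: measurable_funM; first exact: measurable_mu_density.
apply: measurable_minr.
  by apply: (measurableT_comp (@measurable_powR _ b)); exact: measurable_enormB.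
by apply: (measurableT_comp (@measurable_powR _ (- b))); exact: measurable_enormB.
Qed.

Let q : R := 2 `^ (- b).

Let q0 : 0 < q. Proof. exact: powR_gt0. Qed.

Let q1 : q < 1.
Proof.
have : 1 < 2 `^ b :> R.
  by rewrite /powR gt_eqF// expR_gt1 mulr_gt0// ln_gt0// ltr1n.
by move=> h; rewrite /q powRN invf_lt1 ?powR_gt0.
Qed.

Let pow2 (k : nat) : (2 ^- k) `^ b = q ^+ k.
Proof.
rewrite /q -powR_mulrn ?powR_ge0// -powRrM.
by rewrite -powR_invn// -powRrM mulrC mulNr mulrN.
Qed.

Let cover_near (e : R) : 0 < e <= 1 -> exists k, 2 ^- k.+1 < e <= 2 ^- k.
Proof.
move=> /andP[e0 e1].
have ex : exists k, 2 ^- k.+1 < e.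
  have ei0 : 0 <= e^-1 by rewrite invr_ge0 ltW.
  exists (Num.truncn e^-1).
  rewrite invf_plt ?posrE ?exprn_gt0//.
  have /andP[_ h] := truncn_itv ei0; apply: (lt_le_trans h).
  by rewrite -natrX ler_nat ltnW// ltn_expl.
have [k hk mk] := ex_minnP ex; exists k; rewrite hk/=.
case: k hk mk => [|k] hk mk; first by rewrite expr0 invr1.
by rewrite leNgt; apply/negP => /mk; rewrite ltnn.
Qed.

Let cover_far (e : R) : 1 < e -> exists k, 2 ^+ k < e <= 2 ^+ k.+1.
Proof.
move=> e1.
have ex : exists k, e <= 2 ^+ k.+1.
  have ei0 : 0 <= e by rewrite ltW// (lt_trans ltr01).
  exists (Num.truncn e).
  have /andP[_ h] := truncn_itv ei0; apply: (le_trans (ltW h)).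
  by rewrite -natrX ler_nat ltnW// ltn_expl.
have [k hk mk] := ex_minnP ex; exists k; rewrite hk andbT.
case: k hk mk => [|k] hk mk; first by rewrite expr0.
by rewrite ltNge; apply/negP => /mk; rewrite ltnn.
Qed.

Let ball_box (x : V) (h : R) : set V := box (\row_i (x 0 i - 2 * h)) (4 * h).

Let in_ball_box x y h : 0 < h -> enorm (x - y) <= h -> ball_box x h y.
Proof.
move=> h0 xyh i; rewrite mxE.
have := le_trans (coord_le_enorm (x - y) i) xyh; rewrite !mxE ler_norml.
move: (x 0 i) (y 0 i) => x' y' /andP[? ?].
by apply/andP; split; lra.
Qed.

(** Majorant of the kernel on the two dyadic shells of index k, inside and
    outside the unit ball. *)
Let term (x : V) (k : nat) (y : V) : R :=
  (2 ^+ k.+1) ^+ n * q ^+ k * \1_(ball_box x (2 ^- k)) y +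
  (2 ^- k) ^+ n * q ^+ k * \1_(ball_box x (2 ^+ k.+1)) y.

Let mball x h : measurable (ball_box x h). Proof. exact: measurable_box. Qed.

Let term_ge0 x k y : 0 <= term x k y.
Proof.
by rewrite addr_ge0// !mulr_ge0// ?exprn_ge0// ?invr_ge0// ?exprn_ge0// ltW.
Qed.

Let measurable_term x k : measurable_fun setT (fun y => (term x k y)%:E).
Proof.
by apply/measurable_EFinP; apply: measurable_funD; apply: measurable_funM => //;
  exact: measurable_indic.
Qed.

Let integral_term x k :
  (\int[Leb]_y (term x k y)%:E = (2 * 8 ^+ n * q ^+ k)%:E)%E.
Proof.
under eq_integral do rewrite EFinD !EFinM.
have c1 : 0 <= (2 ^+ k.+1) ^+ n * q ^+ k by rewrite mulr_ge0// ?exprn_ge0// ltW.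
have c2 : 0 <= (2 ^- k) ^+ n * q ^+ k :> R.
  by rewrite mulr_ge0// ?exprn_ge0 ?invr_ge0 ?exprn_ge0// ltW.
have mi h : measurable_fun setT (fun y => (\1_(ball_box x h) y)%:E : \bar R).
  by apply/measurable_EFinP; exact: measurable_indic.
rewrite ge0_integralD//; last 4 first.
- by move=> y _; rewrite -!EFinM lee_fin mulr_ge0.
- by rewrite -EFinM; apply: measurable_funeM.
- by move=> y _; rewrite -!EFinM lee_fin mulr_ge0.
- by rewrite -EFinM; apply: measurable_funeM.
rewrite -!EFinM !ge0_integralZl_EFin// !integral_indic// !setIT.
have LB h : 0 < h -> Leb (ball_box x h) = ((4 * h) ^+ n)%:E.
  by move=> h0; rewrite lebesgue_box// mulr_ge0// ltW.
rewrite [X in (_ * X + _)%E](LB (2 ^- k) _) ?invr_gt0 ?exprn_gt0//.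
rewrite [X in (_ + _ * X)%E](LB (2 ^+ k.+1) _) ?exprn_gt0//.
rewrite -!EFinM -EFinD; congr EFin.
rewrite [X in X + _]mulrAC [X in _ + X]mulrAC -!exprMn.
rewrite (_ : 2 ^+ k.+1 * (4 / 2 ^+ k) = 8); last first.
  by rewrite exprS; field; rewrite expf_neq0.
rewrite (_ : 2 ^- k * (4 * 2 ^+ k.+1) = 8); last first.
  by rewrite exprS; field; rewrite expf_neq0.
ring.
Qed.

(** Split into the dyadic shells 2^(-k - 1) < |x - y| <= 2^(-k) and 2^k < |x -
    y| <= 2^(k + 1). On each, the density times the volume of an enclosing
    cube is bounded by a constant, and the minimum is at most 2^(-b k): the
    sum is geometric. *)
Lemma frac_kernel_integral : exists2 C : R, 0 <= C &
  forall x, (\int[Leb]_y (frac_kernel (x, y))%:E <= C%:E)%E.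
Proof.
exists (2 * 8 ^+ n * (1 - q)^-1).
  by rewrite mulr_ge0 ?mulr_ge0 ?exprn_ge0// invr_ge0 subr_ge0 ltW.
move=> x.
apply: (@le_trans _ _ (\int[Leb]_y (\sum_(k <oo) (term x k y)%:E))%E); last first.
  rewrite integral_nneseries//; last by move=> k y _; rewrite lee_fin.
  under eq_eseriesr do rewrite integral_term.
  apply: lime_le.
    by apply: is_cvg_nneseries => k _ _; rewrite lee_fin !mulr_ge0 ?exprn_ge0// ltW.
  near=> m; rewrite sumEFin lee_fin.
  apply: (geometric_le_lim m _ q0); last by rewrite gtr0_norm.
  by rewrite mulr_ge0// exprn_ge0.
have mt : measurable_fun setT (fun y => (\sum_(k <oo) (term x k y)%:E)%E).
  by apply: ge0_emeasurable_sum => // k y _ _; rewrite lee_fin.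
apply: ge0_le_integral => //.
- by move=> y _; rewrite lee_fin frac_kernel_ge0.
- apply/measurable_EFinP; apply: (measurableT_comp measurable_frac_kernel).
  by apply: measurable_fun_pair => //; exact: measurable_cst.
move=> y _.
suff [k hk] : exists k, frac_kernel (x, y) <= term x k y.
  apply: (@le_trans _ _ (term x k y)%:E); first by rewrite lee_fin.
  apply: le_trans (nneseries_lim_ge k.+1 _); last by move=> m _ _; rewrite lee_fin.
  rewrite big_nat_recr//= leeDr// sume_ge0// => m _.
  by rewrite lee_fin.
rewrite /frac_kernel/= /mu_density/=; set e := enorm (x - y).
have [e0|e0] := eqVneq e 0.
  exists 0%N; rewrite e0; apply: le_trans (term_ge0 _ _ _).
  case: (n) => [|n']; last by rewrite expr0n/= invr0 mul0r.
  rewrite expr0 invr1 mul1r ge_min; apply/orP; left.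
  by rewrite powR0// gt_eqF.
have ep : 0 < e by rewrite lt_neqAle eq_sym e0 enorm_ge0.
have t1 k : 0 <= (2 ^+ k.+1) ^+ n * q ^+ k * \1_(ball_box x (2 ^- k)) y.
  by rewrite !mulr_ge0// ?exprn_ge0// ltW.
have t2 k : 0 <= (2 ^- k) ^+ n * q ^+ k * \1_(ball_box x (2 ^+ k.+1)) y.
  by rewrite !mulr_ge0// ?exprn_ge0// ?invr_ge0// ?exprn_ge0// ltW.
have [e1|e1] := lerP e 1.
  have e01 : 0 < e <= 1 by rewrite ep.
  have [k /andP[ke ek]] := cover_near e01; exists k.
  apply: le_trans (_ : (2 ^+ k.+1) ^+ n * q ^+ k * \1_(ball_box x (2 ^- k)) y <= _); last by rewrite lerDl.
  rewrite indicE mem_set ?mulr1; last first.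
    by apply: in_ball_box; rewrite ?invr_gt0 ?exprn_gt0.
  apply: ler_pM; rewrite ?invr_ge0 ?exprn_ge0 ?(ltW ep) ?le_min ?powR_ge0//.
    rewrite -exprVn lerXn2r ?nnegrE ?invr_ge0 ?(ltW ep) ?exprn_ge0//.
    by rewrite invf_ple ?posrE ?exprn_gt0// ltW.
  rewrite -pow2 ge_min; apply/orP; left.
  by rewrite (ge0_ler_powR (ltW b0)) ?nnegrE ?(ltW ep) ?invr_ge0 ?exprn_ge0.
have [k /andP[ke ek]] := cover_far e1; exists k.
apply: le_trans (_ : (2 ^- k) ^+ n * q ^+ k * \1_(ball_box x (2 ^+ k.+1)) y <= _); last by rewrite lerDr.
rewrite indicE mem_set ?mulr1; last first.
  by apply: in_ball_box; rewrite ?exprn_gt0.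
have k2 : 0 < 2 ^+ k :> R by rewrite exprn_gt0.
apply: ler_pM; rewrite ?invr_ge0 ?exprn_ge0 ?(ltW ep) ?le_min ?powR_ge0//.
  rewrite -[e ^- n]exprVn lerXn2r ?nnegrE ?invr_ge0 ?(ltW ep) ?(ltW k2)//.
  by rewrite lef_pV2 ?posrE// ltW.
rewrite -pow2 ge_min; apply/orP; right.
rewrite powRN -[2 ^- k]powR_inv1 ?(ltW k2)// powRAC powR_inv1 ?powR_ge0//.
rewrite lef_pV2 ?posrE ?powR_gt0//.
by rewrite (ge0_ler_powR (ltW b0)) ?nnegrE ?(ltW ep) ?(ltW k2) ?(ltW ke).
Unshelve. all: by end_near. Qed.

End frac_kernel.

(** * The energy of Lipschitz functions *)

Section lipschitz_energy.
Context {R : realType} (n : nat) (s : R) (n0 : (0 < n)%N).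
Context (s0 : (0 : R) < s) (s1 : s < (1 : R)).
Context (p r : R) (Psi psi : R -> R) (Y : young p r Psi psi).
Local Notation V := 'rV[R]_n.
Local Notation Leb := (@lebesgue_rV R n).
Let b : R := Num.min s (1 - s).

Let b0 : 0 < b. Proof. by rewrite lt_min s0 subr_gt0. Qed.

(** Near the diagonal |D^s f| is at most L |x - y|^(1 - s), away from it at
    most 2 B |x - y|^(-s). In both cases the power is at most 1 and
    convexity takes it out of Psi. *)
Lemma Psi_Ds_le_frac_kernel (f : V -> R) (B L : R) (z : V * V) : 0 <= B ->
  (forall x, `|f x| <= B) ->
  (forall x y, `|f x - f y| <= L * enorm (x - y)) ->
  Psi (Ds s f z) * mu_density z <= (Psi L + Psi (2 * B)) * frac_kernel b z.
Proof.
move=> B0 fB fL; case: z => x y; rewrite /frac_kernel /Ds /=.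
set e := enorm (x - y); set m := mu_density _.
have m0 : 0 <= m by exact: mu_density_ge0.
have PL := young_ge0 Y L; have PB := young_ge0 Y (2 * B).
rewrite mulrC [leRHS]mulrCA ler_wpM2l//.
have [e0|e0] := eqVneq e 0.
  have fxy : f x - f y = 0.
    by apply/eqP; rewrite -normr_le0 (le_trans (fL x y))// -/e e0 mulr0.
  by rewrite fxy mul0r (young0 Y) mulr_ge0 ?addr_ge0// le_min !powR_ge0.
have ep : 0 < e by rewrite lt_neqAle eq_sym e0 enorm_ge0.
have Ds_norm : `|(f x - f y) / e `^ s| = `|f x - f y| * e `^ (- s).
  by rewrite normrM powRN [X in _ * X]ger0_norm// invr_ge0 powR_ge0.
have [e1|e1] := lerP e 1.
  have e01 : 0 < e <= 1 by rewrite ep.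
  have h : Psi ((f x - f y) / e `^ s) <= e `^ (1 - s) * Psi L.
    apply: le_trans (_ : Psi (e `^ (1 - s) * L) <= _).
      apply: (young_le Y); rewrite Ds_norm normrM [X in _ <= X * _]ger0_norm ?powR_ge0//.
      rewrite powRD ?(gt_eqF ep) ?implybT// powRr1 ?(ltW ep)//.
      rewrite [leRHS]mulrAC ler_wpM2r ?powR_ge0//.
      by rewrite (le_trans (fL x y))// mulrC ler_wpM2l ?(ltW ep)// ler_norm.
    apply: (young_contract Y); rewrite powR_ge0/=.
    by rewrite -[leRHS](powRr0 e) (ger_powR e01)// subr_ge0 ltW.
  apply: (le_trans h); rewrite mulrC ler_pM ?powR_ge0 ?(young_ge0 Y) ?lerDl//.
  have b1s : b <= 1 - s by rewrite /b ge_min lexx orbT.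
  have bb : - b <= 1 - s.
    by rewrite (le_trans _ b1s)// (@le_trans _ _ 0)// ?oppr_le0 ltW.
  by rewrite le_min !(ger_powR e01).
have e1' := ltW e1.
have h : Psi ((f x - f y) / e `^ s) <= e `^ (- s) * Psi (2 * B).
  apply: le_trans (_ : Psi (e `^ (- s) * (2 * B)) <= _).
    apply: (young_le Y); rewrite Ds_norm normrM [X in _ <= X * _]ger0_norm ?powR_ge0//.
    rewrite mulrC ler_wpM2l ?powR_ge0// (le_trans (ler_normB _ _))//.
    rewrite (le_trans (lerD (fB x) (fB y)))// (le_trans _ (ler_norm _))//.
    by rewrite mulr_natl mulr2n.
  apply: (young_contract Y); rewrite powR_ge0/=.
  by rewrite -[leRHS](powRr0 e) (ler_powR e1')// oppr_le0 ltW.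
apply: (le_trans h); rewrite mulrC ler_pM ?powR_ge0 ?(young_ge0 Y) ?lerDr//.
have bs : b <= s by rewrite /b ge_min lexx.
have bs' : - s <= b.
  by rewrite (@le_trans _ _ 0) ?oppr_le0 ?(ltW s0) ?(ltW b0).
by rewrite le_min !(ler_powR e1')// lerN2.
Qed.

(** The integrand vanishes unless one of the points lies in S, so it suffices
    to integrate the kernel over the product of S and the whole space, in
    both orders. *)
Lemma energy_lipschitz (f : V -> R) (B L : R) (S : set V) : 0 <= B ->
  measurable_fun setT f -> measurable S -> (Leb S < +oo)%E ->
  (forall x, ~ S x -> f x = 0) -> (forall x, `|f x| <= B) ->
  (forall x y, `|f x - f y| <= L * enorm (x - y)) ->
  (energy s Psi f < +oo)%E.
Proof.
move=> B0 mf mS Soo f0 fB fL.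
pose A := Psi L + Psi (2 * B).
have A0 : 0 <= A by rewrite addr_ge0 ?(young_ge0 Y).
have mk := measurable_frac_kernel (n := n) b.
have k0 := frac_kernel_ge0 (n := n) b.
have [C C0 hC] := frac_kernel_integral n b0.
have mkE : measurable_fun setT (fun z : V * V => (frac_kernel b z)%:E) by exact/measurable_EFinP.
pose g (z : V * V) : \bar R := (A%:E * (frac_kernel b z)%:E)%E.
have mg : measurable_fun setT g by apply: measurable_funeM.
have g0 z : (0 <= g z)%E by rewrite /g -EFinM lee_fin mulr_ge0.
have mST : measurable (S `*` [set: V]) by exact: measurableX.
have mTS : measurable ([set: V] `*` S) by exact: measurableX.
have hx x : (\int[Leb]_y g (x, y) <= (A * C)%:E)%E.
  rewrite /g ge0_integralZl_EFin//; last 2 first.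
  - by move=> y _; rewrite lee_fin.
  - apply: (measurableT_comp mkE).
    by apply: measurable_fun_pair => //; exact: measurable_cst.
  by rewrite [leRHS]EFinM lee_wpmul2l.
have bound : (\int[Leb]_(x in S) (A * C)%:E < +oo)%E.
  by rewrite integral_cst// lte_mul_pinfty// lee_fin mulr_ge0.
have half1 : (\int[@lebesgue2 R n]_(z in S `*` setT) g z < +oo)%E.
  rewrite integral_rect//; apply: le_lt_trans bound.
  apply: ge0_le_integral => //.
  - by move=> x _; exact: integral_ge0.
  - apply: measurable_funTS.
    exact: (@measurable_fun_fubini_tonelli_F _ _ _ _ _ Leb g).
have half2 : (\int[@lebesgue2 R n]_(z in setT `*` S) g z < +oo)%E.
  rewrite integral_rect_swap//; apply: le_lt_trans bound.
  apply: ge0_le_integral => //.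
  - by move=> x _; exact: integral_ge0.
  - apply: measurable_funTS.
    exact: (@measurable_fun_fubini_tonelli_G _ _ _ _ _ Leb g).
  - move=> y _; apply: le_trans (hx y).
    rewrite le_eqVlt; apply/orP; left; apply/eqP; apply: eq_integral => x _.
    by rewrite /g frac_kernelC.
apply: (@le_lt_trans _ _ (\int[@lebesgue2 R n]_(z in (S `*` setT)) g z +
    \int[@lebesgue2 R n]_(z in (setT `*` S)) g z)%E); last by rewrite lte_add_pinfty.
rewrite [X in (_ <= X + _)%E]integral_mkcond [X in (_ <= _ + X)%E]integral_mkcond.
have r0 T z : (0 <= (g \_ T) z)%E by exact: erestrict_ge0.
have mr T : measurable T -> measurable_fun setT (g \_ T).
  by move=> mT; apply/(measurable_restrictT _ _).1 => //; exact: measurable_funTS.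
rewrite -ge0_integralD//; try exact: mr.
apply: ge0_le_integral => //.
- by move=> z _; exact: (energy_integrand_ge0 s Y).
- exact: measurable_energy Y _ _.
- by apply: emeasurable_funD; exact: mr.
move=> z _; have zg : ((Psi (Ds s f z) * mu_density z)%:E <= g z)%E.
  by rewrite /g -EFinM lee_fin; exact: Psi_Ds_le_frac_kernel fB fL.
have [z1|z1] := pselect (S z.1).
  rewrite [X in (X + _)%E]patchE mem_set//.
  by rewrite (le_trans zg)// leeDl.
have [z2|z2] := pselect (S z.2).
  rewrite [X in (_ + X)%E]patchE mem_set//.
  by rewrite (le_trans zg)// leeDr.
by rewrite /Ds !f0// subrr mul0r (young0 Y) mul0r adde_ge0.
Qed.

End lipschitz_energy.

(** * Test functions *)

Section derivatives.
Context {R : realType}.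

(** Reduces directional derivatives to derivatives of functions of one
    variable, where the chain rule and the mean value theorem apply. *)
Lemma is_derive_line (V : normedModType R) (f : V -> R) (x v : V) (d : R) :
  is_derive x v f d <-> is_derive (0 : R) (1 : R) (fun h : R => f (h *: v + x)) d.
Proof.
have E : (fun h : R => h^-1 *: ((f \o shift x) (h *: v) - f x)) =
         (fun h : R => h^-1 *: (((fun h : R => f (h *: v + x)) \o shift 0) (h *: 1) - f (0 *: v + x))).
  by apply/funext => h /=; rewrite addr0 scale0r add0r [_%:A]mulr1.
split=> -[dv de]; split.
- by move: dv; rewrite /derivable E.
- by rewrite -de /derive E.
- by move: dv; rewrite /derivable -E.
- by rewrite -de /derive -E.
Qed.

Lemma is_derive_chain (V : normedModType R) (g : R -> R) (h : V -> R)
    (x v : V) (dg dh : R) :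
  is_derive (h x) (1 : R) g dg -> is_derive x v h dh ->
  is_derive x v (g \o h) (dg * dh).
Proof.
move=> Hg /is_derive_line Hh; apply/is_derive_line.
have Hg' : is_derive ((fun t : R => h (t *: v + x)) 0) (1 : R) g dg.
  by rewrite scale0r add0r.
exact: (@is_derive1_comp _ g (fun t : R => h (t *: v + x)) 0 dg dh).
Qed.

Lemma is_derive_along (V : normedModType R) (f : V -> R) (x v : V) (t d : R) :
  is_derive (t *: v + x) v f d -> is_derive t (1 : R) (fun h : R => f (h *: v + x)) d.
Proof.
move=> /is_derive_line H; apply/is_derive_line.
rewrite (_ : (fun h : R => _) = (fun h : R => f (h *: v + (t *: v + x))))//.
by apply/funext => h; rewrite [_%:A]mulr1 scalerDl addrA.
Qed.

Lemma derive_bound_line (V : normedModType R) (f : V -> R) (x v : V) (B : R) :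
  (forall y, derivable f y v) -> (forall y, `|'D_v f y| <= B) ->
  forall t, `|f (t *: v + x) - f x| <= B * `|t|.
Proof.
move=> df dB.
have dF t : is_derive t (1 : R) (fun h : R => f (h *: v + x)) ('D_v f (t *: v + x)).
  by apply: is_derive_along; exact/derivableP.
have aux t1 t2 : t1 <= t2 ->
    `|f (t2 *: v + x) - f (t1 *: v + x)| <= B * `|t2 - t1|.
  move=> t12.
  have [|c _ ->] := @MVT_segment _ (fun h : R => f (h *: v + x))
      (fun t => 'D_v f (t *: v + x)) t1 t2 t12 (fun t _ => dF t).
    by apply: derivable_within_continuous => t _; have [] := dF t.
  by rewrite normrM ler_wpM2r.
move=> t; rewrite (_ : f x = f (0 *: v + x)); last by rewrite scale0r add0r.
have [t0|t0] := leP 0 t; first by have := aux _ _ t0; rewrite subr0.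
by have := aux _ _ (ltW t0); rewrite distrC sub0r normrN.
Qed.

End derivatives.

Section test_functions.
Context {R : realType} (n : nat).
Local Notation V := 'rV[R]_n.
Context (Omega : set V).

Lemma Ck_continuous k (f : V -> R) : Ck k f -> continuous f.
Proof. by case: k => [|k] []. Qed.

Lemma continuous_lin (f g : V -> R) (a b : R) : continuous f -> continuous g ->
  continuous (fun x => a * f x + b * g x).
Proof.
move=> cf cg.
have h (c : R) (u : V -> R) : continuous u -> continuous (fun x => c * u x).
  by move=> cu x; exact: (cvgM (cvg_cst c) (cu x)).
by move=> x; exact: (cvgD (h a f cf x) (h b g cg x)).
Qed.

Lemma Ck_lin k (f g : V -> R) (a b : R) : Ck k f -> Ck k g ->
  Ck k (fun x => a * f x + b * g x).
Proof.
elim: k f g => [|k IH] f g /=.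
  by move=> [cf _] [cg _]; split => //; exact: continuous_lin.
move=> [cf hf] [cg hg]; split; first exact: continuous_lin.
move=> i; have [df Cf] := hf i; have [dg Cg] := hg i.
have E : (fun x => a * f x + b * g x) = (a \*: f) \+ (b \*: g) by [].
split.
  move=> x; rewrite E; apply: (@derivableD _ _ _ (a \*: f) (b \*: g)).
    exact: (@derivableZ _ _ _ f a x _ (df x)).
  exact: (@derivableZ _ _ _ g b x _ (dg x)).
rewrite (_ : (fun x => _) = (fun x => a * 'D_(delta_mx 0 i) f x + b * 'D_(delta_mx 0 i) g x)).
  exact: IH.
apply/funext => x; rewrite E.
rewrite (@deriveD _ _ _ (a \*: f) (b \*: g) x _ (@derivableZ _ _ _ f a x _ (df x)) (@derivableZ _ _ _ g b x _ (dg x))).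
by rewrite (@deriveZ _ _ _ f a x _ (df x)) (@deriveZ _ _ _ g b x _ (dg x)).
Qed.

Lemma test_function_lin (f g : V -> R) (a b : R) :
  test_function Omega f -> test_function Omega g ->
  test_function Omega (fun x => a * f x + b * g x).
Proof.
move=> [Cf Kf Of] [Cg Kg Og].
have sub : closure [set x | a * f x + b * g x != 0] `<=`
    closure [set x | f x != 0] `|` closure [set x | g x != 0].
  rewrite -closureU; apply: closureS => x /= h.
  have [fx|fx] := eqVneq (f x) 0; [right|by left].
  by apply: contra h => /eqP ->; rewrite fx !mulr0 addr0.
split.
- by move=> k; exact: Ck_lin.
- apply: subclosed_compact (sub); first exact: closed_closure.
  exact: compactU.
- by move=> x /sub[/Of|/Og].
Qed.

Lemma test_function0 : test_function Omega (fun=> 0 : R).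
Proof.
have e : [set x : V | (0 : R) != 0] = set0 by apply/seteqP; split=> x //=; rewrite eqxx.
split; rewrite ?e ?closure0//; last exact: compact0.
have C0 k : Ck k ((fun=> 0) : V -> R).
  have c0 : continuous ((fun=> 0) : V -> R) by move=> x; exact: cst_continuous.
  elim: k => [|k IH]; split => // i; split; first by move=> x; have [d0 _] := @is_derive_cst R V R 0 x (delta_mx 0 i); exact: d0.
  rewrite (_ : (fun x => 'D_(delta_mx 0 i) (fun=> 0 : R) x) = (fun=> 0))//.
  by apply/funext => x; have [_ d0] := @is_derive_cst R V R 0 x (delta_mx 0 i); exact: d0.
exact: C0.
Qed.

Lemma compact_support_bounded (K : set V) (g : V -> R) : compact K ->
  continuous g -> (forall x, ~ K x -> g x = 0) ->
  exists2 B : R, 0 <= B & forall x, `|g x| <= B.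
Proof.
move=> cK cg g0.
have : bounded_set (g @` K).
  apply: compact_bounded; apply: continuous_compact => //.
  exact: continuous_subspaceT.
move=> [M [_ hM]]; exists (`|M| + 1); first by rewrite addr_ge0.
move=> x; have [Kx|Kx] := pselect (K x).
  apply: hM; last by exists x.
  by rewrite (le_lt_trans (ler_norm M))// ltrDl.
by rewrite g0// normr0 addr_ge0.
Qed.

Lemma derive_off_support (f : V -> R) (v x : V) :
  ~ closure [set x | f x != 0] x -> 'D_v f x = 0.
Proof.
move=> nx; have [_ <-] := @is_derive_cst R V R 0 x v; apply: near_eq_derive.
have : open (~` closure [set x | f x != 0]).
  exact/closed_openC/closed_closure.
move=> /(_ x nx); apply: filterS => y ny /=.
by apply/eqP; apply: contra_notT ny => fy; apply: subset_closure.
Qed.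

Lemma off_support (f : V -> R) x : ~ closure [set x | f x != 0] x -> f x = 0.
Proof.
move=> nx; apply/eqP; apply: contra_notT nx => fy; exact: subset_closure.
Qed.

Lemma test_function_off_Omega (f : V -> R) : test_function Omega f ->
  forall x, ~ Omega x -> f x = 0.
Proof.
move=> [_ _ OO] x Ox; apply: off_support; by move=> /OO.
Qed.

Lemma test_function_bounded (f : V -> R) : test_function Omega f ->
  exists2 B : R, 0 <= B & forall x, `|f x| <= B.
Proof.
move=> tf; have [Cf Kf Of] := tf.
apply: (compact_support_bounded Kf); first exact: Ck_continuous (Cf 0%N).
exact: off_support.
Qed.

(** The partial derivatives are bounded, being continuous with compact support.
    Pass from y to x by changing one coordinate at a time. *)
Lemma test_function_lipschitz (f : V -> R) : test_function Omega f ->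
  exists L : R, forall x y, `|f x - f y| <= L * enorm (x - y).
Proof.
move=> tf; have [Cf Kf Of] := tf; have [_ C1] := Cf 1%N.
have /choice[B hB] : forall i, exists B : R, forall x, `|'D_(delta_mx 0 i) f x| <= B.
  move=> i; have [_ [cD _]] := C1 i.
  have [B _ hB] := compact_support_bounded Kf cD (fun x => @derive_off_support f _ x).
  by exists B.
pose L := \sum_i `|B i|.
exists (n%:R * L) => x y.
pose z k : V := \row_j (if (j < k)%N then x 0 j else y 0 j).
have step k : (k < n)%N -> `|f (z k.+1) - f (z k)| <= L * enorm (x - y).
  move=> kn; pose i := Ordinal kn.
  have -> : z k.+1 = (x 0 i - y 0 i) *: delta_mx 0 i + z k.
    apply/rowP => j; rewrite !mxE eqxx/= ltnS leq_eqVlt.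
    have -> : (j == i) = (nat_of_ord j == k :> nat) by [].
    case: eqP => [jk|jk] /=.
      have -> : j = i by apply/val_inj.
      by rewrite ltnn mulr1 subrK.
    by rewrite mulr0 add0r.
  apply: le_trans (derive_bound_line (z k) (proj1 (C1 i)) (hB i) _) _.
  have h1 : `|x 0 i - y 0 i| <= enorm (x - y).
    by have := coord_le_enorm (x - y) i; rewrite !mxE.
  have h2 : B i <= L.
    rewrite (le_trans (ler_norm _))// /L (bigD1 i)//= lerDl sumr_ge0//.
  apply: (@le_trans _ _ (L * `|x 0 i - y 0 i|)); first by rewrite ler_wpM2r.
  by rewrite ler_wpM2l// sumr_ge0.
have tele k : (k <= n)%N -> `|f (z k) - f y| <= k%:R * (L * enorm (x - y)).
  elim: k => [_|k IH kn].
    rewrite mul0r (_ : z 0%N = y) ?subrr ?normr0//.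
    by apply/rowP => j; rewrite mxE.
  rewrite -(subrKA (f (z k))) (le_trans (ler_normD _ _))//.
  by rewrite -natr1 mulrDl mul1r addrC lerD ?step ?IH// ltnW.
have := tele n (leqnn n); rewrite mulrA (_ : z n = x)//.
by apply/rowP => j; rewrite mxE ltn_ord.
Qed.

End test_functions.

(** * A flat exponential *)

Section exp_bump.
Context {R : realType}.

(** The flat function t^(-m) exp(-1 / t). The parameter m makes the family
    stable under differentiation, up to linear combinations. *)
Definition exp_bump (m : nat) (t : R) : R :=
  if t <= 0 then 0 else t^-1 ^+ m * expR (- t^-1).

Lemma exp_bump_le0 m t : t <= 0 -> exp_bump m t = 0. Proof. by rewrite /exp_bump => ->. Qed.

Lemma exp_bump_gt0 m t : 0 < t -> 0 < exp_bump m t.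
Proof.
by move=> t0; rewrite /exp_bump [t <= 0]leNgt t0 /= mulr_gt0 ?expR_gt0// exprn_gt0// invr_gt0.
Qed.

(** Keep the term of order m + 2 in the series of exp(1 / t). The square on the
    right makes the derivative at 0 vanish. *)
Lemma exp_bump_le_sqr m t : 0 < t -> exp_bump m t <= (m.+2)`!%:R * t ^+ 2.
Proof.
move=> t0; rewrite /exp_bump [t <= 0]leNgt t0 /=.
have ti0 : 0 <= t^-1 by rewrite invr_ge0 ltW.
have h := expR_ge1Dxn m.+1 ti0.
have F0 : (0 : R) < (m.+2)`!%:R by rewrite ltr0n fact_gt0.
have h1 : t^-1 ^+ m.+2 / (m.+2)`!%:R <= expR t^-1 by apply: le_trans h; rewrite lerDr.
rewrite expRN ler_pdivrMr ?expR_gt0//.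
have -> : t^-1 ^+ m = t ^+ 2 * t^-1 ^+ m.+2.
  rewrite !exprVn [t ^+ m.+2]exprS [t ^+ m.+1]exprS; field.
  by rewrite expf_neq0 ?gt_eqF.
rewrite [leRHS](_ : _ = t ^+ 2 * ((m.+2)`!%:R * expR t^-1)); last by ring.
rewrite ler_wpM2l ?sqr_ge0//.
by rewrite mulrC -ler_pdivrMr.
Qed.

Lemma is_derive_exp_bump m (t : R) :
  is_derive t (1 : R) (exp_bump m) (exp_bump m.+2 t - m%:R * exp_bump m.+1 t).
Proof.
have [t0|t0|t0] := ltgtP t 0.
- rewrite !exp_bump_le0 ?(ltW t0)// mulr0 subr0.
  apply: near_eq_is_derive (is_derive_cst (0 : R) t 1).
  near=> u; rewrite exp_bump_le0// ltW//; near: u; exact: lt_nbhsl.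
- have ti : is_derive t (1 : R) (fun u : R => u^-1) (- t ^- 2).
    have t0' : (id t : R) != 0 by rewrite gt_eqF.
    have did : derivable (id : R -> R) t 1 by [].
    split; first exact: (@derivableV _ _ (id : R -> R) t 1 t0' did).
    rewrite (@deriveV _ _ (id : R -> R) t 1 t0' did) derive_id.
    by rewrite /GRing.scale/= mulr1.
  pose f (u : R) := u^-1 ^+ m * expR (- u^-1).
  have H : is_derive t (1 : R) f (exp_bump m.+2 t - m%:R * exp_bump m.+1 t).
    have d1 := @is_deriveX _ _ _ m t 1 _ ti.
    have d2 := @is_derive1_comp _ expR (fun u : R => - u^-1) t _ _
      (is_derive_expR _) (is_deriveN ti).
    have d3 := is_deriveM d1 d2.
    have -> : f = ((fun u : R => u^-1) ^+ m * (expR \o (fun u : R => - u^-1)))%R.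
      by apply/funext => u; rewrite /f exprfctE.
    apply: (is_derive_eq d3).
    rewrite /exp_bump [t <= 0]leNgt t0 /= /GRing.scale/= opprK.
    have -> : (t ^- 2 : R) = t^-1 ^+ 2 by rewrite exprVn.
    rewrite exprfctE /=; set u := t^-1; set E := expR (- u).
    clear; case: m => [|k]; first by rewrite !expr0 !mul0r !mulr0; ring.
    rewrite /= -!natr1 !exprS; ring.
  apply: near_eq_is_derive H.
  by near=> u; rewrite /exp_bump leNgt ifF// -?ltNge; apply/negbTE; rewrite negbK;
    near: u; exact: lt_nbhsr.
- rewrite t0 !exp_bump_le0// mulr0 subr0.
  suff c : (h^-1 *: ((exp_bump m \o shift 0) (h *: 1) - exp_bump m 0)) @[h --> (0 : R)^'] --> (0 : R).
    by split; [apply/cvg_ex; exists 0|exact: cvg_lim c].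
  apply/cvgrPdist_le => e e0.
  have F0 : (0 : R) < (m.+2)`!%:R by rewrite ltr0n fact_gt0.
  have de : 0 < e / (m.+2)`!%:R by rewrite divr_gt0.
  near=> h.
  rewrite sub0r normrN /= addr0 [_%:A]mulr1 [X in _ - X]exp_bump_le0// subr0.
  have [h0|h0] := leP h 0; first by rewrite exp_bump_le0// scaler0 normr0 ltW.
  rewrite /GRing.scale/= normrM [X in X * _]gtr0_norm ?invr_gt0//.
  rewrite gtr0_norm ?exp_bump_gt0//.
  rewrite mulrC ler_pdivrMr//; apply: (le_trans (exp_bump_le_sqr m h0)).
  rewrite expr2 mulrA ler_wpM2r ?(ltW h0)// mulrC -ler_pdivlMr//.
  rewrite -(gtr0_norm h0); near: h; apply: dnbhs0_le; exact: de.
Unshelve. all: by end_near. Qed.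

End exp_bump.

(** * Existence of a bump *)

Section exp_bump_test_function.
Context {R : realType} (n : nat).
Local Notation V := 'rV[R]_n.

(** Every member has partial derivatives in the class, so all are smooth by
    induction on the order of differentiation. *)
Inductive elementary : (V -> R) -> Prop :=
| elementary_cst a : elementary (fun=> a)
| elementary_coord i : elementary (fun x => x 0 i)
| elementaryD f g : elementary f -> elementary g -> elementary (fun x => f x + g x)
| elementaryM f g : elementary f -> elementary g -> elementary (fun x => f x * g x)
| elementary_exp_bump m f : elementary f -> elementary (fun x => exp_bump m (f x)).

Lemma elementary_derive f : elementary f -> forall i,
  exists2 g, elementary g & forall x, is_derive x (delta_mx 0 i : V) f (g x).
Proof.
elim=> [a|j|f1 g1 ef IHf eg IHg|f1 g1 ef IHf eg IHg|m f1 ef IHf] i.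
- exists (fun=> 0); first exact: elementary_cst.
  by move=> x; exact: is_derive_cst.
- exists (fun=> (j == i)%:R); first exact: elementary_cst.
  move=> x; apply/is_derive_line.
  have -> : (fun h : R => (h *: delta_mx 0 i + x : V) 0 j) =
      ((j == i)%:R \*: (id : R -> R)) \+ cst (x 0 j).
    apply/funext => h; rewrite !mxE eqxx/= /GRing.scale/=.
    by rewrite [X in _ = X + _]mulrC.
  have h1 := @is_derive_id R R 0 1.
  have h2 := is_deriveD (is_deriveZ (j == i)%:R h1) (is_derive_cst (x 0 j) (0 : R) 1).
  apply: (is_derive_eq h2).
  by rewrite addr0 [_%:A]mulr1.
- have [df edf Hf] := IHf i; have [dg edg Hg] := IHg i.
  exists (fun x => df x + dg x); first exact: elementaryD.
  by move=> x; exact: is_deriveD.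
- have [df edf Hf] := IHf i; have [dg edg Hg] := IHg i.
  exists (fun x => f1 x * dg x + g1 x * df x).
    by apply: elementaryD; exact: elementaryM.
  by move=> x; exact: is_deriveM.
- have [df edf Hf] := IHf i.
  exists (fun x => (exp_bump m.+2 (f1 x) + (- m%:R) * exp_bump m.+1 (f1 x)) * df x).
    apply: elementaryM => //; apply: elementaryD; first exact: elementary_exp_bump.
    by apply: elementaryM; [exact: elementary_cst|exact: elementary_exp_bump].
  move=> x; have := is_derive_chain (is_derive_exp_bump m (f1 x)) (Hf x).
  by rewrite mulNr.
Qed.

Lemma continuous_exp_bump m : continuous (@exp_bump R m).
Proof.
move=> t; apply: differentiable_continuous; apply/derivable1_diffP.
by have [] := is_derive_exp_bump m t.
Qed.

Lemma elementary_continuous f : elementary f -> continuous f.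
Proof.
elim=> [a|j|f1 g1 _ cf _ cg|f1 g1 _ cf _ cg|m f1 _ cf] x.
- exact: cst_continuous.
- exact: coord_continuous.
- exact: (cvgD (cf x) (cg x)).
- exact: (cvgM (cf x) (cg x)).
- by apply: (@continuous_comp _ _ _ f1 (@exp_bump R m)); [exact: cf|exact: continuous_exp_bump].
Qed.

Lemma elementary_Ck k f : elementary f -> Ck k f.
Proof.
elim: k f => [|k IH] f ef; split => //; try exact: elementary_continuous.
move=> i; have [g eg Hg] := elementary_derive ef i; split.
  by move=> x; have [] := Hg x.
rewrite (_ : (fun x => 'D_(delta_mx 0 i) f x) = g); first exact: IH.
by apply/funext => x; have [_ ->] := Hg x.
Qed.

Lemma elementary_sum (I : Type) (r : seq I) (F : I -> V -> R) :
  (forall i, elementary (F i)) -> elementary (fun x => \sum_(i <- r) F i x).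
Proof.
move=> eF; elim: r => [|i r IH].
  under eq_fun do rewrite big_nil; exact: elementary_cst.
under eq_fun do rewrite big_cons; exact: elementaryD.
Qed.

(** Compose exp_bump 0 with rho^2 - |x - c|^2: the support lies in a ball
    around c inside Omega, and the function is positive on a small cube
    with corner c. *)
Lemma exists_test_function (Omega : set V) : Omega !=set0 -> open Omega ->
  exists f : V -> R, [/\ test_function Omega f, (forall x, 0 <= f x) &
    exists (c : V) (h : R), 0 < h /\ (box c h `<=` Omega) /\
      forall x, box c h x -> 0 < f x].
Proof.
move=> [c Oc] oO.
have /nbhs_ballP[e /= e0 ceO] := oO _ Oc.
pose rho := e / 2; have rho0 : 0 < rho by rewrite divr_gt0.
pose g (x : V) := \sum_i (x 0 i - c 0 i) ^+ 2.
have eg : elementary g.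
  apply: elementary_sum => i; under eq_fun do rewrite expr2.
  by apply: elementaryM; apply: (elementaryD (elementary_coord i) (elementary_cst (- c 0 i))).
pose f (x : V) := exp_bump 0 (rho ^+ 2 + (- 1) * g x).
have ef : elementary f.
  apply: elementary_exp_bump; apply: elementaryD; first exact: elementary_cst.
  by apply: elementaryM => //; exact: elementary_cst.
have f0 x : 0 <= f x.
  rewrite /f; have [h|h] := leP (rho ^+ 2 + (- 1) * g x) 0; first by rewrite exp_bump_le0.
  by rewrite ltW// exp_bump_gt0.
have gle (x : V) i : `|x 0 i - c 0 i| ^+ 2 <= g x.
  rewrite real_normK ?num_real// /g (bigD1 i)//= lerDl.
  by apply: sumr_ge0 => j _; exact: sqr_ge0.
pose D := [set x : V | g x <= rho ^+ 2].
have cD : closed D.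
  rewrite (_ : D = g @^-1` [set t | t <= rho ^+ 2])//.
  apply: preimage_closed; last exact: closed_le.
  by move=> x _; exact: elementary_continuous.
have suppD : closure [set x | f x != 0] `<=` D.
  rewrite (closure_id D).1//; apply: closureS => x /= fx.
  rewrite /D /= leNgt; apply: contra fx => h; rewrite /f exp_bump_le0//.
  by rewrite mulN1r subr_le0 ltW.
have Dcoord (x : V) i : D x -> `|x 0 i - c 0 i| <= rho.
  move=> Dx; rewrite -(@ler_pXn2r _ 2) ?nnegrE ?(ltW rho0)//.
  exact: le_trans (gle x i) Dx.
have DO : D `<=` Omega.
  move=> x Dx; apply: ceO; split => // i j; rewrite ord1 /ball/= distrC.
  apply: (le_lt_trans (Dcoord x j Dx)).
  by rewrite /rho ltr_pdivrMr// ltr_pMr// ltr1n.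
have bD : bounded_set D.
  exists (`|c| + rho); split; first exact: num_real.
  move=> M hM x Dx /=; apply: le_trans (ltW hM).
  rewrite -[x](subrK c) (le_trans (ler_normD _ _))// addrC lerD2l.
  rewrite [leLHS]/Num.norm /= mx_normrE; apply/bigmax_leP; split; first exact: ltW.
  by move=> [i j] _ /=; rewrite ord1 !mxE; exact: Dcoord.
exists f; split => //.
  split.
  - by move=> k; exact: elementary_Ck.
  - apply: subclosed_compact suppD; first exact: closed_closure.
    exact: bounded_closed_compact.
  - by apply: subset_trans DO.
pose h := rho / (n.+1)%:R.
have n1 : (0 : R) < n.+1%:R by rewrite ltr0n.
have h0 : 0 < h by rewrite divr_gt0.
have hb x : box c h x -> g x < rho ^+ 2.
  move=> bx; apply: (@le_lt_trans _ _ (n%:R * h ^+ 2)).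
    rewrite /g (@le_trans _ _ (\sum_(i < n) h ^+ 2))//; last first.
      by rewrite sumr_const card_ord mulr_natl.
    apply: ler_sum => i _; have /andP[b1 b2] := bx i.
    rewrite lerXn2r ?nnegrE ?subr_ge0 ?(ltW h0)//.
    by rewrite lerBlDl ltW.
  have -> : rho = n.+1%:R * h by rewrite /h mulrC divfK// gt_eqF.
  rewrite [X in _ < X]exprMn ltr_pM2r ?exprn_gt0// -natrX ltr_nat.
  by rewrite expnS expn1; exact: leq_pmulr.
exists c, h; split => //; split.
  by move=> x /hb /ltW; exact: DO.
by move=> x /hb gx; rewrite /f exp_bump_gt0// mulN1r subr_gt0.
Qed.

End exp_bump_test_function.

(** * Minimisation of a convex functional under a compact perturbation *)

Section ultrafilter_cauchy.
Context {R : realType}.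

(** By compactness of a segment, a bounded real sequence converges along an
    ultrafilter. *)
Lemma ultra_bounded_cauchy (U : set_system nat) (x : nat -> R) (B : R) :
  UltraFilter U -> (forall k, `|x k| <= B) -> forall e, 0 < e ->
  exists2 A, U A & forall j k, A j -> A k -> `|x j - x k| <= e.
Proof.
move=> UU xB e e0.
have PU : ProperFilter U by exact: ultra_proper.
have cB : compact (`[(- B), B] : set R) by exact: segment_compact.
have [|l [_ cl]] := cB (x @ U) (fmap_proper_filter x PU).
  rewrite /fmap/= (_ : _ @^-1` _ = setT); first exact: filterT.
  by apply/seteqP; split => // k _ /=; rewrite in_itv/= -ler_norml; exact: xB.
pose A := [set k | `|x k - l| <= e / 2].
exists A; last first.
  move=> j k; rewrite /A /= => Aj Ak.
  rewrite -(subrKA l) (le_trans (ler_normD _ _))// [X in _ + X]distrC.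
  by rewrite (splitr e) lerD.
have [//|UA] := in_ultra_setVsetC A UU.
have e20 : 0 < e / 2 by rewrite divr_gt0.
have [y [ny by_]] := cl (~` [set t | `|t - l| <= e / 2]) (ball l (e / 2)) UA (nbhsx_ballx l _ e20).
by exfalso; apply: ny => /=; rewrite distrC ltW.
Qed.

End ultrafilter_cauchy.

(** Here E stands for the energy, G for the power term, L for the L1 norm over
    Omega, F for the functions of finite energy and T for the test
    functions. The two assumptions that replace weak compactness are
    E_parallelogram and L_compact. *)
Section abstract_minimization.
Context {R : realType} (D : Type).
Implicit Types u v w z : D -> R.
Context (F T : set (D -> R)) (E G L : (D -> R) -> R) (lam K : R) (kap : R -> R).
Context (lam0 : (0 : R) < lam).
Context (TF : T `<=` F).
Context (T_comb : forall u v (a b : R), T u -> T v -> T (fun x => a * u x + b * v x)).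
Context (F_comb : forall u v (a b : R), F u -> F v -> F (fun x => a * u x + b * v x)).
Context (Tn0 : T !=set0).
Context (E0 : forall u, 0 <= E u).
Context (L0 : forall u, 0 <= L u).
Context (LN : forall u, L (fun x => - u x) = L u).
Context (E_perturb : forall e : R, 0 < e -> exists2 C : R, 0 <= C &
  forall u v, F u -> F v -> E u <= (1 + e) * E v + C * E (fun x => u x - v x)).
Context (E_double : forall u v, F u -> F v ->
  E (fun x => u x + v x) <= K * E u + K * E v).
Context (E_scale : forall c u, F u -> E (fun x => c * u x) <= kap c * E u).
Context (E_parallelogram : forall u v, F u -> F v ->
  E (fun x => 2^-1 * u x + 2^-1 * v x) + E (fun x => 2^-1 * u x + (- 2^-1) * v x) <=
  (E u + E v) / 2).
Context (L_le_E : forall e : R, 0 < e -> exists2 C : R, 0 <= C &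
  forall w, F w -> L w <= e + C * E w).
Context (L_compact : forall e : R, 0 < e -> exists (I : finType) (l : I -> (D -> R) -> R),
  [/\ forall i u v (a b : R), F u -> F v ->
        l i (fun x => a * u x + b * v x) = a * l i u + b * l i v,
      forall i u, F u -> `|l i u| <= L u &
      forall w, F w -> L w <= e * (1 + E w) + \sum_i `|l i w|]).
Context (G_le : forall e : R, 0 < e -> exists2 C : R, 0 <= C &
  forall u, F u -> G u <= C + e * E u).
Context (G_diff : forall e : R, 0 < e -> exists2 C : R, 0 <= C &
  forall u v, F u -> F v ->
  G u <= G v + e * E u + C * L (fun x => u x - v x)).

Definition action u := E u - lam * G u.

(** Half of the energy absorbs lam * G, by G_le with the factor 1 / (2 lam). *)
Lemma action_coercive : exists2 C : R, 0 <= C &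
  forall u, F u -> E u <= 2 * action u + C.
Proof.
have e0 : 0 < (2 * lam)^-1 by rewrite invr_gt0 mulr_gt0.
have [C C0 hC] := G_le e0; exists (2 * (lam * C)).
  by rewrite !mulr_ge0// ltW.
move=> u Fu; have h : lam * G u <= lam * (C + (2 * lam)^-1 * E u).
  by rewrite ler_pM2l// hC.
have e1 : lam * (C + (2 * lam)^-1 * E u) = lam * C + E u / 2.
  by field; rewrite gt_eqF.
rewrite e1 in h; rewrite /action; lra.
Qed.

Let actions := action @` T.

Lemma has_inf_actions : has_inf actions.
Proof.
split; first by have [w Tw] := Tn0; exists (action w); exists w.
have [C C0 hC] := action_coercive.
exists (- (C / 2)) => _ [u Tu <-]; have := hC u (TF Tu); have := E0 u; lra.
Qed.

Definition min_action : R := inf actions.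

Lemma min_action_le u : T u -> min_action <= action u.
Proof.
by move=> Tu; apply: ge_inf; [exact: (proj2 has_inf_actions)|exists u].
Qed.

Lemma minimizing_exists (e : R) : 0 < e ->
  exists2 u, T u & action u < min_action + e.
Proof.
move=> e0; have [_ [u Tu <-] h] := inf_adherent e0 has_inf_actions.
by exists u.
Qed.

Lemma L_midpoint u v : L (fun x => v x - (2^-1 * u x + 2^-1 * v x)) =
  L (fun x => 2^-1 * u x + (- 2^-1) * v x).
Proof. by rewrite -LN; congr L; apply/funext => x; field. Qed.

Lemma L_midpointl u v : L (fun x => u x - (2^-1 * u x + 2^-1 * v x)) =
  L (fun x => 2^-1 * u x + (- 2^-1) * v x).
Proof. by congr L; apply/funext => x; field. Qed.

(** The action of the midpoint is not below the infimum, and G at the midpoint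
    is nearly the mean of G u and G v because u and v are close for L. So
    the parallelogram inequality leaves little room for the energy of the
    half difference. *)
Lemma minimizing_close (B e : R) : 0 < e -> exists2 d : R, 0 < d &
  forall u v, T u -> T v -> E u <= B -> E v <= B ->
    action u <= min_action + d -> action v <= min_action + d ->
    L (fun x => 2^-1 * u x + (- 2^-1) * v x) <= d ->
    E (fun x => 2^-1 * u x + (- 2^-1) * v x) <= e.
Proof.
move=> e0; pose B' := `|B| + 1.
have B'0 : 0 < B' by rewrite ltr_wpDl.
have th0 : 0 < e / (3 * lam * B') by rewrite divr_gt0// !mulr_gt0.
have [C C0 hC] := G_diff th0.
(* a third of e each for the excess of the action, the energy term and the L
   term of G_diff *)
pose d := Num.min (e / 3) (e / (3 * lam * (C + 1))).
have C1 : 0 < C + 1 by rewrite ltr_wpDl.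
have d0 : 0 < d by rewrite lt_min !divr_gt0// !mulr_gt0.
exists d => // u v Tu Tv uB vB Iu Iv Lw.
set w := (fun x => 2^-1 * u x + (- 2^-1) * v x) in Lw *.
set mid := (fun x => 2^-1 * u x + 2^-1 * v x).
have Tmid : T mid by exact: T_comb.
have Fu := TF Tu; have Fv := TF Tv; have Fm := TF Tmid.
have par := E_parallelogram Fu Fv; rewrite -/w -/mid in par.
have hm := min_action_le Tmid.
have g1 := hC _ _ Fu Fm; have g2 := hC _ _ Fv Fm.
rewrite L_midpointl -/w in g1; rewrite L_midpoint -/w in g2.
have bB : B <= B' by rewrite (le_trans (ler_norm B))// lerDl.
set th := e / (3 * lam * B') in th0 hC g1 g2.
have k1 u' : E u' <= B -> th * E u' <= e / (3 * lam).
  move=> u'B; have -> : e / (3 * lam) = th * B'.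
    by rewrite /th; field; rewrite !gt_eqF.
  by rewrite ler_pM2l// (le_trans u'B).
have k2 : C * L w <= e / (3 * lam).
  have dle : d <= e / (3 * lam * (C + 1)) by rewrite ge_min lexx orbT.
  apply: (@le_trans _ _ ((C + 1) * (e / (3 * lam * (C + 1))))).
    by apply: ler_pM => //; [rewrite lerDl|exact: le_trans dle].
  by rewrite le_eqVlt; apply/orP; left; apply/eqP; field; rewrite !gt_eqF.
have d3 : d <= e / 3 by rewrite ge_min lexx.
have g1' : G u <= G mid + 2 * (e / (3 * lam)) by have := k1 u uB; lra.
have g2' : G v <= G mid + 2 * (e / (3 * lam)) by have := k1 v vB; lra.
have l1 : lam * G u <= lam * G mid + 2 * (e / 3).
  have -> : 2 * (e / 3) = lam * (2 * (e / (3 * lam))) by field; rewrite gt_eqF.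
  by rewrite -mulrDr ler_pM2l.
have l2 : lam * G v <= lam * G mid + 2 * (e / 3).
  have -> : 2 * (e / 3) = lam * (2 * (e / (3 * lam))) by field; rewrite gt_eqF.
  by rewrite -mulrDr ler_pM2l.
rewrite /action in Iu Iv hm; lra.
Qed.

(** Along an ultrafilter finer than the tails, the finitely many linear
    functionals of L_compact are Cauchy at every precision; hence so is the
    sequence for L and, by minimizing_close, for the energy. A diagonal
    choice of indices gives the prescribed rate. *)
Lemma minimizing_cauchy (d : nat -> R) : (forall k, 0 < d k) ->
  exists v : nat -> D -> R, [/\ forall k, T (v k),
    forall k, action (v k) <= min_action + d k &
    forall j k, (j <= k)%N -> E (fun x => v j x - v k x) <= d j].
Proof.
move=> d0.
have /choice[u hu] : forall k : nat, exists u, T u /\ action u < min_action + k.+1%:R^-1.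
  move=> k; have [|u Tu h] := @minimizing_exists k.+1%:R^-1; first by rewrite invr_gt0.
  by exists u.
have Tu k : T (u k) by have [] := hu k.
have Fu k : F (u k) by exact: TF.
have Iu k : action (u k) <= min_action + k.+1%:R^-1 by have [_ /ltW] := hu k.
have [C C0 hC] := action_coercive.
pose B := 2 * (min_action + 1) + C.
have uB k : E (u k) <= B.
  apply: (le_trans (hC _ (Fu k))); rewrite lerD2r ler_pM2l//.
  by rewrite (le_trans (Iu k))// lerD2l invf_le1// ler1n.
have B0 : 0 <= B by exact: le_trans (E0 _) (uB 0%N).
have [U [UU nU]] := ultraFilterLemma (eventually_filter).
have PU : ProperFilter U by exact: ultra_proper.
pose w j k := fun x => 2^-1 * u j x + (- 2^-1) * u k x.
have Fw j k : F (w j k) by exact: F_comb.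
have wB j k : E (w j k) <= B.
  have := E_parallelogram (Fu j) (Fu k); rewrite -/(w j k).
  have := uB j; have := uB k; have := E0 (fun x => 2^-1 * u j x + 2^-1 * u k x); lra.
have [CL CL0 hCL] := L_le_E ltr01.
have uL k : L (u k) <= 1 + CL * B.
  by apply: (le_trans (hCL _ (Fu k))); rewrite lerD2l ler_wpM2l.
(* the ultrafilter saves extracting a further subsequence for every e *)
have Lsmall e : 0 < e -> exists2 A, U A & forall j k, A j -> A k -> L (w j k) <= e.
  move=> e0.
  have e20 : 0 < e / 2 / (1 + B) by rewrite !divr_gt0// ltr_pwDl.
  have [I [l [l_lin l_bd l_cp]]] := L_compact e20.
  pose th := e / 2 / (#|I|%:R + 1).
  have n0 : (0 : R) < #|I|%:R + 1 by rewrite ltr_wpDl.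
  have th0 : 0 < th by rewrite !divr_gt0.
  have /choice[A hA] : forall i : I, exists A, U A /\
      forall j k, A j -> A k -> `|l i (u j) - l i (u k)| <= th.
    move=> i; have [|A UA hA] := ultra_bounded_cauchy UU _ th0 (x := fun k => l i (u k)) (B := 1 + CL * B).
      by move=> k; exact: le_trans (l_bd i _ (Fu k)) (uL k).
    by exists A.
  exists [set k | forall i, A i k].
    by apply: filter_forall => i; have [] := hA i.
  move=> j k Aj Ak; apply: (le_trans (l_cp _ (Fw j k))).
  rewrite [leRHS](splitr e) lerD//.
    have B1 : 0 < 1 + B by rewrite ltr_pwDl.
    apply: (@le_trans _ _ (e / 2 / (1 + B) * (1 + B))).
      by rewrite ler_pM2l// lerD2l.
    by rewrite divfK// gt_eqF.
  apply: (@le_trans _ _ (\sum_(i in I) th)).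
    apply: ler_sum => i _; rewrite l_lin// mulNr -mulrBr normrM.
    rewrite gtr0_norm// (le_trans _ (proj2 (hA i) j k (Aj i) (Ak i)))//.
    by rewrite ler_piMl// invf_le1// ler1n.
  rewrite sumr_const -[th *+ _]mulr_natl.
  apply: (@le_trans _ _ ((#|I|%:R + 1) * th)).
    by rewrite ler_pM2r// lerDl.
  by rewrite /th mulrC divfK// gt_eqF.
have Esmall e : 0 < e -> exists2 A, U A & forall j k, A j -> A k -> E (w j k) <= e.
  move=> e0; have [th th0 hth] := minimizing_close B e0.
  have [A UA hA] := Lsmall _ th0.
  have UN : U [set k | k.+1%:R^-1 <= th].
    apply: nU; exists (Num.truncn th^-1) => // k /= hk.
    have ti0 : 0 <= th^-1 by rewrite invr_ge0 ltW.
    rewrite invf_ple ?posrE// ltW//; have /andP[_ h] := truncn_itv ti0.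
    by apply: (lt_le_trans h); rewrite ler_nat ltnS.
  exists (A `&` [set k | k.+1%:R^-1 <= th]); first exact: filterI.
  move=> j k [Aj dj] [Ak dk]; apply: hth => //.
  - by rewrite (le_trans (Iu j))// lerD2l.
  - by rewrite (le_trans (Iu k))// lerD2l.
  - exact: hA.
have /choice[A hA] : forall i : nat, exists A, U A /\ forall j k, A j -> A k ->
    E (fun x => u j x - u k x) <= d i.
  move=> i; have k0 : 0 < `|kap 2| + 1 by rewrite ltr_wpDl.
  have [A UA hA] := Esmall _ (divr_gt0 (d0 i) k0); exists A; split=> // j k Aj Ak.
  rewrite (_ : (fun x => u j x - u k x) = (fun x => 2 * w j k x)); last first.
    by apply/funext => x; rewrite /w; field.
  apply: (le_trans (E_scale _ (Fw j k))).
  apply: (@le_trans _ _ ((`|kap 2| + 1) * (d i / (`|kap 2| + 1)))).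
    apply: (@le_trans _ _ ((`|kap 2| + 1) * E (w j k))).
      by rewrite ler_wpM2r// (le_trans (ler_norm _))// lerDl.
    by rewrite ler_pM2l// hA.
  by rewrite mulrC divfK// gt_eqF.
(* an index lying in A j for all j <= i remains within d j of the earlier
   choices *)
have UB i : U ([set k | forall j, (j <= i)%N -> A j k] `&` [set k | k.+1%:R^-1 <= d i]).
  apply: filterI.
    elim: i => [|i IH].
      apply: filterS (proj1 (hA 0%N)) => k Ak j.
      by rewrite leqn0 => /eqP ->.
    apply: filterS (filterI IH (proj1 (hA i.+1))) => k [h1 h2] j.
    by rewrite leq_eqVlt => /predU1P[-> //|]; rewrite ltnS; exact: h1.
  apply: nU; exists (Num.truncn (d i)^-1) => // k /= hk.
  have ti0 : 0 <= (d i)^-1 by rewrite invr_ge0 ltW.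
  rewrite invf_ple ?posrE// ltW//; have /andP[_ h] := truncn_itv ti0.
  by apply: (lt_le_trans h); rewrite ler_nat ltnS.
have /choice[k hk] : forall i, exists k, ([set k | forall j, (j <= i)%N -> A j k] `&` [set k | k.+1%:R^-1 <= d i]) k.
  by move=> i; exact: filter_ex (UB i).
exists (fun i => u (k i)); split => //.
- move=> i; have [_ /= h] := hk i; rewrite (le_trans (Iu _))// lerD2l//.
- move=> i j ij; have [h1 _] := hk i; have [h2 _] := hk j.
  have [_ h] := hA i; apply: h; first exact: h1.
  exact: h2.
Qed.

Context (K0 : 0 <= K).
Context (kap0 : forall c, 0 <= kap c).
Context (EN : forall u, E (fun x => - u x) = E u).

Let F_sub u v : F u -> F v -> F (fun x => u x - v x).
Proof.
move=> Fu Fv; have := F_comb 1 (- 1) Fu Fv.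
by congr F; apply/funext => x; ring.
Qed.

Let E_sym u v : E (fun x => u x - v x) = E (fun x => v x - u x).
Proof. by rewrite -EN; congr E; apply/funext => x; ring. Qed.

Let L_sym u v : L (fun x => u x - v x) = L (fun x => v x - u x).
Proof. by rewrite -LN; congr L; apply/funext => x; ring. Qed.

(** Near z the energy stays bounded, so the perturbation inequality and G_diff,
    with small factors of the energy, control both terms; e is spent in
    eighths. *)
Lemma action_continuous z e : F z -> 0 < e -> exists2 d : R, 0 < d &
  forall w, F w -> E (fun x => z x - w x) <= d -> `|action w - action z| <= e.
Proof.
move=> Fz e0; pose B := K * E z + K; pose S := B + E z + 1.
have B0 : 0 <= B by rewrite addr_ge0// mulr_ge0.
have S0 : 0 < S by rewrite ltr_wpDl// addr_ge0.
have h80 : 0 < e / 8 by rewrite divr_gt0.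
have eta0 : 0 < e / 8 / S by rewrite divr_gt0.
have [C C0 hC] := E_perturb eta0.
have eta'0 : 0 < e / 8 / lam / S by rewrite !divr_gt0.
have [C' C'0 hC'] := G_diff eta'0.
have th0 : 0 < e / 8 / lam / (C' + 1) by rewrite !divr_gt0// ltr_wpDl.
have [C2 C20 hC2] := L_le_E th0.
pose d := Num.min 1 (Num.min (e / 8 / (C + 1)) (e / 8 / lam / (C' + 1) / (C2 + 1))).
have d0 : 0 < d by rewrite !lt_min ltr01 !divr_gt0// ltr_wpDl.
have d1 : d <= 1 by rewrite ge_min lexx.
have dC : C * d <= e / 8.
  apply: (@le_trans _ _ ((C + 1) * (e / 8 / (C + 1)))).
    apply: ler_pM => //; rewrite ?(ltW d0) ?lerDl//.
    by rewrite /d !ge_min lexx orbT.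
  by rewrite mulrC divfK// gt_eqF// ltr_wpDl.
have dC2 : C2 * d <= e / 8 / lam / (C' + 1).
  apply: (@le_trans _ _ ((C2 + 1) * (e / 8 / lam / (C' + 1) / (C2 + 1)))).
    apply: ler_pM => //; rewrite ?(ltW d0) ?lerDl//.
    by rewrite /d !ge_min lexx !orbT.
  by rewrite mulrC divfK// gt_eqF// ltr_wpDl.
have Cth : C' * (e / 8 / lam / (C' + 1)) <= e / 8 / lam.
  apply: (@le_trans _ _ ((C' + 1) * (e / 8 / lam / (C' + 1)))).
    by rewrite ler_pM2r// lerDl.
  by rewrite mulrC divfK// gt_eqF// ltr_wpDl.
exists d => // w Fw Ed.
have Fzw := F_sub Fz Fw; have Fwz := F_sub Fw Fz.
have Ed' : E (fun x => w x - z x) <= d by rewrite E_sym.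
have EwB : E w <= B.
  have -> : w = (fun x => z x + (w x - z x)) by apply/funext => x; ring.
  apply: (le_trans (E_double Fz Fwz)); rewrite /B lerD2l.
  by rewrite ler_piMr// (le_trans Ed').
have EwS : E w <= S by rewrite (le_trans EwB)// /S -addrA lerDl addr_ge0.
have EzS : E z <= S by rewrite /S addrAC lerDr addr_ge0.
have small c x : 0 < c -> x <= S -> c / S * x <= c.
  move=> c0 xS; rewrite -mulrA ler_piMr ?(ltW c0)// mulrC ler_pdivrMr// mul1r//.
have e1 := hC _ _ Fw Fz; have e2 := hC _ _ Fz Fw.
have f1 : C * E (fun x => w x - z x) <= e / 8.
  by rewrite (le_trans _ dC)// ler_wpM2l.
have f2 : C * E (fun x => z x - w x) <= e / 8.
  by rewrite (le_trans _ dC)// ler_wpM2l.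
have sw := small _ _ h80 EwS; have sz := small _ _ h80 EzS.
rewrite !mulrDl !mul1r in e1 e2.
have Lzw : L (fun x => z x - w x) <= 2 * (e / 8 / lam / (C' + 1)).
  apply: (le_trans (hC2 _ Fzw)).
  have : C2 * E (fun x => z x - w x) <= C2 * d by rewrite ler_wpM2l.
  move: dC2; lra.
have CL : C' * L (fun x => z x - w x) <= 2 * (e / 8 / lam).
  apply: (@le_trans _ _ (C' * (2 * (e / 8 / lam / (C' + 1))))).
    by rewrite ler_wpM2l.
  by rewrite mulrCA ler_pM2l.
have h8l : 0 < e / 8 / lam by rewrite divr_gt0.
have g1 := hC' _ _ Fw Fz; have g2 := hC' _ _ Fz Fw.
rewrite (L_sym w z) in g1.
have sw' := small _ _ h8l EwS; have sz' := small _ _ h8l EzS.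
have G1 : lam * (G w - G z) <= 3 * (e / 8).
  have -> : 3 * (e / 8) = lam * (3 * (e / 8 / lam)) by field; rewrite gt_eqF.
  by rewrite ler_pM2l//; lra.
have G2 : lam * (G z - G w) <= 3 * (e / 8).
  have -> : 3 * (e / 8) = lam * (3 * (e / 8 / lam)) by field; rewrite gt_eqF.
  by rewrite ler_pM2l//; lra.
by rewrite /action ler_norml; apply/andP; split; lra.
Qed.

(** The closure is taken for the modular instead of a norm. By doubling this
    gives a vector space, and up to null sets it is the Orlicz-Sobolev
    space. *)
Definition energy_closure z := F z /\
  forall e : R, 0 < e -> exists2 w, T w & E (fun x => z x - w x) <= e.

Lemma energy_closure_action z : energy_closure z -> min_action <= action z.
Proof.
move=> [Fz hz]; apply/ler_addgt0Pr => e e0.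
have [d d0 hd] := action_continuous Fz e0.
have [w Tw Ew] := hz d d0.
have := hd w (TF Tw) Ew; have := min_action_le Tw.
rewrite ler_norml => h /andP[_]; lra.
Qed.

Lemma energy_closure_comb u v (a b : R) :
  energy_closure u -> energy_closure v -> energy_closure (fun x => a * u x + b * v x).
Proof.
move=> [Fu hu] [Fv hv]; split; first exact: F_comb.
move=> e e0; pose m := K * (kap a + kap b) + 1.
have m0 : 0 < m by rewrite ltr_wpDl// mulr_ge0// addr_ge0.
have [u' Tu' hu'] := hu _ (divr_gt0 e0 m0).
have [v' Tv' hv'] := hv _ (divr_gt0 e0 m0).
exists (fun x => a * u' x + b * v' x); first exact: T_comb.
have Fuu := F_sub Fu (TF Tu'); have Fvv := F_sub Fv (TF Tv').
have Fa : F (fun x => a * (u x - u' x)).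
  have := F_comb a 0 Fuu Fuu; congr F; apply/funext => x; ring.
have Fb : F (fun x => b * (v x - v' x)).
  have := F_comb b 0 Fvv Fvv; congr F; apply/funext => x; ring.
rewrite (_ : (fun x => _) = (fun x => a * (u x - u' x) + b * (v x - v' x))); last first.
  by apply/funext => x; ring.
apply: (le_trans (E_double Fa Fb)).
apply: (@le_trans _ _ (K * (kap a * (e / m)) + K * (kap b * (e / m)))).
  apply: lerD; rewrite ler_wpM2l//.
    by rewrite (le_trans (E_scale _ Fuu))// ler_wpM2l.
  by rewrite (le_trans (E_scale _ Fvv))// ler_wpM2l.
rewrite -mulrDr -mulrDl mulrA.
apply: (@le_trans _ _ (m * (e / m))).
  by rewrite ler_wpM2r ?divr_ge0 ?(ltW e0) ?(ltW m0)// lerDl.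
by rewrite mulrC divfK// gt_eqF.
Qed.

Lemma energy_closure_limit u : F u ->
  (forall e : R, 0 < e -> exists w, [/\ T w, action w <= min_action + e &
    E (fun x => u x - w x) <= e]) ->
  energy_closure u /\ action u <= min_action.
Proof.
move=> Fu hu; split.
  by split => // e e0; have [w [Tw _ Ew]] := hu e e0; exists w.
apply/ler_addgt0Pr => e e0; have e20 : 0 < e / 2 by rewrite divr_gt0.
have [d d0 hd] := action_continuous Fu e20.
have m0 : 0 < Num.min d (e / 2) by rewrite lt_min d0.
have [w [Tw Iw Ew]] := hu _ m0.
have := hd w (TF Tw); have le1 : Num.min d (e / 2) <= d by rewrite ge_min lexx.
have le2 : Num.min d (e / 2) <= e / 2 by rewrite ge_min lexx orbT.
move=> /(_ (le_trans Ew le1)); rewrite ler_norml => /andP[h _].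
move: Iw le2 h; lra.
Qed.

(** E (t w) decreases like t^p and G (t w) only like t^Q, with Q < p, so the
    action is negative at t w for small t. *)
Lemma min_action_lt0 (p Q : R) w : T w -> 0 < Q -> Q < p -> 0 < G w ->
  (forall t, 0 < t <= 1 -> E (fun x => t * w x) <= t `^ p * E w) ->
  (forall t, 0 < t <= 1 -> t `^ Q * G w <= G (fun x => t * w x)) ->
  min_action < 0.
Proof.
move=> Tw Q0 Qp Gw hE hG.
have pQ : 0 < p - Q by rewrite subr_gt0.
(* t^(p - Q) <= k makes E (t w) at most half of lam * G (t w) *)
pose k := lam * G w / (2 * (E w + 1)).
have E1 : 0 < E w + 1 by rewrite ltr_wpDl.
have k0 : 0 < k by rewrite divr_gt0 ?mulr_gt0.
pose t := Num.min 1 (k `^ (p - Q)^-1).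
have t01 : 0 < t <= 1 by rewrite lt_min ltr01 powR_gt0//= ge_min lexx.
have /andP[t0 t1] := t01.
have tk : t `^ (p - Q) <= k.
  have -> : k = (k `^ (p - Q)^-1) `^ (p - Q).
    by rewrite -powRrM mulVf ?gt_eqF// powRr1// ltW.
  rewrite (ge0_ler_powR (ltW pQ)) ?nnegrE ?powR_ge0 ?(ltW t0)//.
  by rewrite /t ge_min lexx orbT.
have Ttw : T (fun x => t * w x).
  have := T_comb t 0 Tw Tw; congr T; apply/funext => x; ring.
apply: (le_lt_trans (min_action_le Ttw)).
have h1 := hE t t01.
have h2 : lam * (t `^ Q * G w) <= lam * G (fun x => t * w x) by rewrite ler_pM2l// hG.
have tp : t `^ p = t `^ Q * t `^ (p - Q).
  by rewrite -powRD ?(gt_eqF t0) ?implybT// addrC subrK.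
have tQ : 0 < t `^ Q by rewrite powR_gt0.
have h3 : t `^ p * E w < lam * (t `^ Q * G w).
  rewrite tp mulrCA -mulrA ltr_pM2l//.
  apply: (@le_lt_trans _ _ (k * (E w + 1))).
    by apply: ler_pM; rewrite ?powR_ge0// lerDl.
  rewrite /k; have -> : lam * G w / (2 * (E w + 1)) * (E w + 1) = lam * G w / 2.
    by field; rewrite gt_eqF.
  by rewrite ltr_pdivrMr// ltr_pMr ?mulr_gt0// ltr1n.
rewrite /action; lra.
Qed.

End abstract_minimization.

(** * Limits of sequences that are Cauchy for the energy *)

Section energy_fatou.
Context {R : realType} (n : nat) (s : R).
Context (p r : R) (Psi psi : R -> R) (Y : young p r Psi psi).
Local Notation V := 'rV[R]_n.

Lemma limn_einf_le (u : (\bar R)^nat) (C : \bar R) :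
  (forall m, (u m <= C)%E) -> (limn_einf u <= C)%E.
Proof.
move=> uC; rewrite limn_einf_lim; apply: lime_le; first exact: is_cvg_einfs.
near=> m; apply: le_trans (uC m); apply: ereal_inf_lbound.
by exists m => //=.
Unshelve. all: by end_near. Qed.

Lemma energy_fatou (w : nat -> V -> R) (u : V -> R) (C : \bar R) :
  (forall m, measurable_fun setT (w m)) ->
  (forall x, w ^~ x @ \oo --> u x) ->
  (forall m, energy s Psi (w m) <= C)%E -> (energy s Psi u <= C)%E.
Proof.
move=> mw wu wC; rewrite /energy.
have DsC z : (Psi (Ds s (w m) z) * mu_density z)%:E @[m --> \oo] -->
    (Psi (Ds s u z) * mu_density z)%:E.
  apply: cvg_EFin; first by near=> m.
  apply: cvgM; last exact: cvg_cst.
  apply: (@cvg_comp _ _ _ (fun m => Ds s (w m) z) Psi); last exact: (young_continuous Y).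
  apply: cvgM; last exact: cvg_cst.
  by apply: cvgB; exact: wu.
rewrite (_ : (fun z => (Psi (Ds s u z) * mu_density z)%:E) =
    (fun z => limn_einf (fun m => (Psi (Ds s (w m) z) * mu_density z)%:E))); last first.
  by apply/funext => z; rewrite (cvg_limn_einf_sup (DsC z)).1.
apply: le_trans (limn_einf_le wC).
apply: fatou => //.
- by move=> m; exact: measurable_energy Y _ (mw m).
- by move=> m z _; exact: (energy_integrand_ge0 s Y).
Unshelve. all: by end_near. Qed.

End energy_fatou.

Section ae_limit.
Context {R : realType} (n : nat) (s : R) (n0 : (0 < n)%N) (s0 : (0 : R) < s).
Context (p r : R) (Psi psi : R -> R) (Y : young p r Psi psi) (r0 : (0 : R) < r).
Local Notation V := 'rV[R]_n.
Local Notation Leb := (@lebesgue_rV R n).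
Context (Omega : set V) (mOmega : measurable Omega).
Context (M : R) (M0 : (0 : R) < M) (OM : forall x i, Omega x -> `|x 0 i| < M).
Local Notation FE := (finite_energy s Psi Omega).
Local Notation E := (fun u => fine (energy s Psi u)).

(** Summable L1 increments give convergence almost everywhere, and the lemma of
    Fatou carries the energy bounds over to the limit. *)
Lemma finite_energy_limit (v : nat -> V -> R) (d : nat -> R) :
  (forall k, FE (v k)) ->
  (forall k, L1 Omega (fun x => v k.+1 x - v k x) <= 2^-1 ^+ k) ->
  (forall j k, (j <= k)%N -> E (fun x => v j x - v k x) <= d j) ->
  exists2 u, FE u & forall j, E (fun x => u x - v j x) <= d j.
Proof.
move=> Fv Lv Ev.
have mv k : measurable_fun setT (v k) by have [] := Fv k.
have v0 k x : ~ Omega x -> v k x = 0 by have [_ + _] := Fv k; exact.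
have Fd j k : FE (fun x => v j x - v k x) by exact: (finite_energyB Y).
pose a k (x : V) : \bar R := (`|v k.+1 x - v k x|)%:E.
have a0 k x : (0 <= a k x)%E by rewrite lee_fin.
have ma k : measurable_fun setT (a k).
  by apply: measurable_absE; exact: measurable_funB.
pose g x := (\sum_(k <oo) a k x)%E.
have mg : measurable_fun setT g by apply: ge0_emeasurable_sum.
have g0 x : (0 <= g x)%E by exact: nneseries_ge0.
have intg : Leb.-integrable Omega g.
  apply/integrableP; split; first exact: measurable_funTS.
  under eq_integral do rewrite gee0_abs//.
  rewrite integral_nneseries//; last by move=> k; exact: measurable_funTS.
  apply: (@le_lt_trans _ _ (2%:E)); last exact: ltry.
  apply: lime_le; first by apply: is_cvg_nneseries => k _ _; exact: integral_ge0.
  near=> m.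
  apply: (@le_trans _ _ (\sum_(0 <= k < m) ((2^-1 ^+ k)%:E : \bar R))%E).
    apply: lee_sum => k _; rewrite /a (L1_fin n0 s0 Y r0 mOmega M0 OM)//.
    by rewrite lee_fin.
  rewrite sumEFin lee_fin.
  have half_gt0 : (0 : R) < 2^-1 by rewrite invr_gt0.
  have half_lt1 : `|2^-1 : R| < 1 by rewrite gtr0_norm// invf_lt1// ltr1n.
  have h := @geometric_le_lim R m 1 2^-1 ler01 half_gt0 half_lt1.
  apply: (@le_trans _ _ (series (geometric 1 2^-1) m)).
    by rewrite /series/=; apply: ler_sum => k _; rewrite mul1r.
  by apply: (le_trans h); rewrite le_eqVlt; apply/orP; left; apply/eqP; field.
pose Z := [set x | (g x < +oo)%E].
have mZ : measurable Z.
  rewrite (_ : Z = setT `&` g @^-1` (~` [set +oo%E])).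
    by apply: mg => //; exact: measurableC.
  rewrite setTI; apply/seteqP; split => x /=; first by move=> /lt_eqF/eqP.
  by move=> /eqP h; rewrite /Z/= ltey.
(* cut off the null set of divergence, so that the limit exists at every point *)
pose v' k x := v k x * \1_Z x.
have aeZ : {ae Leb, forall x, Z x}.
  have := integrable_ae mOmega intg; apply: filterS => x h.
  have [Ox|Ox] := pselect (Omega x).
    by rewrite /Z/= ltey_eq h.
  rewrite /Z/= /g eseries0 ?ltry// => k _ _.
  by rewrite /a !v0// subrr normr0.
have aev k : {ae Leb, forall x, v' k x = v k x}.
  by move: aeZ; apply: filterS => x Zx; rewrite /v' indicE mem_set// mulr1.
have mv' k : measurable_fun setT (v' k).
  by apply: measurable_funM => //; exact: measurable_indic.
have cv x : cvgn (v' ^~ x).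
  have [Zx|Zx] := pselect (Z x); last first.
    rewrite (_ : v' ^~ x = fun=> 0); first exact: is_cvg_cst.
    by apply/funext => k; rewrite /v' indicE memNset// mulr0.
  have cs : cvgn (series (fun k => v k.+1 x - v k x)).
    apply: normed_cvg; apply: nondecreasing_is_cvgn.
      by apply: nondecreasing_series => k _ /=.
    exists (fine (g x)) => _ [m _ <-]; rewrite -lee_fin fineK ?ge0_fin_numE//.
    rewrite /series/= -sumEFin; exact: nneseries_lim_ge.
  rewrite (_ : v' ^~ x = fun k => v 0%N x + series (fun k => v k.+1 x - v k x) k); last first.
    apply/funext => k; rewrite /v' indicE mem_set// mulr1 /series/= telescope_sumr//.
    by rewrite addrC subrK.
  by apply: is_cvgD => //; exact: is_cvg_cst.
pose u x : R := limn (v' ^~ x).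
have uc x : v' ^~ x @ \oo --> u x by exact: cv.
have mu : measurable_fun setT u by exact: measurable_fun_cvg mv' (fun x _ => uc x).
have u0 x : ~ Omega x -> u x = 0.
  move=> Ox; rewrite /u (_ : v' ^~ x = fun=> 0) ?lim_cst//.
  by apply/funext => k; rewrite /v' v0// mul0r.
have key j : (energy s Psi (fun x => v' j x - u x)%R <= (d j)%:E)%E.
  apply: (energy_fatou Y (w := fun m x => v' j x - v' (j + m)%N x)).
  - by move=> m; exact: measurable_funB.
  - move=> x; apply: cvgB; first exact: cvg_cst.
    by have := uc x; rewrite -(cvg_shiftn j) => h; under eq_cvg do rewrite addnC.
  - move=> m; rewrite (@energy_ae_eq _ _ s p r Psi psi Y _ (fun x => v j x - v (j + m)%N x)).
    + by rewrite (energy_fin Y (Fd _ _)) lee_fin Ev// leq_addr.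
    + exact: measurable_funB.
    + exact: measurable_funB.
    + by move: (aev j) (aev (j + m)%N); apply: filterS2 => x -> ->.
have keyE j : (energy s Psi (fun x => u x - v j x)%R <= (d j)%:E)%E.
  apply: le_trans (key j); rewrite -(energyB s Y) le_eqVlt; apply/orP; left; apply/eqP.
  apply: (energy_ae_eq s Y); [exact: measurable_funB|exact: measurable_funB|].
  by move: (aev j); apply: filterS => x /= ->.
have Fu : FE u.
  have Fu0 : FE (fun x => u x - v 0%N x).
    split; first exact: measurable_funB.
      by move=> x Ox; rewrite u0// v0// subrr.
    by rewrite (le_lt_trans (keyE 0%N))// ltry.
  have := finite_energy_comb Y 1 1 Fu0 (Fv 0%N).
  by congr finite_energy; apply/funext => x; ring.
exists u => // j.
have Fj : FE (fun x => u x - v j x) by exact: (finite_energyB Y).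
by have := keyE j; rewrite (energy_fin Y Fj) lee_fin.
Unshelve. all: by end_near. Qed.

End ae_limit.

(** * The minimiser *)

Section minimizer.
Context {R : realType} (n : nat) (s : R) (n0 : (0 < n)%N) (s0 : (0 : R) < s)
  (s1 : s < (1 : R)).
Context (p r : R) (Psi psi : R -> R) (Y : young p r Psi psi)
  (r0 : (0 : R) < r).
Local Notation V := 'rV[R]_n.
Local Notation Leb := (@lebesgue_rV R n).
Context (Omega : set V) (Omega0 : Omega !=set0) (oOmega : open Omega).
Context (M : R) (M0 : (0 : R) < M) (OM : forall x i, Omega x -> `|x 0 i| < M).
Context (q : V -> R) (mq : measurable_fun Omega q) (Q : R) (Qp : Q < p).
Context (hq : forall x, Omega x -> 1 < q x <= Q).
Implicit Types u v w : V -> R.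

Let mOmega : measurable Omega. Proof. exact: open_measurable_rV. Qed.

Local Notation FE := (finite_energy s Psi Omega).
Local Notation E := (fun u => fine (energy s Psi u)).
Local Notation T := (@test_function R n Omega).
Local Notation kap := (fun c : R => (Num.max 1 `|c|) `^ r).

Lemma test_finite_energy : T `<=` FE.
Proof.
move=> f tf; have [Cf _ _] := tf.
have [B B0 fB] := test_function_bounded tf.
have [L fL] := test_function_lipschitz tf.
have mf : measurable_fun setT f.
  by apply: continuous_measurable_rV; exact: Ck_continuous (Cf 0%N).
have f0 := test_function_off_Omega tf.
have LO := lebesgue_Omega_lty mOmega M0 OM.
split => //; exact: (energy_lipschitz s0 s1 Y B0 mf mOmega LO f0 fB fL).
Qed.

Let E_ge u : 0 <= E u. Proof. exact: (E_ge0 s Y). Qed.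
Let LN u : L1 Omega (fun x => - u x) = L1 Omega u.
Proof. by congr fine; apply: eq_integral => x _; rewrite normrN. Qed.
Let EN u : E (fun x => - u x) = E u.
Proof. by congr fine; exact: (energyN s Y). Qed.
Let K0 : 0 <= 2 `^ r :> R. Proof. exact: powR_ge0. Qed.
Let kap0 (c : R) : 0 <= kap c. Proof. exact: powR_ge0. Qed.
Let F_comb := finite_energy_comb Y (s := s) (Omega := Omega).
Let T_comb (u v : V -> R) (a b : R) (tu : T u) (tv : T v) := test_function_lin a b tu tv.
Let Tn0 : T !=set0. Proof. by exists (fun=> 0); exact: test_function0. Qed.
Let Ep := E_perturb s Y Omega.
Let Ed := E_double Y (s := s) (Omega := Omega).
Let Es c u := @E_scale _ _ s p r Psi psi Y Omega c u.
Let Epar := E_parallelogram Y (s := s) (Omega := Omega).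
Let LE := L1_le_E n0 s0 Y r0 mOmega M0 OM.
Let Gle := G_le n0 s0 Y r0 mOmega M0 OM mq Qp hq.
Let Gdiff := G_diff n0 s0 Y r0 mOmega M0 OM mq Qp hq.

Let Lcp (e : R) : 0 < e -> exists (I : finType) (l : I -> (V -> R) -> R),
  [/\ forall i u v (a b : R), FE u -> FE v ->
        l i (fun x => a * u x + b * v x) = a * l i u + b * l i v,
      forall i u, FE u -> `|l i u| <= L1 Omega u &
      forall w, FE w -> L1 Omega w <= e * (1 + E w) + \sum_i `|l i w|].
Proof.
move=> e0; have [I [A [mA hA]]] := L1_compact n0 s0 Y r0 mOmega M0 OM e0.
have fi := finite_integrable n0 s0 Y r0 mOmega M0 OM.
exists I, (fun i w => \int[Leb]_(x in A i) w x); split => //.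
- move=> i u v a b Fu Fv.
  have iu := fi _ _ (mA i) Fu; have iv := fi _ _ (mA i) Fv.
  have ia (c : R) w : Leb.-integrable (A i) (EFin \o w) ->
      Leb.-integrable (A i) (EFin \o (fun x => c * w x)).
    by move=> iw; exact: (integrableZl (mA i) c iw).
  rewrite RintegralD//; [|exact: ia|exact: ia].
  by rewrite !RintegralZl.
- move=> i u Fu; have iu := fi _ _ (mA i) Fu; have [mu u0 _] := Fu.
  rewrite -lee_fin EFin_normr_Rintegral// -(L1_fin n0 s0 Y r0 mOmega M0 OM Fu).
  apply: le_trans (integral_abs_support (mA i) mu u0).
  by apply: le_abse_integral => //; apply/measurable_EFinP; exact: measurable_funTS.
Qed.

Context (lam : R) (lam0 : (0 : R) < lam).
Local Notation J := (action E (G Omega q) lam).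
Local Notation clos := (energy_closure FE T E).

Lemma energy_closure_linear u v (a b : R) : clos u -> clos v ->
  clos (fun x => a * u x + b * v x).
Proof.
exact: (energy_closure_comb test_finite_energy T_comb F_comb Ed Es K0 kap0).
Qed.

Lemma G_scale w (t : R) : FE w -> 0 < t <= 1 ->
  t `^ Q * G Omega q w <= G Omega q (fun x => t * w x).
Proof.
move=> Fw /[dup] t01 /andP[t0 t1].
have Ftw : FE (fun x => t * w x).
  by have := F_comb t 0 Fw Fw; congr FE; apply/funext => x; ring.
have [mw _ _] := Fw; have [mtw _ _] := Ftw.
have GE := G_fin n0 s0 Y r0 mOmega M0 OM mq Qp hq.
rewrite -lee_fin EFinM -!GE// -ge0_integralZl_EFin//; last 3 first.
- by move=> x Ox; rewrite lee_fin (Gint_ge0 hq).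
- by apply/measurable_EFinP; exact: measurable_Gint mq _ hq _ mw.
- exact: powR_ge0.
apply: ge0_le_integral => //.
- by move=> x Ox; rewrite -EFinM lee_fin mulr_ge0 ?powR_ge0// (Gint_ge0 hq).
- by apply: measurable_funeM; apply/measurable_EFinP; exact: measurable_Gint mq _ hq _ mw.
- by apply/measurable_EFinP; exact: measurable_Gint mq _ hq _ mtw.
move=> x Ox; rewrite -EFinM lee_fin /Gint; have /andP[q1 qQ] := hq Ox.
rewrite mulrA ler_wpM2r ?invr_ge0 ?(le_trans ler01 (ltW q1))//.
rewrite normrM powRM// (gtr0_norm t0) ler_wpM2r ?powR_ge0//.
by rewrite (ger_powR t01).
Qed.

Lemma E_contract w (t : R) : FE w -> 0 < t <= 1 -> E (fun x => t * w x) <= t `^ p * E w.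
Proof.
move=> Fw /andP[t0 t1]; rewrite -[leRHS]addr0 -[X in _ + X](mul0r (E w)).
have Ftw : FE (fun x => t * w x).
  by have := F_comb t 0 Fw Fw; congr FE; apply/funext => x; ring.
have [mw _ _] := Fw; have [mtw _ _] := Ftw.
apply: (E_comb1 Y Ftw Fw Fw); apply: (energy_comb1 Y) => //; rewrite ?powR_ge0//.
move=> z; rewrite mul0r addr0 DsZ.
have ti : 1 <= t^-1 by rewrite invf_ge1.
have := young_scale_ge Y (t * Ds s w z) ti; rewrite mulKf ?gt_eqF// => h.
have tp : 0 < t `^ p by rewrite powR_gt0.
rewrite -ler_pdivrMl// (le_trans _ h)// ler_wpM2r ?(young_ge0 Y)//.
by rewrite -powRN -(powR_inv1 (ltW t0)) -powRrM mulN1r.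
Qed.

Lemma G_positive w (c : V) (h : R) : FE w -> 0 < h -> box c h `<=` Omega ->
  (forall x, box c h x -> 0 < w x) -> 0 < G Omega q w.
Proof.
move=> Fw h0 bO wb; rewrite lt_neqAle (G_ge0 hq) andbT; apply/eqP => G0.
have [mw _ _] := Fw.
have GE := G_fin n0 s0 Y r0 mOmega M0 OM mq Qp hq Fw.
have mG : measurable_fun Omega (fun x => (Gint q w x)%:E).
  by apply/measurable_EFinP; exact: measurable_Gint mq _ hq _ mw.
have : (\int[Leb]_(x in Omega) `|(Gint q w x)%:E| = 0)%E.
  rewrite -[RHS]/(0%:E)%E G0 -GE; apply: eq_integral => x /set_mem Ox.
  by rewrite gee0_abs// lee_fin (Gint_ge0 hq).
move=> /(ae_eq_integral_abs Leb mOmega mG).1 [N [mN N0 hN]].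
have bN : box c h `<=` N.
  move=> x bx; apply: hN => /= H; have Ox := bO _ bx.
  have := H Ox => -[]/eqP; rewrite mulf_eq0 => /orP[|].
    by rewrite powR_eq0 normr_eq0 gt_eqF ?wb.
  have /andP[q1 _] := hq Ox.
  by rewrite invr_eq0 gt_eqF// (lt_trans ltr01).
have : (Leb (box c h) <= Leb N)%E.
  by apply: le_measure; rewrite ?inE//; exact: measurable_box.
by rewrite N0 lebesgue_box ?(ltW h0)// lee_fin leNgt exprn_gt0.
Qed.

(** The rate d of the minimising sequence is chosen such that an energy
    distance d k forces an L1 distance 2^(-k); so finite_energy_limit
    applies. *)
Lemma action_minimizer : exists u, [/\ clos u, J u < 0 &
  forall w, clos w -> J u <= J w].
Proof.
have TF := test_finite_energy.
have e20 (k : nat) : (0 : R) < 2^-1 ^+ k / 2 by rewrite divr_gt0// exprn_gt0.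
have /choice[C hC] : forall k : nat, exists C : R, 0 <= C /\
    forall w, FE w -> L1 Omega w <= 2^-1 ^+ k / 2 + C * E w.
  by move=> k; have [C C0 h] := LE (e20 k); exists C.
pose d (k : nat) : R := Num.min k.+1%:R^-1 (2^-1 ^+ k / 2 / (C k + 1)).
have C1 k : 0 < C k + 1 by rewrite ltr_wpDl//; case: (hC k).
have d0 k : 0 < d k by rewrite lt_min invr_gt0 ltr0n/= divr_gt0.
have [v [Tv Jv Ev]] := minimizing_cauchy lam0 TF T_comb F_comb Tn0 E_ge
  (L1_ge0 Omega) LN Es Epar LE Lcp Gle Gdiff d0.
have Fv k : FE (v k) by exact: TF.
have Lv k : L1 Omega (fun x => v k.+1 x - v k x) <= 2^-1 ^+ k.
  have Fd : FE (fun x => v k.+1 x - v k x) by exact: (finite_energyB Y).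
  have [C0 h] := hC k; apply: (le_trans (h _ Fd)).
  rewrite [leRHS]splitr lerD2l.
  have Edk : E (fun x => v k.+1 x - v k x) <= d k.
    by rewrite (E_sym s Y) Ev// leqnSn.
  apply: (@le_trans _ _ ((C k + 1) * (2^-1 ^+ k / 2 / (C k + 1)))).
    apply: ler_pM => //; first by rewrite lerDl.
    by rewrite (le_trans Edk)// /d ge_min lexx orbT.
  by rewrite mulrC divfK// gt_eqF.
have [u Fu Eu] := finite_energy_limit n0 s0 Y r0 mOmega M0 OM Fv Lv Ev.
have [cu Ju] : clos u /\ J u <= min_action T E (G Omega q) lam.
  apply: (energy_closure_limit lam0 TF F_comb E_ge LN Ep Ed LE Gdiff K0 EN Fu).
  move=> e e0; pose k := Num.truncn e^-1.
  have ke : d k <= e.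
    rewrite /d ge_min; apply/orP; left.
    have ti0 : 0 <= e^-1 by rewrite invr_ge0 ltW.
    by rewrite invf_ple ?posrE// ltW//; have /andP[_ h] := truncn_itv ti0.
  exists (v k); split => //.
    by rewrite (le_trans (Jv k))// lerD2l.
  by rewrite (le_trans (Eu k)).
exists u; split => //.
  apply: (le_lt_trans Ju).
  have [w [Tw w0 [c [h [h0 [bO wb]]]]]] := exists_test_function Omega0 oOmega.
  have Fw := TF _ Tw.
  have Q0 : 0 < Q.
    have [x Ox] := Omega0; have /andP[q1 qQ] := hq Ox.
    exact: lt_le_trans (lt_trans ltr01 q1) qQ.
  apply: (min_action_lt0 lam0 TF T_comb Tn0 E_ge Gle Tw Q0 Qp).
  - exact: G_positive Fw h0 bO wb.
  - by move=> t t01; exact: E_contract.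
  - by move=> t t01; exact: G_scale.
move=> w cw; apply: (le_trans Ju).
exact: (energy_closure_action lam0 TF F_comb Tn0 E_ge LN Ep Ed LE Gle Gdiff K0 EN cw).
Qed.

End minimizer.

(** * The Euler-Lagrange equation *)

Section euler_lagrange.
Context {R : realType} (n : nat) (s : R) (n0 : (0 < n)%N) (s0 : (0 : R) < s).
Context (p r : R) (Psi psi : R -> R) (Y : young p r Psi psi)
  (r0 : (0 : R) < r).
Local Notation V := 'rV[R]_n.
Local Notation Leb := (@lebesgue_rV R n).
Local Notation Leb2 := (@lebesgue2 R n).
Context (Omega : set V) (mOmega : measurable Omega).
Context (M : R) (M0 : (0 : R) < M) (OM : forall x i, Omega x -> `|x 0 i| < M).
Context (q : V -> R) (mq : measurable_fun Omega q) (Q : R) (Qp : Q < p).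
Context (hq : forall x, Omega x -> 1 < q x <= Q).
Implicit Types u v w : V -> R.

Local Notation FE := (finite_energy s Psi Omega).
Local Notation E := (fun u => fine (energy s Psi u)).

(** The first variation of the energy integrand at u in the direction v. *)
Definition flux u v (z : V * V) : R := psi (Ds s u z) * Ds s v z * mu_density z.

Lemma measurable_flux u v : measurable_fun setT u -> measurable_fun setT v ->
  measurable_fun setT (flux u v).
Proof.
move=> mu mv; apply: measurable_funM; last exact: measurable_mu_density.
apply: measurable_funM; last exact: measurable_Ds.
apply: (measurableT_comp (continuous_measurable_fun (young_cont Y))).
exact: measurable_Ds.
Qed.

Lemma energy_integrable u : FE u ->
  Leb2.-integrable setT (EFin \o (fun z => Psi (Ds s u z) * mu_density z)).
Proof.
move=> [mu u0 Eu]; apply/integrableP; split; first exact: (measurable_energy s Y).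
rewrite (eq_integral (fun z => (Psi (Ds s u z) * mu_density z)%:E))//.
by move=> z _; rewrite gee0_abs// (energy_integrand_ge0 s Y).
Qed.

Lemma E_Rintegral u : E u = \int[Leb2]_z (Psi (Ds s u z) * mu_density z).
Proof. by []. Qed.

(** Majorises the flux at u + t v for all t in [0, 1] at once. *)
Definition flux_bound u v (z : V * V) : R :=
  (2 * 2 `^ r) * (Psi (Ds s u z) * mu_density z) +
  (2 * 2 `^ r * 2 `^ r) * (Psi (Ds s v z) * mu_density z).

Lemma flux_bound_integrable u v : FE u -> FE v ->
  Leb2.-integrable setT (EFin \o flux_bound u v).
Proof.
move=> Fu Fv.
have h1 := integrableZl measurableT (2 * 2 `^ r) (energy_integrable Fu).
have h2 := integrableZl measurableT (2 * 2 `^ r * 2 `^ r) (energy_integrable Fv).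
exact: (integrableD measurableT h1 h2).
Qed.

Lemma flux_le_bound u v (t : R) z : 0 <= t <= 1 ->
  `|flux (fun x => u x + t * v x) v z| <= flux_bound u v z.
Proof.
move=> /andP[t0 t1]; rewrite /flux /flux_bound normrM.
rewrite [X in _ * X]ger0_norm ?mu_density_ge0//.
rewrite [X in _ <= X + _]mulrA [X in _ <= _ + X]mulrA -mulrDl ler_wpM2r ?mu_density_ge0//.
set a := Ds s u z; set b := Ds s v z.
have -> : Ds s (fun x => u x + t * v x) z = a + t * b.
  by rewrite /a /b -DsZ -DsD.
apply: (le_trans (young_psi_bound Y _ _)).
have key c : `|c| <= 2 * `|b| -> Psi (a + c) <= 2 `^ r * Psi a + 2 `^ r * 2 `^ r * Psi b.
  move=> cb; apply: (le_trans (young_double Y a c)); rewrite mulrDr lerD2l -mulrA.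
  rewrite ler_pM2l ?powR_gt0//.
  apply: (@le_trans _ _ (Psi (2 * b))).
    by apply: (young_le Y); rewrite normrM (ger0_norm (ler0n R 2)).
  by apply: (young_scale_le Y); rewrite ler1n.
have tb : `|t * b| <= `|b| by rewrite normrM (ger0_norm t0) ler_piMl.
have k1 : Psi (a + t * b + b) <= 2 `^ r * Psi a + 2 `^ r * 2 `^ r * Psi b.
  rewrite -addrA; apply: key; rewrite (le_trans (ler_normD _ _))//.
  by rewrite mulr_natl mulr2n lerD2r.
have k2 : Psi (a + t * b - b) <= 2 `^ r * Psi a + 2 `^ r * 2 `^ r * Psi b.
  rewrite -addrA; apply: key; rewrite (le_trans (ler_normB _ _))//.
  by rewrite mulr_natl mulr2n lerD2r.
lra.
Qed.

Lemma flux_integrable u v (t : R) : FE u -> FE v -> 0 <= t <= 1 ->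
  Leb2.-integrable setT (EFin \o flux (fun x => u x + t * v x) v).
Proof.
move=> Fu Fv t01; have [mu _ _] := Fu; have [mv _ _] := Fv.
apply: le_integrable (flux_bound_integrable Fu Fv) => //.
  apply/measurable_EFinP; apply: measurable_flux => //.
  by apply: measurable_funD => //; exact: measurable_funM.
move=> z _; rewrite /= lee_fin (le_trans (flux_le_bound u v z t01))//.
exact: ler_norm.
Qed.

Lemma flux_limit u v : FE u -> FE v ->
  \int[Leb2]_z flux (fun x => u x + k.+1%:R^-1 * v x) v z @[k --> \oo] -->
  \int[Leb2]_z flux u v z.
Proof.
move=> Fu Fv; have [mu _ _] := Fu; have [mv _ _] := Fv.
have t01 k : 0 <= (k.+1%:R^-1 : R) <= 1 by rewrite invr_ge0 ler0n/= invf_le1// ler1n.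
have Fuu : Leb2.-integrable setT (EFin \o flux u v).
  have := @flux_integrable u v 0 Fu Fv _; rewrite lexx ler01 => /(_ isT).
  rewrite (_ : (fun x => u x + 0 * v x) = u)//.
  by apply/funext => x; rewrite mul0r addr0.
have [|||||_ _ h] := @dominated_convergence _ _ R Leb2 setT measurableT
  (fun k => EFin \o flux (fun x => u x + k.+1%:R^-1 * v x) v) (EFin \o flux u v)
  (EFin \o flux_bound u v).
- move=> k; apply/measurable_EFinP; apply: measurable_flux => //.
  by apply: measurable_funD => //; exact: measurable_funM.
- by apply/measurable_EFinP; exact: measurable_flux.
- apply: aeW => z _; apply: cvg_EFin; first by near=> k.
  apply: cvgM; last exact: cvg_cst.
  apply: cvgM; last exact: cvg_cst.
  have hD : Ds s (fun x => u x + k.+1%:R^-1 * v x) z @[k --> \oo] --> Ds s u z.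
    rewrite (_ : (fun k => _) = (fun k => Ds s u z + k.+1%:R^-1 * Ds s v z)); last first.
      by apply/funext => k; rewrite -DsZ -DsD.
    rewrite -[X in _ --> X]addr0 -[X in _ --> _ + X](mul0r (Ds s v z)).
    apply: cvgD; first exact: cvg_cst.
    by apply: cvgM; [exact: cvg_harmonic|exact: cvg_cst].
  apply: (cvg_comp _ _ hD); exact: (young_cont Y).
- exact: flux_bound_integrable.
- apply: aeW => z k _; rewrite /= lee_fin; exact: flux_le_bound.
have := @fine_cvg _ _ _ _ _ (fine (\int[Leb2]_z (flux u v z)%:E)%E) _.
apply.
rewrite fineK; first exact: h.
exact: integrable_fin_num.
Unshelve. all: by end_near. Qed.

Lemma Gint_integrable u : FE u -> Leb.-integrable Omega (EFin \o Gint q u).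
Proof.
move=> Fu; have [mu _ _] := Fu; apply/integrableP; split.
  by apply/measurable_EFinP; exact: measurable_Gint mq _ hq _ mu.
rewrite (eq_integral (fun x => (Gint q u x)%:E)).
  by rewrite (G_fin n0 s0 Y r0 mOmega M0 OM mq Qp hq Fu) ltry.
by move=> x /set_mem Ox; rewrite gee0_abs// lee_fin (Gint_ge0 hq).
Qed.

Lemma rhs_integrable u v : FE u -> FE v ->
  Leb.-integrable Omega (EFin \o rhs_integrand q u v).
Proof.
move=> Fu Fv; have [mu _ _] := Fu; have [mv _ _] := Fv.
have h1 := integrableZl mOmega Q (Gint_integrable Fu).
have h := integrableD mOmega h1 (Gint_integrable Fv).
apply: le_integrable h => //.
  by apply/measurable_EFinP; exact: measurable_rhs.
move=> x Ox; rewrite /= lee_fin.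
have /andP[q1 qQ] := hq Ox; have q0 : 0 < q x by exact: lt_trans q1.
apply: le_trans (ler_norm _).
rewrite /rhs_integrand normrM powR_sub1//.
apply: (le_trans (young_powR q1 (normr_ge0 _) (normr_ge0 _))).
rewrite /Gint lerD2r.
have c0 : 0 <= `|u x| `^ q x / q x by rewrite divr_ge0 ?powR_ge0// ltW.
apply: (@le_trans _ _ (q x * (`|u x| `^ q x / q x))); last by rewrite ler_wpM2r.
by rewrite [leRHS]mulrC divfK ?gt_eqF// gerBl.
Qed.

Context (lam : R) (lam0 : (0 : R) < lam).
Local Notation J := (action E (G Omega q) lam).

(** Convexity alone: the tangent at u + t v bounds the increment of the energy
    from above, the tangent at u bounds that of G from below. *)
Lemma action_increment u v (t : R) : FE u -> FE v -> 0 < t <= 1 ->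
  J (fun x => u x + t * v x) - J u <=
  t * (\int[Leb2]_z flux (fun x => u x + t * v x) v z -
       lam * \int[Leb]_(x in Omega) rhs_integrand q u v x).
Proof.
move=> Fu Fv /andP[t0 t1].
have t01 : 0 <= t <= 1 by rewrite ltW.
set ut := fun x => u x + t * v x.
have Fut : FE ut.
  by have := finite_energy_comb Y 1 t Fu Fv; congr FE; apply/funext => x; rewrite /ut; ring.
have iF := flux_integrable Fu Fv t01.
have iu := energy_integrable Fu; have iut := energy_integrable Fut.
have hE : E ut <= E u + t * \int[Leb2]_z flux ut v z.
  rewrite !E_Rintegral -RintegralZl//.
  have itF : Leb2.-integrable setT (EFin \o (fun z => t * flux ut v z)).
    exact: (integrableZl measurableT t iF).
  rewrite -RintegralD//; apply: le_Rintegral => //.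
    exact: (integrableD measurableT iu itF).
  move=> z _; rewrite /flux mulrA -mulrDl ler_wpM2r ?mu_density_ge0//.
  have := young_tangent Y (Ds s ut z) (Ds s u z).
  have -> : Ds s u z - Ds s ut z = - (t * Ds s v z).
    have -> : Ds s ut z = Ds s u z + t * Ds s v z by rewrite -DsZ -DsD.
    by ring.
  rewrite mulrN mulrCA; lra.
have ir := rhs_integrable Fu Fv.
have gu := Gint_integrable Fu; have gut := Gint_integrable Fut.
have hG : G Omega q u + t * \int[Leb]_(x in Omega) rhs_integrand q u v x <= G Omega q ut.
  rewrite -RintegralZl//.
  have itr : Leb.-integrable Omega (EFin \o (fun x => t * rhs_integrand q u v x)).
    exact: (integrableZl mOmega t ir).
  rewrite -[G Omega q u]/(\int[Leb]_(x in Omega) Gint q u x).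
  rewrite -[G Omega q ut]/(\int[Leb]_(x in Omega) Gint q ut x).
  rewrite -RintegralD//; apply: le_Rintegral => //.
    exact: (integrableD mOmega gu itr).
  move=> x Ox; have /andP[q1 qQ] := hq Ox.
  have := powR_tangent (u x) (ut x) q1; rewrite /Gint /rhs_integrand.
  have -> : ut x - u x = t * v x by rewrite /ut; ring.
  by rewrite [X in _ + X <= _ -> _]mulrCA.
have : lam * (G Omega q u + t * \int[Leb]_(x in Omega) rhs_integrand q u v x) <=
   lam * G Omega q ut by rewrite ler_pM2l.
rewrite /action; move: hE; set A := \int[Leb2]_z _; set B := \int[Leb]_(x in Omega) _.
lra.
Qed.

(** Take t = 1 / (k + 1) in action_increment and let k grow; the flux converges
    by dominated convergence. *)
Lemma euler_lagrange_ge u v : FE u -> FE v ->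
  (forall t, 0 < t -> J u <= J (fun x => u x + t * v x)) ->
  lam * \int[Leb]_(x in Omega) rhs_integrand q u v x <= \int[Leb2]_z flux u v z.
Proof.
move=> Fu Fv hmin.
have hlim := flux_limit Fu Fv.
rewrite -(cvg_lim _ hlim)//; apply: limr_ge; first by apply/cvg_ex; exists (\int[Leb2]_z flux u v z).
near=> k.
have k0 : 0 < k.+1%:R^-1 :> R by rewrite invr_gt0.
have k01 : 0 < (k.+1%:R^-1 : R) <= 1 by rewrite k0 invf_le1// ler1n.
have := action_increment Fu Fv k01; have := hmin _ k0.
rewrite -subr_ge0 => h1 /(le_trans h1).
by rewrite pmulr_rge0// subr_ge0.
Unshelve. all: by end_near. Qed.

Lemma euler_lagrange u v : FE u -> FE v ->
  (forall t, J u <= J (fun x => u x + t * v x)) ->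
  \int[Leb2]_z flux u v z = lam * \int[Leb]_(x in Omega) rhs_integrand q u v x.
Proof.
move=> Fu Fv hmin; apply/eqP; rewrite eq_le euler_lagrange_ge// andbT.
have Fnv : FE (fun x => - 1 * v x).
  by have := finite_energy_comb Y (- 1) 0 Fv Fv; congr FE; apply/funext => x; ring.
have := @euler_lagrange_ge u (fun x => - 1 * v x) Fu Fnv _.
have -> : \int[Leb2]_z flux u (fun x => - 1 * v x) z = - 1 * \int[Leb2]_z flux u v z.
  rewrite -RintegralZl//; last first.
    have := @flux_integrable u v 0 Fu Fv _; rewrite lexx ler01 => /(_ isT).
    rewrite (_ : (fun x => u x + 0 * v x) = u)//.
    by apply/funext => x; rewrite mul0r addr0.
  by apply: eq_Rintegral => z _; rewrite /flux DsZ; ring.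
have -> : \int[Leb]_(x in Omega) rhs_integrand q u (fun x => - 1 * v x) x =
    - 1 * \int[Leb]_(x in Omega) rhs_integrand q u v x.
  rewrite -RintegralZl//; last exact: rhs_integrable.
  by apply: eq_Rintegral => x _; rewrite /rhs_integrand; ring.
rewrite mulrCA !mulN1r lerN2; apply.
move=> t t0; have := hmin (- t).
by rewrite (_ : (fun x => u x + - t * v x) = (fun x => u x + t * (- 1 * v x)))//; apply/funext => x; ring.
Qed.

End euler_lagrange.

(** * The Orlicz-Sobolev space and the energy *)

Section space_translation.
Context {R : realType} (n : nat) (s : R) (n0 : (0 < n)%N) (s0 : (0 : R) < s)
  (s1 : s < (1 : R)).
Context (a : 'I_n -> R -> R) (p r : R) (r0 : (0 : R) < r).
Context (Ya : forall i, young p r (fun t => Phi (a i) `|t|) (phi (a i))).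
Local Notation V := 'rV[R]_n.
Local Notation Leb := (@lebesgue_rV R n).
Local Notation Leb2 := (@lebesgue2 R n).
Context (Omega : set V) (Omega0 : Omega !=set0) (oOmega : open Omega).
Context (M : R) (M0 : (0 : R) < M) (OM : forall x i, Omega x -> `|x 0 i| < M).
Implicit Types u v w : V -> R.

Definition Phi_total (t : R) : R := \sum_(i < n) Phi (a i) `|t|.
Definition phi_total (t : R) : R := \sum_(i < n) phi (a i) t.

Lemma young_Phi_total : young p r Phi_total phi_total.
Proof. exact: (young_sum (Ordinal n0) Ya). Qed.

Let Y := young_Phi_total.
Let mOmega : measurable Omega. Proof. exact: open_measurable_rV. Qed.

Local Notation FE := (finite_energy s Phi_total Omega).
Local Notation E := (fun u => fine (energy s Phi_total u)).
Local Notation T := (@test_function R n Omega).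
Local Notation clos := (energy_closure FE T E).
Local Notation Psii i := (fun t : R => Phi (a i) `|t|).

Lemma measurable_Qset : measurable (Qset Omega).
Proof. by apply: measurableC; apply: measurableX; exact: measurableC. Qed.

Lemma off_Qset (z : V * V) : ~ Qset Omega z -> ~ Omega z.1 /\ ~ Omega z.2.
Proof. by move=> /contrapT. Qed.

Lemma integral_Qset (f : V * V -> \bar R) :
  (forall z, ~ Qset Omega z -> f z = 0%E) ->
  (\int[Leb2]_(z in Qset Omega) f z = \int[Leb2]_z f z)%E.
Proof.
move=> f0; rewrite integral_mkcond; congr (integral _ _ _).
apply/funext => z; rewrite patchE; case: ifPn => // /negP zQ.
by rewrite f0// => /mem_set.
Qed.

Lemma energy_sum w : measurable_fun setT w ->
  (energy s Phi_total w = \sum_(i < n) energy s (Psii i) w)%E.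
Proof.
move=> mw; rewrite /energy -ge0_integral_sum//.
- by apply: eq_integral => z _; rewrite /Phi_total sumEFin mulr_suml.
- by move=> i; exact: (measurable_energy s (Ya i)).
- by move=> i z _; exact: (energy_integrand_ge0 s (Ya i)).
Qed.

Lemma seminorm_ge0 i w : (0 <= seminorm s Omega (a i) w)%E.
Proof. by apply: le_ereal_inf_tmp => _ [l [l0 _] <-]; rewrite lee_fin ltW. Qed.

Lemma Ds_norm_scale w (l : R) z : 0 < l ->
  `|Ds s (fun x => l^-1 * w x) z| = `|Ds s w z| / l.
Proof. by move=> l0; rewrite DsZ normrM mulrC [X in _ * X]gtr0_norm ?invr_gt0. Qed.

Lemma seminorm_le i w (l : R) : measurable_fun setT w -> 0 < l ->
  (energy s (Psii i) (fun x => l^-1 * w x)%R <= 1)%E ->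
  (seminorm s Omega (a i) w <= l%:E)%E.
Proof.
move=> mw l0 h; apply: ereal_inf_lbound; exists l; last by [].
split; first exact: l0.
apply: le_trans h.
rewrite (_ : energy _ _ _ = \int[Leb2]_z (Phi (a i) (`|Ds s w z| / l) * mu_density z)%:E)%E; last first.
  by apply: eq_integral => z _; rewrite Ds_norm_scale.
have mf : measurable_fun setT (fun z => (Phi (a i) (`|Ds s w z| / l) * mu_density z)%:E).
  have mlw : measurable_fun setT (fun x => l^-1 * w x) by exact: measurable_funM.
  have := measurable_energy s (Ya i) mlw.
  by congr measurable_fun; apply/funext => z; rewrite Ds_norm_scale.
apply: ge0_subset_integral => //; first exact: measurable_Qset.
move=> z _; rewrite lee_fin mulr_ge0 ?mu_density_ge0//.
have := young_ge0 (Ya i) (Ds s w z / l).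
by rewrite normrM [X in _ * X]gtr0_norm ?invr_gt0.
Qed.

Lemma energy_component_le i w : measurable_fun setT w ->
  (energy s (Psii i) w <= energy s Phi_total w)%E.
Proof.
move=> mw; rewrite energy_sum// (bigD1 i)//= leeDl//.
by apply: sume_ge0 => k _; exact: energy_ge0 (Ya k) _.
Qed.

(** A difference of energy at most 1 / k, where k bounds the effect of scaling
    by 1 / l, has all seminorms at most l. *)
Lemma energy_closure_Wspace u : clos u -> Wspace s Omega a u.
Proof.
move=> [Fu hu]; have [mu u0 Eu] := Fu; split => //.
  by apply: aeW => x; exact: u0.
move=> e e0; pose l := e / 2 / n%:R.
have nR : (0 : R) < n%:R by rewrite ltr0n.
have l0 : 0 < l by rewrite !divr_gt0.
pose k : R := (Num.max 1 `|l^-1|) `^ r.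
have k0 : 0 < k by rewrite powR_gt0// lt_max ltr01.
have [w Tw Ew] := hu k^-1 (ltac:(by rewrite invr_gt0)).
have Fw := test_finite_energy s0 s1 Y oOmega M0 OM Tw.
have Fuw : FE (fun x => u x - w x) by exact: (finite_energyB Y).
have [muw _ _] := Fuw.
exists w => //; apply: (@le_lt_trans _ _ (\sum_(i < n) l%:E)%E).
  apply: lee_sum => i _; apply: seminorm_le => //.
  apply: le_trans (energy_scale s (Ya i) l^-1 muw) _.
  apply: (@le_trans _ _ (k%:E * energy s Phi_total (fun x => u x - w x)%R)%E).
    by rewrite lee_wpmul2l ?lee_fin ?(ltW k0)// energy_component_le.
  rewrite (energy_fin Y Fuw) -EFinM lee_fin.
  by rewrite -ler_pdivlMl// mulr1.
rewrite sumEFin lte_fin sumr_const card_ord -mulr_natr /l divfK ?gt_eqF//.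
by rewrite ltr_pdivrMr// ltr_pMr// ltr1n.
Qed.

(** By convexity, a Luxemburg norm l <= 1 bounds the modular by l. *)
Lemma seminorm_lt i w (d : R) : measurable_fun setT w -> d <= 1 ->
  (seminorm s Omega (a i) w < d%:E)%E ->
  (\int[Leb2]_(z in Qset Omega) (Phi (a i) `|Ds s w z| * mu_density z)%:E <= d%:E)%E.
Proof.
move=> mw d1 /ereal_inf_lt [_ [l [l0 hl] <-]]; rewrite lte_fin => ld.
have mQ := measurable_Qset.
have l1 : l <= 1 by rewrite (le_trans (ltW ld)).
apply: (@le_trans _ _ (l%:E * \int[Leb2]_(p0 in Qset Omega)
   (Phi (a i) (`|Ds s w p0| / l) * mu_density p0)%:E)%E); last first.
  apply: (@le_trans _ _ (l%:E * 1)%E).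
    by rewrite lee_wpmul2l// lee_fin ltW.
  by rewrite mule1 lee_fin ltW.
have PE z : Phi (a i) (`|Ds s w z| / l) = Phi (a i) `|Ds s (fun x => l^-1 * w x) z|.
  by rewrite Ds_norm_scale.
have mlw : measurable_fun setT (fun x => l^-1 * w x) by exact: measurable_funM.
under [X in (_ <= _ * X)%E]eq_integral do rewrite PE.
have P0 z : (0 <= (Phi (a i) `|Ds s (fun x => l^-1 * w x) z| * mu_density z)%:E)%E.
  exact: (energy_integrand_ge0 s (Ya i)).
have mP : measurable_fun (Qset Omega) (fun z =>
    (Phi (a i) `|Ds s (fun x => l^-1 * w x) z| * mu_density z)%:E).
  by apply: measurable_funTS; exact: (measurable_energy s (Ya i)).
rewrite -ge0_integralZl_EFin//; last exact: ltW.
apply: ge0_le_integral => //.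
- by move=> z _; exact: (energy_integrand_ge0 s (Ya i)).
- by apply: measurable_funTS; exact: (measurable_energy s (Ya i)).
- exact: measurable_funeM.
move=> z _; rewrite -EFinM lee_fin mulrA ler_wpM2r ?mu_density_ge0//.
have l01 : 0 <= l <= 1 by rewrite ltW.
have := young_contract (Ya i) (Ds s (fun x => l^-1 * w x) z) l01.
by rewrite DsZ mulrA divff ?gt_eqF// mul1r.
Qed.

(** Members of the space vanish outside Omega only almost everywhere; this
    representative vanishes there everywhere and so has an energy
    concentrated on Q. *)
Definition cutoff v : V -> R := v \_ Omega.

Lemma cutoff_in v x : Omega x -> cutoff v x = v x.
Proof. by move=> Ox; rewrite /cutoff patchE mem_set. Qed.

Lemma cutoff_out v x : ~ Omega x -> cutoff v x = 0.
Proof. by move=> Ox; rewrite /cutoff patchE memNset. Qed.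

Lemma measurable_cutoff v : measurable_fun setT v -> measurable_fun setT (cutoff v).
Proof.
move=> mv; apply/(measurable_restrictT _ _).1 => //; exact: measurable_funTS.
Qed.

Lemma cutoff_ae v : Wspace s Omega a v -> {ae Leb, forall x, cutoff v x = v x}.
Proof.
move=> [_ v0 _]; move: v0; apply: filterS => x vx.
have [Ox|Ox] := pselect (Omega x); first exact: cutoff_in.
by rewrite cutoff_out// vx.
Qed.

(** Small seminorms bound the modular over Q, and for the representative that
    is the whole energy. *)
Lemma cutoff_energy_closure v : Wspace s Omega a v -> clos (cutoff v).
Proof.
move=> Wv; have aev := cutoff_ae Wv; have [mv v0 hv] := Wv.
have mc := measurable_cutoff mv.
have nR : (0 : R) < n%:R by rewrite ltr0n.
have approx e : 0 < e -> exists2 w, T w &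
    (energy s Phi_total (fun x => cutoff v x - w x)%R <= e%:E)%E.
  move=> e0; pose d := Num.min 1 (e / n%:R).
  have d0 : 0 < d by rewrite lt_min ltr01 divr_gt0.
  have d1 : d <= 1 by rewrite ge_min lexx.
  have [w Tw hw] := hv d d0; exists w => //.
  have [Cw _ _] := Tw.
  have mw : measurable_fun setT w.
    by apply: continuous_measurable_rV; exact: Ck_continuous (Cw 0%N).
  have mvw : measurable_fun setT (fun x => v x - w x) by exact: measurable_funB.
  have mcw : measurable_fun setT (fun x => cutoff v x - w x) by exact: measurable_funB.
  rewrite energy_sum//.
  apply: (@le_trans _ _ (\sum_(i < n) d%:E)%E); last first.
    rewrite sumEFin lee_fin sumr_const card_ord -mulr_natr -ler_pdivlMr//.
    by rewrite /d ge_min lexx orbT.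
  apply: lee_sum => i _.
  have hi : (seminorm s Omega (a i) (fun x => v x - w x)%R < d%:E)%E.
    apply: le_lt_trans hw; rewrite /anorm (bigD1 i)//= leeDl//.
    by apply: sume_ge0 => k _; exact: seminorm_ge0.
  apply: le_trans (seminorm_lt mvw d1 hi).
  rewrite -[leLHS]integral_Qset; last first.
    move=> z /off_Qset[z1 z2]; rewrite /Ds !cutoff_out// !(test_function_off_Omega Tw)//.
    by rewrite subrr mul0r normr0 Phi0 mul0r.
  rewrite le_eqVlt; apply/orP; left; apply/eqP; apply: ge0_ae_eq_integral => //.
  - exact: measurable_Qset.
  - by apply: measurable_funTS; exact: (measurable_energy s (Ya i)).
  - by apply: measurable_funTS; exact: (measurable_energy s (Ya i)).
  - by move=> z _; exact: (energy_integrand_ge0 s (Ya i)).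
  - by move=> z _; exact: (energy_integrand_ge0 s (Ya i)).
  - have := ae_lebesgue2 aev; apply: filterS => z [e1 e2] _.
    by rewrite /Ds e1 e2.
have Fdiff e w : T w -> (energy s Phi_total (fun x => cutoff v x - w x)%R <= e%:E)%E ->
    FE (fun x => cutoff v x - w x).
  move=> Tw h; have [Cw _ _] := Tw; split.
  - apply: measurable_funB => //; apply: continuous_measurable_rV.
    exact: Ck_continuous (Cw 0%N).
  - by move=> x Ox; rewrite cutoff_out// (test_function_off_Omega Tw)// subrr.
  - by rewrite (le_lt_trans h)// ltry.
split.
  have [w Tw h] := approx 1 ltr01.
  have Fw := test_finite_energy s0 s1 Y oOmega M0 OM Tw.
  have := finite_energy_comb Y 1 1 (Fdiff _ _ Tw h) Fw.
  by congr finite_energy; apply/funext => x; ring.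
move=> e e0; have [w Tw h] := approx e e0; exists w => //.
by have := h; rewrite (energy_fin Y (Fdiff _ _ Tw h)) lee_fin.
Qed.

Context (q : V -> R) (mq : measurable_fun Omega q) (Q : R) (Qp : Q < p).
Context (hq : forall x, Omega x -> 1 < q x <= Q).

Lemma lhs_integrandE u v z : lhs_integrand s a u v z = flux s phi_total u v z.
Proof. by rewrite /lhs_integrand /flux /phi_total -mulr_suml. Qed.

(** The minimiser is not zero, since its action is negative and that of 0 is 0.
    Its Euler-Lagrange equation holds for the representative of every
    direction v, hence for v itself. *)
Lemma eigenvalue_of_positive (lam : R) : 0 < lam -> weak_eigenvalue s Omega a q lam.
Proof.
move=> lam0; have lam0' : (0 : R) < lam by [].
have mQ := measurable_Qset.
have [u [cu Ju hu]] := action_minimizer n0 s0 s1 Y r0 Omega0 oOmega M0 OM mq Qp hq lam0'.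
have [Fu _] := cu; have [mu u0 Eu] := Fu.
exists u; split; first exact: energy_closure_Wspace.
  move=> ae0; have E0 : E u = 0.
    rewrite (_ : energy s Phi_total u = 0%E)//.
    by rewrite (energy_ae_eq s Y mu (measurable_cst (0 : R)) ae0) (energy0 _ s Y).
  have G0 : G Omega q u = 0.
    rewrite /G (_ : (\int[Leb]_(x in Omega) _ = 0)%E)//.
    rewrite (ge0_ae_eq_integral (g := fun=> 0%E) mOmega)//.
    - by rewrite integral0.
    - by apply/measurable_EFinP; exact: measurable_Gint mq _ hq _ mu.
    - by move=> x Ox; rewrite lee_fin (Gint_ge0 hq).
    - move: ae0; apply: filterS => x ux Ox; rewrite /Gint ux normr0.
      have /andP[q1 _] := hq Ox.
      by rewrite powR0 ?mul0r// gt_eqF// (lt_trans ltr01).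
  by move: Ju; rewrite /action E0 G0 mulr0 subr0 ltxx.
move=> v Wv; have cv := cutoff_energy_closure Wv; have [Fv _] := cv.
have aev := cutoff_ae Wv; have [mv _ _] := Wv; have mc := measurable_cutoff mv.
have fluxI : Leb2.-integrable setT (EFin \o flux s phi_total u (cutoff v)).
  have := @flux_integrable _ _ s p r Phi_total phi_total Y Omega u (cutoff v) 0 Fu Fv.
  rewrite lexx ler01 => /(_ isT).
  rewrite (_ : (fun x => u x + 0 * cutoff v x) = u)//.
  by apply/funext => x; rewrite mul0r addr0.
have aeflux : {ae Leb2, forall z, Qset Omega z ->
    (lhs_integrand s a u v z)%:E = (flux s phi_total u (cutoff v) z)%:E}.
  have := ae_lebesgue2 aev; apply: filterS => z [e1 e2] _.
  by rewrite lhs_integrandE /flux /Ds e1 e2.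
have mlhs : measurable_fun setT (fun z => (lhs_integrand s a u v z)%:E).
  apply/measurable_EFinP; rewrite (_ : lhs_integrand s a u v = flux s phi_total u v).
    exact: (measurable_flux s Y mu mv).
  by apply/funext => z; exact: lhs_integrandE.
have mflux : measurable_fun setT (fun z => (flux s phi_total u (cutoff v) z)%:E).
  by apply/measurable_EFinP; exact: (measurable_flux s Y mu mc).
have rhsE x : Omega x -> rhs_integrand q u v x = rhs_integrand q u (cutoff v) x.
  by move=> Ox; rewrite /rhs_integrand cutoff_in.
have rhsI := rhs_integrable n0 s0 Y r0 mOmega M0 OM mq Qp hq Fu Fv.
have EL := @euler_lagrange _ n s n0 s0 p r Phi_total phi_total Y r0 Omega mOmega M M0 OM q mq
  Q Qp hq lam lam0' u (cutoff v) Fu Fv _.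
have {}EL : \int[Leb2]_z flux s phi_total u (cutoff v) z =
    lam * \int[Leb]_(x in Omega) rhs_integrand q u (cutoff v) x.
  apply: EL => t; apply: hu.
  have := energy_closure_linear s0 s1 Y oOmega M0 OM 1 t cu cv.
  by congr energy_closure; apply/funext => x; ring.
split.
- apply/integrableP; split; first exact: measurable_funTS.
  rewrite (ge0_ae_eq_integral (g := fun z => `|(flux s phi_total u (cutoff v) z)%:E|%E) mQ)//.
  + have /integrableP[_ h] := integrableS measurableT mQ (@subsetT _ _) fluxI.
    exact: h.
  + by apply: measurableT_comp => //; exact: measurable_funTS.
  + by apply: measurableT_comp => //; exact: measurable_funTS.
  + by move: aeflux; apply: filterS => z hz Qz; congr abse; exact: hz.
- apply: eq_integrable rhsI => // x /set_mem Ox /=.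
  by rewrite rhsE.
have -> : (\int[Leb2]_(z in Qset Omega) (lhs_integrand s a u v z)%:E =
    \int[Leb2]_(z in Qset Omega) (flux s phi_total u (cutoff v) z)%:E)%E.
  by apply: ae_eq_integral => //; exact: measurable_funTS.
rewrite integral_Qset; last first.
  move=> z /off_Qset[z1 z2].
  by rewrite /flux {2}/Ds !cutoff_out// subrr mul0r mulr0 mul0r.
rewrite (eq_integral (fun x => (rhs_integrand q u (cutoff v) x)%:E)); last first.
  by move=> x /set_mem Ox; rewrite rhsE.
have f1 := integrable_fin_num measurableT fluxI.
have f2 := integrable_fin_num mOmega rhsI.
by rewrite -(fineK f1) -(fineK f2) -EFinM; congr EFin; exact: EL.
Qed.

End space_translation.

(** * The eigenvalue problem *)

Section continuous_on_closure.
Context {R : realType} (n : nat).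
Local Notation V := 'rV[R]_n.

Lemma compact_closure_bounded (A : set V) :
  bounded_set A -> compact (closure A).
Proof.
move=> /bounded_coord[M M0 AM].
have AB : closure A `<=` [set x : V | `|x| <= M].
  have cB : closed [set x : V | `|x| <= M].
    apply: (@preimage_closed _ _ (fun x : V => `|x|) [set t : R | t <= M]).
      by move=> x _; exact: norm_continuous.
    exact: closed_le.
  rewrite [X in _ `<=` X](closure_id _).1//; apply: closureS => x Ax /=.
  rewrite [leLHS]/Num.norm /= mx_normrE; apply: bigmax_le; first exact: ltW.
  by move=> [i k] _ /=; rewrite (ord1 i); apply/ltW/AM.
apply: bounded_closed_compact; last exact: closed_closure.
exists M; split; first exact: num_real.
by move=> K MK x /AB /= xM; apply: (le_trans xM); exact: ltW.
Qed.

Lemma le_sup_image_compact (A : set V) (f : V -> R) x : compact A ->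
  {within A, continuous f} -> A x -> f x <= sup (f @` A).
Proof.
move=> cA cf Ax; have A0 : A !=set0 by exists x.
have [c _ fc] := EVT_max_rV A0 cA cf.
apply: ub_le_sup; last by exists x.
by exists (f c) => _ [y Ay <-]; apply: fc; exact: mem_set.
Qed.

End continuous_on_closure.
Theorem theorem3p3 (R : realType) (N : nat) (hN : (1 <= N)%N)
    (s : R) (hs0 : 0 < s) (hs1 : s < 1)
    (Omega : set 'rV[R]_N)
    (hOmega0 : Omega !=set0) (hOmega_open : open Omega)
    (hOmega_bounded : bounded_set Omega)
    (hOmega_lip : lipschitz_boundary Omega)
    (q : 'rV[R]_N -> R)
    (hq_cont : {within closure Omega, continuous q})
    (hq_gt1 : forall x, closure Omega x -> 1 < q x)
    (a : 'I_N -> R -> R)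
    (ha_homeo : forall i, increasing_homeomorphism (phi (a i)))
    (ha_index : forall i, [/\ (1 < phi_minus (a i))%E,
       (phi_minus (a i) <= phi_plus (a i))%E & (phi_plus (a i) < +oo)%E])
    (ha_convex : forall i, convex_function (`[0, +oo[ : set R^o)
       (fun t => Phi (a i) (Num.sqrt t)))
    (j : 'I_N)
    (hj_zero : (\int[lebesgue_measure]_(t in `]0%R, 1%R])
       (sobolev_integrand N s (a j) t)%:E < +oo)%E)
    (hj_infty : (\int[lebesgue_measure]_(t in `[1%R, +oo[)
       (sobolev_integrand N s (a j) t)%:E = +oo)%E)
    (hj_growth : forall k : R, 0 < k ->
       t `^ sup (q @` closure Omega) / Phi_star N s (a j) (k * t)
         @[t --> +oo] --> 0)
    (hq_phi : ((sup (q @` closure Omega))%:E < phi_minus_min a)%E) :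
  exists lambda_low lambda_high : R,
    [/\ 0 < lambda_low, 0 < lambda_high &
      forall lambda : R,
        0 < lambda < lambda_low \/ lambda_high <= lambda ->
        weak_eigenvalue s Omega a q lambda].
Proof.
have [M M0 OM] := bounded_coord hOmega_bounded.
have cO := compact_closure_bounded hOmega_bounded.
have [p [r [Qp r0 Ya]]] := young_exponents j ha_homeo ha_index ha_convex hq_phi.
have hq x : Omega x -> 1 < q x <= sup (q @` closure Omega).
  move=> /subset_closure Ox; rewrite hq_gt1//=.
  exact: le_sup_image_compact.
have mq : measurable_fun Omega q.
  apply: measurable_fun_continuous_open => //.
  by apply: continuous_subspaceW hq_cont; exact: subset_closure.
exists 1, 1; split => // lambda hl.
have lambda0 : 0 < lambda.
  by case: hl => [/andP[]//|]; exact: lt_le_trans.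
exact: (eigenvalue_of_positive hN hs0 hs1 r0 Ya hOmega0 hOmega_open M0 OM
  mq Qp hq lambda0).
Qed.
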